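(* Let $w\in A_\infty$ be a weight on $\mathbb{R}^n$, let $0<p<\infty$, and let $N$ be an integer with $N\ge s_w=\lfloor n(\frac{r_w}{p}-1)\rfloor_+$. Then there is a constant $C$ such that for each $f\in\mathcal{O}_N\cap H^p(w)$ there exist a finite sequence of non-negative numbers $\{\lambda_k\}_k$ and a (finite) sequence $\{a_k\}_k$ of $(N,\infty)$ atoms, with $\operatorname{supp}(a_k)\subset Q_k$ for cubes $Q_k$, such that $f=\sum_k\lambda_ka_k$ and $$\Big\|\sum_k\lambda_k\chi_{Q_k}\Big\|_{L^p(w)}\le C\|f\|_{H^p(w)}.$$
   Context: Notation: $\lfloor x\rfloor_+=\max(0,\lfloor x\rfloor)$; $\chi_Q$ is the indicator function of $Q$. Cubes have sides parallel to the axes. Weights: a weight is a locally integrable function $w$ on $\mathbb{R}^n$ with $0<w<\infty$ a.e. For $1<r<\infty$, $w\in A_r$ (Muckenhoupt class) if $\sup_Q \big(\frac1{|Q|}\int_Q w\big)\big(\frac1{|Q|}\int_Q w^{1-r'}\big)^{r-1}<\infty$, the supremum over all cubes, $r'=r/(r-1)$; $w\in A_1$ if there is $C$ with $\frac1{|Q|}\int_Q w\le Cw(x)$ for every cube $Q$ and a.e. $x\in Q$. $A_\infty=\bigcup_{r\ge1}A_r$. For $w\in A_\infty$, $r_w=\inf\{r\in(1,\infty): w\in A_r\}$. $L^p(w)$ is the Lebesgue space with respect to $w\,dx$. Atoms: an $(N,\infty)$ atom is a function $a$ for which there is a cube $Q$ with $\operatorname{supp}(a)\subset Q$, $\|a\|_\infty\le1$,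 and $\int x^\beta a(x)\,dx=0$ for all $|\beta|\le N$; $Q_k$ above denotes such a cube for $a_k$. $\mathcal{O}_N$ is the set of smooth compactly supported functions $f$ on $\mathbb{R}^n$ with $\int x^\alpha f(x)\,dx=0$ for all $0\le|\alpha|\le N$. Weighted Hardy space: for $N_0\in\mathbb{N}$ let $\mathfrak{F}_{N_0}$ be the set of Schwartz functions $\varphi$ with $\int(1+|x|)^{N_0}\sum_{|\alpha|\le N_0}|\partial^\alpha\varphi(x)|^2\,dx\le1$, and $\mathcal{M}_{N_0}f(x)=\sup_{\varphi\in\mathfrak{F}_{N_0}}\sup_{t>0}|\varphi_t*f(x)|$, $\varphi_t(x)=t^{-n}\varphi(x/t)$. $H^p(w)$ is the set of tempered distributions $f$ with $\|f\|_{H^p(w)}=\|\mathcal{M}_{N_0}f\|_{L^p(w)}<\infty$, where $N_0$ is a fixed sufficiently large integer depending on $n,p,w$ (large enough that the usual maximal function definitions of $H^p(w)$ are equivalent). *)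

(* Defs.v *)
From HB Require Import structures.
From mathcomp Require Import all_boot all_order all_algebra.
From mathcomp Require Import complex.
From mathcomp Require Import all_classical all_reals all_analysis.
From mathcomp Require Import measurable_realfun.
Import Order.TTheory GRing.Theory Num.Theory.
Import numFieldNormedType.Exports.

Set Implicit Arguments.
Unset Strict Implicit.
Unset Printing Implicit Defensive.

Local Open Scope classical_set_scope.
Local Open Scope ring_scope.

(* R^n is 'rV[R]_n with the sigma-algebra generated by the coordinates, i.e.
   the Borel sigma-algebra. *)
Definition rV_display : measure_display -> measure_display.
Proof. exact. Qed.

Section rV_measurable.
Context (R : realType) (n : nat).

Let coor (i : 'I_n) (x : 'rV[R]_n) : R := x ord0 i.

Let rV_set0 : g_sigma_preimage coor set0.
Proof. exact: sigma_algebra0. Qed.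

Let rV_setC A : g_sigma_preimage coor A -> g_sigma_preimage coor (~` A).
Proof. exact: sigma_algebraC. Qed.

Let rV_bigcup (F : (set 'rV[R]_n)^nat) :
  (forall i, g_sigma_preimage coor (F i)) ->
  g_sigma_preimage coor (\bigcup_i F i).
Proof. exact: sigma_algebra_bigcup. Qed.

HB.instance Definition _ := @isMeasurable.Build 
  (rV_display default_measure_display)
  'rV[R]_n (g_sigma_preimage coor) rV_set0 rV_setC rV_bigcup.

End rV_measurable.

Section rV_measurable_fun.
Context d (T : measurableType d) (R : realType).

Lemma measurable_coord n (i : 'I_n) :
  measurable_fun [set: 'rV[R]_n] (fun x : 'rV[R]_n => x ord0 i).
Proof.
move=> _ Y mY; rewrite setTI; apply: sub_sigma_algebra => /=.
rewrite -bigcup_seq/=; exists i => /=; first by rewrite mem_index_enum.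
by exists Y => //; rewrite setTI.
Qed.

Lemma measurable_fun_coordP n (f : T -> 'rV[R]_n) :
  (forall i, measurable_fun [set: T] (fun t => f t ord0 i)) ->
  measurable_fun [set: T] f.
Proof.
move=> mf _ A mA; rewrite setTI; move: A mA.
pose coor (i : 'I_n) (x : 'rV[R]_n) : R := x ord0 i.
have H : g_sigma_preimage (fun i => coor i \o f) `<=` measurable.
  apply: smallest_sub; first exact: sigma_algebra_measurable.
  rewrite -bigcup_seq; apply: bigcup_sub => i _ A [B mB <-]; exact: mf.
rewrite g_sigma_preimage_comp in H => A mA.
by apply: H; exists A => //; rewrite setTI.
Qed.

End rV_measurable_fun.

Section lebesgue_rV.
Context (R : realType).
Local Open Scope ereal_scope.

Definition rV_cons n (p : measurableTypeR R * 'rV[R]_n) : 'rV[R]_n.+1 :=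
  row_mx (const_mx p.1 : 'rV_1) p.2.

Lemma rV_cons0 n (p : measurableTypeR R * 'rV[R]_n) : rV_cons p ord0 ord0 = p.1.
Proof.
have -> : (ord0 : 'I_n.+1) = lshift n (ord0 : 'I_1) by exact/val_inj.
by rewrite [LHS]row_mxEl mxE.
Qed.

Lemma rV_consS n (p : measurableTypeR R * 'rV[R]_n) i :
  rV_cons p ord0 (lift ord0 i) = p.2 ord0 i.
Proof.
have -> : lift ord0 i = rshift 1 i by exact/val_inj.
by rewrite [LHS]row_mxEr.
Qed.

Lemma measurable_rV_cons n :
  measurable_fun [set: measurableTypeR R * 'rV[R]_n] (@rV_cons n).
Proof.
apply: (@measurable_fun_coordP _ (measurableTypeR R * 'rV[R]_n)%type) => i.
have [j ->|->] := unliftP ord0 i.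
  under eq_fun do rewrite rV_consS.
  by apply: (measurableT_comp (measurable_coord j)).
under eq_fun do rewrite rV_cons0.
exact: measurable_fst.
Qed.

Definition rV_uncons n (x : 'rV[R]_n.+1) : measurableTypeR R * 'rV[R]_n :=
  (x ord0 ord0, \row_j x ord0 (lift ord0 j)).

Lemma rV_consK n : cancel (@rV_cons n) (@rV_uncons n).
Proof.
move=> [a x]; rewrite /rV_uncons rV_cons0; congr (_, _).
by apply/rowP => j; rewrite mxE rV_consS.
Qed.

Lemma measurable_rV_uncons n :
  measurable_fun [set: 'rV[R]_n.+1] (@rV_uncons n).
Proof.
apply/measurable_fun_pairP; split; first exact: measurable_coord.
apply: (@measurable_fun_coordP _ 'rV[R]_n.+1) => j.
rewrite [X in measurable_fun _ X](_ : _ =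
    fun x : 'rV[R]_n.+1 => x ord0 (lift ord0 j)).
  exact: measurable_coord.
by apply/funext => x /=; rewrite mxE.
Qed.

Section step.
Context n (lam : {sigma_finite_measure set (measurableTypeR R) -> \bar R})
  (mu : {sigma_finite_measure set 'rV[R]_n -> \bar R}).

Definition lebesgue_rV_step : set 'rV[R]_n.+1 -> \bar R :=
  pushforward (lam \x mu) (@rV_cons n).

HB.instance Definition _ := Measure.copy lebesgue_rV_step
  (measure_function_pushforward__canonical__measure_function_Measure
     (lam \x mu) (@measurable_rV_cons n)).

Let step_sigma_finite : sigma_finite setT lebesgue_rV_step.
Proof.
have /sigma_finiteP[F [TF ndF Foo]] := sigma_finiteT lam.
have /sigma_finiteP[G [TG ndG Goo]] := sigma_finiteT mu.
exists (fun k => @rV_uncons n @^-1` (F k `*` G k)).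
  rewrite -preimage_bigcup (_ : \bigcup_i _ = setT) ?preimage_setT//.
  apply/seteqP; split => // -[x y] _.
  have [k _ Fx] : (\bigcup_i F i) x by rewrite -TF.
  have [l _ Gy] : (\bigcup_i G i) y by rewrite -TG.
  exists (maxn k l) => //; split => /=.
    by move: x Fx; exact/subsetPset/ndF/leq_maxl.
  by move: y Gy; exact/subsetPset/ndG/leq_maxr.
move=> k; have [mF Fk] := Foo k; have [mG Gk] := Goo k; split.
  rewrite -[X in measurable X]setTI; apply: measurable_rV_uncons => //.
  exact: measurableX.
rewrite /lebesgue_rV_step /pushforward -comp_preimage.
rewrite (_ : _ \o _ = id); last by apply/funext => x /=; rewrite rV_consK.
by rewrite preimage_id product_measure1E// lte_mul_pinfty// ge0_fin_numE.
Qed.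

HB.instance Definition _ := Measure_isSigmaFinite.Build _ _ _ lebesgue_rV_step
  step_sigma_finite.

End step.

(* Lebesgue measure on R^n, as the n-fold product of Lebesgue measure on R. *)
Fixpoint lebesgue_rV n : {sigma_finite_measure set 'rV[R]_n -> \bar R} :=
  match n with
  | 0 => \d_(0%R : 'rV[R]_0)
  | m.+1 => lebesgue_rV_step (@lebesgue_measure R) (lebesgue_rV m)
  end.

Lemma lebesgue_rV_box n (a b : 'rV[R]_n) : (forall i, (a ord0 i <= b ord0 i)%R) ->
  lebesgue_rV n [set x | forall i, x ord0 i \in `[a ord0 i, b ord0 i]%R] =
  (\prod_i (b ord0 i - a ord0 i))%:E.
Proof.
elim: n a b => [|n IH] a b ab.
  by rewrite big_ord0 /= diracE mem_set// => -[].
rewrite /= /lebesgue_rV_step /pushforward.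
pose A := `[a ord0 ord0, b ord0 ord0]%classic : set (measurableTypeR R).
pose B := [set x : 'rV[R]_n | forall i,
  x ord0 i \in `[(rV_uncons a).2 ord0 i, (rV_uncons b).2 ord0 i]%R].
transitivity ((@lebesgue_measure R \x lebesgue_rV n) (A `*` B)).
  congr (product_measure1 _ _ _).
  apply/seteqP; split => [[y x] /= H|[y x] /= [H0 H] i].
    split; first by have := H ord0; rewrite rV_cons0.
    by move=> i; rewrite !mxE; have := H (lift ord0 i); rewrite rV_consS.
  have [j ->|->] := unliftP ord0 i; last by rewrite rV_cons0.
  by have := H j; rewrite rV_consS /= !mxE.
have mB : measurable B.
  rewrite [X in measurable X](_ : _ = \bigcap_(i in [set: 'I_n])
      ((fun x : 'rV[R]_n => x ord0 i) @^-1`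
         `[(rV_uncons a).2 ord0 i, (rV_uncons b).2 ord0 i])).
    apply: fin_bigcap_measurable => // i _.
    by rewrite -[X in measurable X]setTI; exact: measurable_coord.
  by apply/seteqP; split => x /= H i; [move=> _; exact: H | exact: H].
rewrite product_measure1E//; last exact: measurable_itv.
rewrite IH; last by move=> i; rewrite !mxE.
rewrite [X in X * _]lebesgue_measure_itv/= lte_fin big_ord_recl.
have -> : (\prod_i ((rV_uncons b).2 ord0 i - (rV_uncons a).2 ord0 i) =
  \prod_(i < n) (b ord0 (lift ord0 i) - a ord0 (lift ord0 i)))%R.
  by apply: eq_bigr => i _; rewrite !mxE.
case: ifPn => [_|]; first by rewrite EFinM.
rewrite -leNgt => ba; rewrite mul0e.
by rewrite (_ : b ord0 ord0 = a ord0 ord0) ?subrr ?mul0r//; apply/le_anti/andP.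
Qed.

End lebesgue_rV.

Section hardy.
Context (R : realType) (n : nat).
Local Notation Rn := 'rV[R]_n.
Local Notation mu := (lebesgue_rV R n).
Local Open Scope complex_scope.

Definition modulus (z : R[i]) : R := Normc.normc z.

Definition euclidean_norm (x : Rn) : R := Num.sqrt (\sum_i x ord0 i ^+ 2).

(* Measurability with respect to the Lebesgue sigma-algebra, i.e. the
   completion of the Borel one. *)
Definition lebesgue_measurable (f : Rn -> \bar R) :=
  exists2 g : Rn -> \bar R, measurable_fun [set: Rn] g &
    {ae mu, forall x, f x = g x}.

Definition lebesgue_measurableC (f : Rn -> R[i]) :=
  lebesgue_measurable (fun x => (complex.Re (f x))%:E) /\
  lebesgue_measurable (fun x => (complex.Im (f x))%:E).

Definition integralC (f : Rn -> R[i]) : R[i] :=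
  (\int[mu]_x complex.Re (f x)) +i* (\int[mu]_x complex.Im (f x)).

Definition supp (f : Rn -> R[i]) : set Rn := closure [set x | f x != 0].

Definition multiindex := 'I_n -> nat.

Definition mdegree (a : multiindex) : nat := (\sum_i a i)%N.

Definition monomial (b : multiindex) (x : Rn) : R := \prod_i x ord0 i ^+ b i.

Definition partial (i : 'I_n) (f : Rn -> R) : Rn -> R :=
  fun x => 'D_(delta_mx ord0 i) f x.

Definition Dmulti (a : multiindex) (f : Rn -> R) : Rn -> R :=
  foldr (fun i g => iter (a i) (partial i) g) f (enum 'I_n).

Definition DmultiC (a : multiindex) (f : Rn -> R[i]) (x : Rn) : R[i] :=
  Dmulti a (fun y => complex.Re (f y)) x +i*
  Dmulti a (fun y => complex.Im (f y)) x.

Fixpoint class_C (k : nat) (f : Rn -> R) : Prop :=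
  continuous f /\
  if k is k'.+1 then
    forall i, (forall x, derivable f x (delta_mx ord0 i)) /\
              class_C k' (partial i f)
  else True.

Definition smooth (f : Rn -> R[i]) : Prop :=
  forall k, class_C k (fun x => complex.Re (f x)) /\
            class_C k (fun x => complex.Im (f x)).

Definition vanishing_moments (N : nat) (f : Rn -> R[i]) : Prop :=
  forall b : multiindex, (mdegree b <= N)%N ->
    integralC (fun x => (monomial b x)%:C * f x) = 0.

Definition O_moments (N : nat) (f : Rn -> R[i]) : Prop :=
  [/\ smooth f, compact (supp f) & vanishing_moments N f].

Definition is_cube (Q : set Rn) : Prop :=
  exists (c : Rn) (l : R), 0 < l /\
    Q = [set x | forall i, c ord0 i <= x ord0 i <= c ord0 i + l].

Definition atom_on (N : nat) (Q : set Rn) (a : Rn -> R[i]) : Prop :=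
  [/\ lebesgue_measurableC a, supp a `<=` Q,
      (Lnorm mu +oo (fun x => (modulus (a x))%:E) <= 1)%E &
      vanishing_moments N a].

Section weights.
Local Open Scope ereal_scope.

Definition is_weight (w : Rn -> \bar R) : Prop :=
  [/\ lebesgue_measurable w,
      (forall K, compact K -> \int[mu]_(x in K) `|w x| < +oo) &
      {ae mu, forall x, 0 < w x < +oo}].

Definition average (Q : set Rn) (w : Rn -> \bar R) : \bar R :=
  (fine (mu Q))^-1%:E * \int[mu]_(x in Q) w x.

(* The exponent is 1 - r' = 1 - r / (r - 1). *)
Definition muckenhoupt_char (r : R) (w : Rn -> \bar R) : \bar R :=
  ereal_sup [set average Q w *
                 average Q (fun x => w x `^ (1 - r / (r - 1))) `^ (r - 1)
            | Q in is_cube].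

Definition muckenhoupt (r : R) (w : Rn -> \bar R) : Prop :=
  muckenhoupt_char r w < +oo.

Definition muckenhoupt1 (w : Rn -> \bar R) : Prop :=
  exists C : R, forall Q, is_cube Q ->
    {ae mu, forall x, Q x -> average Q w <= C%:E * w x}.

Definition muckenhoupt_infty (w : Rn -> \bar R) : Prop :=
  muckenhoupt1 w \/ exists2 r : R, (1 < r)%R & muckenhoupt r w.

Definition critical_index (w : Rn -> \bar R) : R :=
  inf [set r : R | (1 < r)%R /\ muckenhoupt r w].

Definition s_index (w : Rn -> \bar R) (p : R) : int :=
  Num.max 0%R (Num.floor (n%:R * (critical_index w / p - 1)))%R.

(* The quasi-norm of L^p(w dx), for 0 < p < oo. *)
Definition Lp_norm (p : R) (w g : Rn -> \bar R) : \bar R :=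
  (\int[mu]_x (`|g x| `^ p * w x)) `^ p^-1.

End weights.

Definition schwartz (phi : Rn -> R[i]) : Prop :=
  smooth phi /\
  forall a b : multiindex, exists M : R, forall x,
    `|monomial b x| * modulus (DmultiC a phi x) <= M.

Definition functional := (Rn -> R[i]) -> R[i].

(* Linear functionals on Schwartz functions, continuous for the usual
   seminorms; values on other functions are irrelevant. *)
Definition tempered (T : functional) : Prop :=
  (forall (c : R[i]) phi psi, schwartz phi -> schwartz psi ->
     T (fun x => c * phi x + psi x) = c * T phi + T psi) /\
  exists (C : R) (k : nat), forall phi, schwartz phi -> forall A : R,
    (forall a b : multiindex, (mdegree a <= k)%N -> (mdegree b <= k)%N ->
       forall x, `|monomial b x| * modulus (DmultiC a phi x) <= A) ->
    modulus (T phi) <= C * A.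

Definition distribution_of (f : Rn -> R[i]) : functional :=
  fun phi => integralC (fun x => f x * phi x).

Definition dilate (t : R) (phi : Rn -> R[i]) (x : Rn) : R[i] :=
  ((t ^+ n)^-1)%:C * phi (t^-1 *: x).

(* (phi * T)(x) = <T, phi(x - .)>. *)
Definition convolve (phi : Rn -> R[i]) (T : functional) (x : Rn) : R[i] :=
  T (fun y => phi (x - y)).

(* |a| <= N0 forces a i <= N0 for all i, so that these multi-indices can be
   enumerated through a finite type. *)
Definition test_class (N0 : nat) (phi : Rn -> R[i]) : Prop :=
  schwartz phi /\
  (\int[mu]_x ((1 + euclidean_norm x) ^+ N0 *
     \sum_(a : {ffun 'I_n -> 'I_N0.+1} | (mdegree (fun i => a i) <= N0)%N)
       modulus (DmultiC (fun i => a i) phi x) ^+ 2)%:E <= 1)%E.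

Definition grand_maximal (N0 : nat) (T : functional) (x : Rn) : \bar R :=
  ereal_sup [set z | exists phi (t : R), [/\ test_class N0 phi, 0 < t &
    z = (modulus (convolve (dilate t phi) T x))%:E]].

Definition hardy_norm (N0 : nat) (p : R) (w : Rn -> \bar R)
    (T : functional) : \bar R :=
  Lp_norm p w (grand_maximal N0 T).

Definition hardy (N0 : nat) (p : R) (w : Rn -> \bar R)
    (T : functional) : Prop :=
  tempered T /\ (hardy_norm N0 p w T < +oo)%E.

End hardy.

(* Main.v *)
(** The coefficients can be chosen so that [\sum_k lambda_k \1_(Q_k) <= C * Mf]
everywhere, [Mf] being the grand maximal function, so the weight plays no role
beyond the monotonicity of the quasi-norm of [L^p(w)].  The real and imaginary
parts of [f] are treated separately.

For a real [f], take at each dyadic scale [l_k] a partition of unity [psi_(k, m)]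
by translated and dilated mollified B-splines.  The refinement equation writes
every bump of scale [k + 1] as a nonnegative combination of bumps of scale [k],
so the pieces [F k m := f psi_(k, m)] form a tree.  Let [G k m] be a step function
supported in the support of [psi_(k, m)] with the moments of [F k m] up to order
[N]; testing [f] against dilated bumps shows that [|G k m|] is at most a constant
times [Mf] at every point near that node.  At the bottom scale, which is chosen
so fine that the oscillation of [f] is below a lower bound of [Mf] near the
support of [f], take [G 0 m := F 0 m].

For a threshold [t], descend the tree from the roots, stop at the nodes having a
neighbourhood in [{Mf > t}], and replace the pieces [F] there by [G].  Unstopped
nodes then have size [O(t)], because stopped and unstopped nodes meeting at a
point lie on neighbouring levels.  Comparing the thresholds [t] and [2 t] yields
atoms with coefficients [O(t)], on cubes contained in [{Mf > t}] and overlapping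
boundedly.  The sum over the dyadic [t] telescopes, and the pointwise sum of the
coefficients is a geometric series with sum [O(Mf)].  What remains is the sum of
the [G] at the roots, a multiple of a single atom. *)

(* In absolute units the bumps of all levels are finite differences, of step [ell k], of one and the
   same function: the truncated power of degree [N0], smoothed once at the bottom mesh [h]. This is
   why refinement survives smoothing: with [E] the shift by one step, [1 - E^2 = (1 + E)(1 - E)]
   holds whatever function the differences act on. Smoothing each level in proportion to its own
   mesh would destroy the identity. In units of [ell k] the smoothing scale is [2 ^- k], so that
   high derivatives blow up with [k]; the degree [N0] is chosen because the derivatives up to that
   order, those measured by [test_class], stay bounded. Since pieces of different scales are tied by
   exact linear identities, equality of moments passes through the stopped sums without error, and
   sizes are controlled by sums of nonnegative coefficients only. The obstacle is the bottom level:
   tests control averages of [f], while [F 0 m] requires its values. A value is an average up to the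
   oscillation, so the mesh is fixed only after a positive lower bound of the maximal function is
   known. The final constant depends neither on the mesh nor on the number of levels. *)
Require Import Defs.
From mathcomp Require Import all_boot all_order all_algebra.
From mathcomp Require Import complex.
From mathcomp Require Import all_classical all_reals all_analysis.
From mathcomp Require Import measurable_realfun.
From mathcomp Require Import ring lra zify.
Import Order.TTheory GRing.Theory Num.Theory.
Import numFieldNormedType.Exports.
Set Implicit Arguments.
Unset Strict Implicit.
Unset Printing Implicit Defensive.
Local Open Scope classical_set_scope.
Local Open Scope ring_scope.
Local Open Scope complex_scope.

(** * Smooth functions of one variable *)

Section smooth1.
Context {R : realType}.
Implicit Types u v : R -> R.

(** [Cn k] asks for [k + 1] derivatives: each order being derivable, continuity of all of them up to
    [k] is automatic. *)
Fixpoint Cn (k : nat) u : Prop :=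
  (forall x : R, derivable u x 1) /\ (if k is k'.+1 then Cn k' (derive1 u) else True).

Definition smooth1 u := forall k, Cn k u.

Lemma Cn_derivable {k u} : Cn k u -> forall x : R, derivable u x 1.
Proof. by case: k => [|k] []. Qed.

Arguments Cn_derivable {k u} _ x.

Lemma CnW {k u} : Cn k.+1 u -> Cn k u.
Proof. by elim: k u => [|k IH] u [du] //= Du; split => //; exact: IH. Qed.

Lemma derive1_is_derive u (u' : R -> R) :
  (forall x : R, is_derive x 1 u (u' x)) -> (derive1 u) = u'.
Proof. by move=> h; apply/funext => x; rewrite derive1E; exact: derive_val. Qed.

Lemma derivable_is_derive1 u x : derivable u x 1 -> is_derive x 1 u ((derive1 u) x).
Proof. by move=> du; rewrite derive1E; exact: DeriveDef. Qed.

Lemma Cn_step k u (u' : R -> R) :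
  (forall x : R, is_derive x 1 u (u' x)) -> Cn k u' -> Cn k.+1 u.
Proof.
move=> h h'; split; last by rewrite (derive1_is_derive h).
by move=> x; have := h x => /@ex_derive.
Qed.

Lemma Cn_step0 u (u' : R -> R) : (forall x : R, is_derive x 1 u (u' x)) -> Cn 0 u.
Proof. by move=> h; split=> // x; have := h x => /@ex_derive. Qed.

Lemma Cn_cst k (c : R) : Cn k (fun=> c).
Proof.
elim: k c => [|k IH] c.
  by apply: (@Cn_step0 _ (fun=> 0)) => x; exact: is_derive_cst.
by apply: (@Cn_step _ _ (fun=> 0)) => // x; exact: is_derive_cst.
Qed.

Lemma is_derive_add u v x :
  derivable u x 1 -> derivable v x 1 ->
  is_derive x 1 (fun y => u y + v y) ((derive1 u) x + (derive1 v) x).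
Proof.
by move=> /derivable_is_derive1 du /derivable_is_derive1 dv; exact: is_deriveD.
Qed.

Lemma is_derive_mul u v x :
  derivable u x 1 -> derivable v x 1 ->
  is_derive x 1 (fun y => u y * v y) ((derive1 u) x * v x + u x * (derive1 v) x).
Proof.
move=> /derivable_is_derive1 du /derivable_is_derive1 dv.
have -> : derive1 u x * v x + u x * derive1 v x =
  u x *: derive1 v x + v x *: derive1 u x by rewrite /GRing.scale/=; ring.
exact: is_deriveM.
Qed.

Lemma CnD k u v : Cn k u -> Cn k v -> Cn k (fun x => u x + v x).
Proof.
elim: k u v => [|k IH] u v Du Dv.
  apply: Cn_step0 => x; exact: is_derive_add (Cn_derivable Du _) (Cn_derivable Dv _).
have ? := Cn_derivable Du; have ? := Cn_derivable Dv.
apply: Cn_step => [x|]; first by apply: is_derive_add.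
by have [_ Du'] := Du; have [_ Dv'] := Dv; exact: IH.
Qed.

Lemma CnM k u v : Cn k u -> Cn k v -> Cn k (fun x => u x * v x).
Proof.
elim: k u v => [|k IH] u v Du Dv.
  apply: Cn_step0 => x; exact: is_derive_mul (Cn_derivable Du _) (Cn_derivable Dv _).
have ? := Cn_derivable Du; have ? := Cn_derivable Dv.
apply: Cn_step => [x|]; first by apply: is_derive_mul.
have [_ Du'] := Du; have [_ Dv'] := Dv.
by apply: CnD; apply: IH => //; exact: CnW.
Qed.

Lemma is_derive_affine u (a b : R) x : derivable u (a * x + b) 1 ->
  is_derive x 1 (fun y => u (a * y + b)) (a * (derive1 u) (a * x + b)).
Proof.
move=> du.
have da : is_derive x 1 (fun y => a * y + b) a.
  have -> : (fun y => a * y + b) = horner (a *: 'X + b%:P).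
    by apply/funext => y; rewrite !hornerE.
  have := is_derive_poly (a *: 'X + b%:P) x.
  by rewrite derivD derivZ derivX derivC addr0 !hornerE.
have := @is_derive1_comp _ u (fun y => a * y + b) x _ _
  (derivable_is_derive1 du) da.
by rewrite mulrC.
Qed.

Lemma Cn_affine k u (a b : R) : Cn k u -> Cn k (fun x => u (a * x + b)).
Proof.
elim: k u => [|k IH] u Du.
  apply: Cn_step0 => x; apply: is_derive_affine; exact: (Cn_derivable Du _).
apply: Cn_step => [x|]; first by apply: is_derive_affine; exact: (Cn_derivable Du _).
by apply: CnM; [exact: Cn_cst|by have [_ Du'] := Du; exact: IH].
Qed.

Lemma is_derive_inv u x : u x != 0 -> derivable u x 1 ->
  is_derive x 1 (fun y => (u y)^-1) (- (derive1 u) x * ((u x)^-1 * (u x)^-1)).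
Proof.
move=> ux /derivable_is_derive1 du.
have -> : - derive1 u x * ((u x)^-1 * (u x)^-1) =
  - (u x) ^- 2 *: derive1 u x by rewrite expr2 invfM /GRing.scale/=; ring.
exact: is_deriveV.
Qed.

Lemma CnV k u : (forall x, u x != 0) -> Cn k u -> Cn k (fun x => (u x)^-1).
Proof.
move=> u0; elim: k u u0 => [|k IH] u u0 Du.
  by apply: Cn_step0 => x; apply: is_derive_inv => //; exact: (Cn_derivable Du _).
apply: Cn_step => [x|].
  by apply: is_derive_inv => //; exact: (Cn_derivable Du _).
have Vu := IH _ u0 (CnW Du).
apply: CnM; last exact: CnM.
have [_ Du'] := Du.
have := CnM (Cn_cst k (-1)) Du'.
by congr Cn; apply/funext => x; rewrite mulN1r.
Qed.

Lemma Cn_horner k (p : {poly R}) : Cn k (fun x => p.[x]).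
Proof.
elim: k p => [|k IH] p.
  by apply: (@Cn_step0 _ (fun x => p^`().[x])) => x; exact: is_derive_poly.
by apply: (@Cn_step _ _ (fun x => p^`().[x])) => // x; exact: is_derive_poly.
Qed.

End smooth1.

Section smooth1_theory.
Context {R : realType}.
Implicit Types u v : R -> R.

Lemma smooth1_derive1 u : smooth1 u -> smooth1 (derive1 u).
Proof. by move=> su k; have [] := su k.+1. Qed.

Lemma derive1nSr k u : derive1n k.+1 u = derive1n k (derive1 u).
Proof. by rewrite /derive1n iterSr. Qed.

Lemma smooth1_derive1n k u : smooth1 u -> smooth1 (derive1n k u).
Proof.
elim: k u => [//|k IH] u su; rewrite derive1nSr; exact/IH/smooth1_derive1.
Qed.

Lemma smooth1_derivable u : smooth1 u -> forall x : R, derivable u x 1.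
Proof. by move=> su; exact: (Cn_derivable (su 0%N)). Qed.
Arguments smooth1_derivable {u} _ x.

Lemma smooth1_continuous u : smooth1 u -> continuous u.
Proof.
move=> su x; apply: differentiable_continuous; apply/derivable1_diffP.
exact: smooth1_derivable.
Qed.

Lemma smooth1_cst (c : R) : smooth1 (fun=> c).
Proof. by move=> k; exact: Cn_cst. Qed.

Lemma smooth1D u v : smooth1 u -> smooth1 v -> smooth1 (fun x => u x + v x).
Proof. by move=> su sv k; exact: CnD. Qed.

Lemma smooth1M u v : smooth1 u -> smooth1 v -> smooth1 (fun x => u x * v x).
Proof. by move=> su sv k; exact: CnM. Qed.

Lemma smooth1Z (c : R) u : smooth1 u -> smooth1 (fun x => c * u x).
Proof. by apply: smooth1M; exact: smooth1_cst. Qed.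

Lemma smooth1_affine (a b : R) u : smooth1 u -> smooth1 (fun x => u (a * x + b)).
Proof. by move=> su k; exact: Cn_affine. Qed.

Lemma smooth1V u : (forall x, u x != 0) -> smooth1 u -> smooth1 (fun x => (u x)^-1).
Proof. by move=> u0 su k; exact: CnV. Qed.

Lemma smooth1_horner (p : {poly R}) : smooth1 (fun x => p.[x]).
Proof. by move=> k; exact: Cn_horner. Qed.

Lemma derive1_add u v : smooth1 u -> smooth1 v ->
  derive1 (fun x => u x + v x) = (fun x => derive1 u x + derive1 v x).
Proof.
move=> su sv; apply: derive1_is_derive => x.
by apply: is_derive_add; exact: smooth1_derivable.
Qed.

Lemma derive1_mul u v : smooth1 u -> smooth1 v ->
  derive1 (fun x => u x * v x) = (fun x => derive1 u x * v x + u x * derive1 v x).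
Proof.
move=> su sv; apply: derive1_is_derive => x.
by apply: is_derive_mul; exact: smooth1_derivable.
Qed.

Lemma derive1nD k u v : smooth1 u -> smooth1 v ->
  derive1n k (fun x => u x + v x) = (fun x => derive1n k u x + derive1n k v x).
Proof.
elim: k u v => [//|k IH] u v su sv.
by rewrite !derive1nSr derive1_add// IH//; exact: smooth1_derive1.
Qed.

Lemma derive1n_0 k : derive1n k (fun=> 0 : R) = (fun=> 0).
Proof.
elim: k => [//|k IH]; rewrite derive1nSr.
rewrite (_ : derive1 _ = fun=> 0)//; exact: derive1_is_derive.
Qed.

Lemma derive1_scale (c : R) u : smooth1 u ->
  derive1 (fun x => c * u x) = (fun x => c * derive1 u x).
Proof.
move=> su; rewrite (derive1_mul (smooth1_cst c))//.
apply/funext => x; rewrite (_ : derive1 (fun=> c) = fun=> 0) ?mul0r ?add0r//.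
exact: derive1_is_derive.
Qed.

Lemma derive1nZ k (c : R) u : smooth1 u ->
  derive1n k (fun x => c * u x) = (fun x => c * derive1n k u x).
Proof.
elim: k u => [//|k IH] u su.
by rewrite !derive1nSr derive1_scale// IH//; exact: smooth1_derive1.
Qed.

Lemma derive1n_affine k (a b : R) u : smooth1 u ->
  derive1n k (fun x => u (a * x + b)) =
  (fun x => a ^+ k * derive1n k u (a * x + b)).
Proof.
elim: k u => [|k IH] u su; first by apply/funext => x; rewrite expr0 mul1r.
rewrite !derive1nSr (_ : derive1 _ = (fun x => a * derive1 u (a * x + b))).
  rewrite derive1nZ; last exact/smooth1_affine/smooth1_derive1.
  rewrite IH; last exact: smooth1_derive1.
  by apply/funext => x; rewrite mulrA -exprS.
apply: derive1_is_derive => x; apply: is_derive_affine; exact: smooth1_derivable.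
Qed.

Lemma derive1n_horner k (p : {poly R}) :
  derive1n k (fun x => p.[x]) = (fun x => p^`(k).[x]).
Proof.
elim: k p => [//|k IH] p; rewrite derive1nSr.
by rewrite -[X in derive1 X]/(horner p) -derivE IH derivSn.
Qed.

Lemma derive1n_open k u v (O : set R) : open O ->
  (forall x, O x -> u x = v x) -> forall x, O x -> derive1n k u x = derive1n k v x.
Proof.
move=> oO; elim: k u v => [//|k IH] u v uv x Ox.
rewrite !derive1nSr; apply: IH => // y Oy; rewrite !derive1E.
by apply: near_eq_derive; apply: (filterS uv); exact: open_nbhs_nbhs.
Qed.

Lemma derive1n_vanish k u (a b : R) : smooth1 u ->
  (forall x, ~~ (a <= x <= b) -> u x = 0) ->
  forall x, ~~ (a <= x <= b) -> derive1n k u x = 0.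
Proof.
move=> su u0 x; rewrite negb_and -!ltNge => /orP[xa|xb].
  rewrite (@derive1n_open k u (fun=> 0) [set y | y < a]) ?derive1n_0//.
  by move=> y /= ya; rewrite u0// negb_and -!ltNge ya.
rewrite (@derive1n_open k u (fun=> 0) [set y | b < y]) ?derive1n_0//.
by move=> y /= ya; rewrite u0// negb_and -!ltNge ya orbT.
Qed.

Lemma continuous_bounded u (a b : R) : continuous u ->
  exists C : R, 0 <= C /\ forall x, a <= x <= b -> `|u x| <= C.
Proof.
move=> cu; have [ab|ba] := leP a b; last first.
  exists 0; split=> // x /andP[ax xb].
  by have := le_lt_trans (le_trans ax xb) ba; rewrite ltxx.
have cn : {within `[a, b], continuous (fun x => `|u x|)}.
  apply: continuous_subspaceT => x.
  by apply: continuous_comp; [exact: cu|exact: norm_continuous].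
have [c _ cmax] := EVT_max ab cn.
by exists `|u c|; split=> // x xab; apply: cmax; rewrite in_itv.
Qed.

Lemma smooth1_bounded u (n : nat) (a b : R) : smooth1 u ->
  exists C : R, 0 <= C /\
    forall i, (i <= n)%N -> forall x, a <= x <= b -> `|derive1n i u x| <= C.
Proof.
move=> su; elim: n => [|n [C [C0 HC]]].
  have [C [C0 HC]] := @continuous_bounded u a b (smooth1_continuous su).
  by exists C; split=> // i; rewrite leqn0 => /eqP ->.
have [D [D0 HD]] := @continuous_bounded (derive1n n.+1 u) a b
  (smooth1_continuous (smooth1_derive1n n.+1 su)).
exists (C + D); split=> [|i]; first exact: addr_ge0.
rewrite leq_eqVlt => /orP[/eqP ->|ni] x xab.
  by rewrite (le_trans (HD _ xab))// lerDr.
by rewrite (le_trans (HC _ _ _ xab))// lerDl.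
Qed.

(** Each application of the product rule doubles the number of terms, and every term is bounded by
    [A * B]; this gives [2 ^+ k] without the Leibniz formula. *)
Lemma derive1nM_bound k u v (x A B : R) : smooth1 u -> smooth1 v ->
  0 <= A -> 0 <= B ->
  (forall i, (i <= k)%N -> `|derive1n i u x| <= A) ->
  (forall i, (i <= k)%N -> `|derive1n i v x| <= B) ->
  `|derive1n k (fun x => u x * v x) x| <= 2 ^+ k * (A * B).
Proof.
move=> su sv A0 B0; elim: k u v su sv => [|k IH] u v su sv uA vB.
  by rewrite expr0 mul1r normrM; apply: ler_pM => //; [exact: (uA 0%N)|exact: (vB 0%N)].
rewrite derive1nSr derive1_mul// derive1nD; [|exact/smooth1M/sv/smooth1_derive1|
  exact/smooth1M/smooth1_derive1].
rewrite (le_trans (ler_normD _ _))// exprS -mulrA mulrDl !mul1r.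
have su' := smooth1_derive1 su; have sv' := smooth1_derive1 sv.
apply: lerD; apply: IH => // i ik; rewrite -?derive1nSr; first exact: uA.
- exact/vB/ltnW.
- exact/uA/ltnW.
- exact: vB.
Qed.

End smooth1_theory.

(** * A smooth transition function *)

Section step.
Context {R : realType}.
Implicit Types (p : {poly R}) (s x : R).

Lemma exprn_le_expR (n : nat) x : 0 <= x -> x ^+ n <= n`!%:R * expR x.
Proof.
move=> x0; case: n => [|n]; first by rewrite fact0 expr0 mul1r -expR0 ler_expR.
have nf : 0 < (n.+1`!%:R : R) by rewrite ltr0n fact_gt0.
rewrite mulrC -ler_pdivrMr//.
by apply: le_trans (expR_ge1Dxn n x0); rewrite lerDr.
Qed.

Lemma horner_le_expR p : exists2 C : R, 0 <= C &
  forall x, 0 <= x -> `|p.[x]| <= C * expR x.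
Proof.
exists (\sum_(i < size p) `|p`_i| * i`!%:R).
  by apply: sumr_ge0 => i _; exact: mulr_ge0.
move=> x x0; rewrite horner_coef (le_trans (ler_norm_sum _ _ _))//.
rewrite mulr_suml; apply: ler_sum => i _.
rewrite normrM -mulrA; apply: ler_wpM2l => //.
by rewrite ger0_norm ?exprn_ge0//; exact: exprn_le_expR.
Qed.

(* The polynomial factor makes the class stable under derivation. *)
Definition flat p s := if 0 < s then p.[s^-1] * expR (- s^-1) else 0.

(** Quadratic decay forces derivative 0 at the junction [s = 0]. Applying [horner_le_expR] to
    ['X^2 * p] at [s^-1] lets the exponential absorb the extra factor [s ^- 2]. *)
Lemma flat_le_sqr p : exists2 C : R, 0 <= C & forall s, `|flat p s| <= C * s ^+ 2.
Proof.
have [C C0 HC] := horner_le_expR ('X^2 * p).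
exists C => // s; rewrite /flat; case: ifPn => s0; last first.
  by rewrite normr0 mulr_ge0// sqr_ge0.
have := HC s^-1; rewrite invr_ge0 (ltW s0) => /(_ isT).
rewrite hornerM hornerXn normrM => h.
rewrite normrM (ger0_norm (expR_ge0 _)) expRN ler_pdivrMr ?expR_gt0// mulrAC.
rewrite (ger0_norm (sqr_ge0 _)) exprVn mulrC ler_pdivrMr ?exprn_gt0// in h.
Qed.

Lemma is_derive_sqr_bound (u : R -> R) (C : R) :
  (forall s, `|u s| <= C * s ^+ 2) -> is_derive (0 : R) (1 : R) u (0 : R).
Proof.
move=> uC; have u0 : u 0 = 0.
  by apply/normr0_eq0/le_anti; rewrite normr_ge0 andbT (le_trans (uC 0))// expr0n mulr0.
(* At 0 this slope is 0, by the convention [0^-1 = 0], and 0 is the derivative sought. *)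
apply/is_derive1_caratheodory; exists (fun z => u z / z); split.
- move=> z; rewrite u0 !subr0; have [->|z0] := eqVneq z 0.
    by rewrite u0 mulr0.
  by rewrite divfK.
- have C0 : 0 <= C by have := uC 1; rewrite expr1n mulr1; exact: le_trans (normr_ge0 _).
  have C1 : 0 < C + 1 by rewrite ltr_wpDl.
  apply/cvgrPdist_le => /= e e0.
  near=> z; rewrite u0 invr0 mulr0 sub0r normrN normrM normfV.
  have [->|z0] := eqVneq z 0; first by rewrite normr0 invr0 mulr0 ltW.
  rewrite ler_pdivrMr ?normr_gt0// (le_trans (uC z))//.
  rewrite -[z ^+ 2](@ger0_norm _ (z ^+ 2)) ?sqr_ge0// normrX expr2 mulrA.
  apply: ler_wpM2r => //.
  apply: (@le_trans _ _ ((C + 1) * `|z|)); first by apply: ler_wpM2r => //; rewrite lerDl.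
  rewrite mulrC -ler_pdivlMr//.
  near: z; apply: (@nbhs0_le _ R^o); exact: divr_gt0.
- by rewrite u0 mul0r.
Unshelve. all: by end_near. Qed.

Lemma is_derive_flat p x :
  is_derive x 1 (flat p) (flat ('X^2 * (p - p^`())) x).
Proof.
have [->|x0] := eqVneq x 0.
  rewrite {2}/flat ltxx; have [C _ HC] := flat_le_sqr p.
  exact: is_derive_sqr_bound HC.
rewrite {2}/flat; case: ifPn => [xp|]; last first.
  rewrite -leNgt le_eqVlt (negbTE x0)/= => xn.
  apply: (@near_eq_is_derive _ _ _ (cst 0)).
  near=> y; rewrite /flat ifF//; apply/negbTE; rewrite -leNgt ltW//.
  by near: y; exact: lt_nbhsl.
apply: (@near_eq_is_derive _ _ _ (fun s => p.[s^-1] * expR (- s^-1))).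
  by near=> y; rewrite /flat ifT//; near: y; exact: lt_nbhsr.
have dV : is_derive x 1 (fun s : R => s^-1) (- x ^- 2).
  have := @is_deriveV _ id x 1 1 x0 (is_derive_id _ _).
  by rewrite /GRing.scale/= mulr1.
have d1 := @is_derive1_comp _ (horner p) _ x _ _ (is_derive_poly p x^-1) dV.
have d2 := @is_derive1_comp _ expR _ x _ _ (is_derive_expR _) (is_deriveN dV).
have -> : ('X^2 * (p - p^`())).[x^-1] * expR (- x^-1) =
  p.[x^-1] *: (expR (- x^-1) * - - x ^- 2) +
  expR (- x^-1) *: (p^`().[x^-1] * - x ^- 2).
  by rewrite hornerM hornerXn hornerD hornerN /GRing.scale/= -exprVn; ring.
exact: is_deriveM d1 d2.
Unshelve. all: by end_near. Qed.

Lemma smooth1_flat p : smooth1 (flat p).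
Proof.
move=> k; elim: k p => [|k IH] p.
  exact: Cn_step0 (is_derive_flat p).
exact: Cn_step (is_derive_flat p) (IH _).
Qed.

(** The classical transition from 0 on [s <= 0] to 1 on [s >= 1]; the denominator is positive
    because [s] or [1 - s] is. *)
Definition smooth_step s := flat 1 s / (flat 1 s + flat 1 (1 - s)).

Lemma flat1_ge0 s : 0 <= flat 1 s.
Proof. by rewrite /flat; case: ifP => // _; rewrite hornerC mul1r expR_ge0. Qed.

Lemma flat1_gt0 s : 0 < s -> 0 < flat 1 s.
Proof. by move=> s0; rewrite /flat s0 hornerC mul1r expR_gt0. Qed.

Lemma smooth_step_den s : 0 < flat 1 s + flat 1 (1 - s).
Proof.
have [s0|s0] := ltP 0 s; first by rewrite ltr_pwDl// ?flat1_ge0 ?flat1_gt0.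
by rewrite ltr_wpDl ?flat1_ge0// flat1_gt0//; lra.
Qed.

Lemma smooth1_step : smooth1 smooth_step.
Proof.
apply: smooth1M; first exact: smooth1_flat.
apply: smooth1V; first by move=> x; rewrite gt_eqF// smooth_step_den.
apply: smooth1D; first exact: smooth1_flat.
rewrite (_ : (fun _ => _) = (fun x => flat 1 (-1 * x + 1))).
  by apply: smooth1_affine; exact: smooth1_flat.
by apply/funext => x; congr flat; ring.
Qed.

Lemma smooth_step_le0 s : s <= 0 -> smooth_step s = 0.
Proof. by move=> s0; rewrite /smooth_step {1}/flat ltNge s0 mul0r. Qed.

Lemma smooth_step_ge1 s : 1 <= s -> smooth_step s = 1.
Proof.
move=> s1; rewrite /smooth_step (_ : flat 1 (1 - s) = 0).
  by rewrite addr0 divff// gt_eqF// flat1_gt0//; lra.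
by rewrite /flat ifF//; apply/negbTE; rewrite -leNgt; lra.
Qed.

Lemma smooth_step_ge0 s : 0 <= smooth_step s.
Proof. by rewrite divr_ge0 ?flat1_ge0// ltW// smooth_step_den. Qed.

Lemma smooth_step_le1 s : smooth_step s <= 1.
Proof.
by rewrite ler_pdivrMr ?smooth_step_den// mul1r lerDl flat1_ge0.
Qed.

End step.

(** * Mollified B-splines *)

Section difference.
Context {R : realType}.
Implicit Types (g : R -> R) (p q : {poly R}).

Definition bdiff (h : R) g := fun v => g v - g (v - h).

Lemma iter_bdiffD n h g1 g2 v : iter n (bdiff h) (fun v => g1 v + g2 v) v =
  iter n (bdiff h) g1 v + iter n (bdiff h) g2 v.
Proof. by elim: n v => //= n IH v; rewrite /bdiff !IH; ring. Qed.

Lemma iter_bdiff_shift n h t g v :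
  iter n (bdiff h) (fun v => g (v - t)) v = iter n (bdiff h) g (v - t).
Proof. by elim: n v => //= n IH v; rewrite /bdiff !IH addrAC. Qed.

Lemma iter_bdiff_scale n h a c g v :
  iter n (bdiff h) (fun v => c * g (a * v)) v = c * iter n (bdiff (a * h)) g (a * v).
Proof. by elim: n v => //= n IH v; rewrite /bdiff !IH !mulrBr. Qed.

Lemma smooth1_bdiff h g : smooth1 g -> smooth1 (bdiff h g).
Proof.
move=> sg; rewrite (_ : bdiff h g = fun v => g v + (-1) * g (1 * v + - h)).
  by apply: smooth1D => //; apply: smooth1Z; exact: smooth1_affine.
by apply/funext => v; rewrite /bdiff mul1r mulN1r.
Qed.

Lemma smooth1_iter_bdiff n h g : smooth1 g -> smooth1 (iter n (bdiff h) g).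
Proof. by move=> sg; elim: n => //= n; exact: smooth1_bdiff. Qed.

Lemma derive1n_bdiff i h g : smooth1 g ->
  derive1n i (bdiff h g) = bdiff h (derive1n i g).
Proof.
move=> sg; rewrite (_ : bdiff h g = fun v => g v + (-1) * g (1 * v + - h)).
  rewrite derive1nD ?derive1nZ ?derive1n_affine//.
  - by apply/funext => v; rewrite /bdiff expr1n !mul1r mulN1r.
  - exact: smooth1_affine.
  - by apply: smooth1Z; exact: smooth1_affine.
by apply/funext => v; rewrite /bdiff mul1r mulN1r.
Qed.

Lemma derive1n_iter_bdiff i n h g : smooth1 g ->
  derive1n i (iter n (bdiff h) g) = iter n (bdiff h) (derive1n i g).
Proof.
move=> sg; elim: n => //= n IH.
by rewrite derive1n_bdiff ?IH//; exact: smooth1_iter_bdiff.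
Qed.

Lemma iter_bdiff_bound n h g (V C : R) : 0 <= h ->
  (forall v, v <= V -> `|g v| <= C) ->
  forall v, v <= V -> `|iter n (bdiff h) g v| <= 2 ^+ n * C.
Proof.
move=> h0 gC; elim: n => [|n IH] v vV /=; first by rewrite mul1r gC.
rewrite (le_trans (ler_normB _ _))// exprS -mulrA mulrDl mul1r.
by apply: lerD; apply: IH => //; rewrite (le_trans _ vV)// gerBl.
Qed.

(** With [E] the unit shift, [(1 - E^2)^n = (1 + E)^n (1 - E)^n]; the coefficients come from
    expanding [(1 + E)^n], here by induction through Pascal's rule. *)
Lemma iter_bdiff_refine n g v :
  iter n (bdiff 2) g v = \sum_(j < n.+1) 'C(n, j)%:R * iter n (bdiff 1) g (v - j%:R).
Proof.
elim: n g v => [|n IH] g v; first by rewrite big_ord1 bin0 mul1r subr0.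
rewrite iterSr IH; set E := iter n.+1 (bdiff 1) g.
transitivity (\sum_(j < n.+1) 'C(n, j)%:R * (E (v - j%:R) + E (v - j.+1%:R))).
  apply: eq_bigr => j _; congr (_ * _).
  rewrite (_ : bdiff 2 g = fun v => bdiff 1 g v + bdiff 1 g (v - 1)).
    rewrite iter_bdiffD iter_bdiff_shift /E !iterSr; congr (_ + _).
    by congr (iter _ _ _ _); rewrite -natr1; ring.
  apply/funext => w; rewrite /bdiff; have -> : w - 1 - 1 = w - 2 by ring.
  ring.
rewrite [RHS]big_ord_recl /= bin0 mul1r subr0.
under eq_bigr do rewrite mulrDr.
rewrite big_split/= big_ord_recl /= bin0 mul1r subr0 -addrA; congr (_ + _).
under [RHS]eq_bigr do rewrite /bump /= add1n binS natrD mulrDl.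
rewrite big_split/=; congr (_ + _).
by rewrite [RHS]big_ord_recr/= bin_small// mul0r addr0.
Qed.

Definition pdiff p := p - (p \Po ('X - 1%:P)).

Lemma pdiffD p q : pdiff (p + q) = pdiff p + pdiff q.
Proof. by rewrite /pdiff comp_polyD; ring. Qed.

Lemma pdiffZ c p : pdiff (c *: p) = c *: pdiff p.
Proof. by rewrite /pdiff comp_polyZ scalerBr. Qed.

Lemma iter_pdiffD n p q : iter n pdiff (p + q) = iter n pdiff p + iter n pdiff q.
Proof. by elim: n => //= n ->; rewrite pdiffD. Qed.

Lemma iter_pdiffZ n c p : iter n pdiff (c *: p) = c *: iter n pdiff p.
Proof. by elim: n => //= n ->; rewrite pdiffZ. Qed.

Lemma pdiffXn m : exists2 q : {poly R}, (size q <= m)%N & pdiff 'X^(m.+1) = m.+1%:R *: 'X^m + q.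
Proof.
suff [q sq E] : exists2 q : {poly R}, (size q <= m)%N &
    ('X - 1%:P) ^+ m.+1 = 'X^(m.+1) - m.+1%:R *: 'X^m + q :> {poly R}.
  by exists (- q); rewrite ?size_polyN// /pdiff comp_Xn_poly E; ring.
elim: m => [|m [q sq E]].
  by exists 0; rewrite ?size_poly0// !expr1 expr0 scale1r addr0.
exists (q * 'X - q + m.+1%:R *: 'X^m).
  rewrite (leq_trans (size_polyD _ _))// geq_max; apply/andP; split.
    rewrite (leq_trans (size_polyD _ _))// geq_max size_polyN (leq_trans sq)//.
    by rewrite andbT (leq_trans (size_polyMleq _ _))// size_polyX addn2.
  by rewrite (leq_trans (size_scale_leq _ _))// size_polyXn.
rewrite exprS E -(@natr1 R m.+1) scalerDl scale1r !exprS polyC1.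
by rewrite -!mul_polyC; ring.
Qed.

Lemma size_pdiff m p : (size p <= m.+1)%N -> (size (pdiff p) <= m)%N.
Proof.
move=> sp; rewrite -[p]coefK poly_def.
have -> : pdiff (\sum_(i < size p) p`_i *: 'X^i) =
    \sum_(i < size p) p`_i *: pdiff 'X^i.
  elim/big_ind2: _ => [|? ? ? ? <- <-|i _]; last by rewrite pdiffZ.
    by rewrite /pdiff comp_poly0 subrr.
  by rewrite pdiffD.
rewrite (leq_trans (size_sum _ _ _))//; apply/bigmax_leqP => -[[|i] ip] _ /=.
  by rewrite /pdiff expr0 -polyC1 comp_polyC subrr scaler0 size_poly0.
have [q sq ->] := pdiffXn i.
rewrite (leq_trans (size_scale_leq _ _))//.
have im : (i.+1 <= m)%N by rewrite -ltnS (leq_trans ip).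
rewrite (leq_trans (size_polyD _ _))// geq_max (leq_trans sq (ltnW im)) andbT.
by rewrite (leq_trans (size_scale_leq _ _))// size_polyXn.
Qed.

Lemma iter_pdiff_eq0 m p : (size p <= m)%N -> iter m pdiff p = 0.
Proof.
elim: m p => [|m IH] p; first by rewrite leqn0 size_poly_eq0 => /eqP.
by rewrite iterSr => /size_pdiff /IH.
Qed.

Lemma iter_pdiffXn m : iter m pdiff 'X^m = (m`!%:R)%:P.
Proof.
elim: m => [|m IH]; first by rewrite expr0 fact0.
have [q sq E] := pdiffXn m.
by rewrite iterSr E iter_pdiffD iter_pdiffZ IH iter_pdiff_eq0// addr0
  -mul_polyC -polyCM -natrM factS.
Qed.

(** The difference of order [n] at [v] reads [g] only at [v - n, ..., v], so agreement with a
    polynomial beyond [v0] persists beyond [v0 + n]. *)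
Lemma iter_bdiff_horner n g p (v0 : R) : (forall v, v0 <= v -> g v = p.[v]) ->
  forall v, v0 + n%:R <= v -> iter n (bdiff 1) g v = (iter n pdiff p).[v].
Proof.
move=> gp; elim: n => [|n IH] v vn /=; first by rewrite gp// -[v0]addr0.
rewrite /bdiff IH; last by rewrite (le_trans _ vn)// lerD2l ler_nat.
rewrite IH; last by move: vn; rewrite -natr1; lra.
by rewrite /pdiff hornerD hornerN horner_comp !hornerE.
Qed.

End difference.

Section spline.
Context {R : realType} (d : nat).
Implicit Types v s : R.

Let r s : R := smooth_step s * (d`!%:R^-1 *: 'X^d).[s].

Let smooth1_r : smooth1 r.
Proof. by apply: smooth1M; [exact: smooth1_step|exact: smooth1_horner]. Qed.

Let r_le0 s : s <= 0 -> r s = 0.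
Proof. by move=> s0; rewrite /r smooth_step_le0// mul0r. Qed.

Let r_ge1 s : 1 <= s -> r s = (d`!%:R^-1 *: 'X^d).[s].
Proof. by move=> s1; rewrite /r smooth_step_ge1// mul1r. Qed.

(* Smoothed at scale [2 ^- k], the truncated power satisfies
   [rk k.+1 v = 2 ^- d * rk k (2 * v)] exactly, whence the refinement equation. *)
Let rk k v := (2 ^+ k) ^- d * r (2 ^+ k * v).

Let smooth1_rk k : smooth1 (rk k).
Proof.
apply: smooth1Z; under eq_fun do rewrite -[_ * _]addr0.
exact: smooth1_affine.
Qed.

Let rk_le0 k v : v <= 0 -> rk k v = 0.
Proof. by move=> v0; rewrite /rk r_le0 ?mulr0// mulr_ge0_le0// exprn_ge0. Qed.

Let rk_ge1 k v : 1 <= v -> rk k v = (d`!%:R^-1 *: 'X^d).[v].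
Proof.
move=> v1; rewrite /rk r_ge1; last first.
  have k1 : 1 <= (2 ^+ k : R) by rewrite exprn_ege1// ler1n.
  nra.
have k0 : ((2 ^+ k) ^+ d : R) != 0 by rewrite !expf_neq0// pnatr_eq0.
by rewrite !hornerZ !hornerXn exprMn mulrCA mulKf.
Qed.

(** Left of 0 everything vanishes. Where [2 ^+ k * v <= 2], the chain rule brings out
    [(2 ^+ k) ^+ i / (2 ^+ k) ^+ d], at most 1 precisely because [i <= d]. Further right [rk k] is
    the exact power [v ^+ d / d!], which does not depend on [k]. *)
Let rk_bound (V : R) : exists2 C : R, 0 <= C &
  forall k i, (i <= d)%N -> forall v, v <= V -> `|derive1n i (rk k) v| <= C.
Proof.
have [C [C0 HC]] := @smooth1_bounded R r d 0 2 smooth1_r.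
have [D [D0 HD]] := @smooth1_bounded R _ d 0 (Num.max V 0)
  (smooth1_horner (d`!%:R^-1 *: 'X^d)).
exists (C + D); first exact: addr_ge0.
move=> k i id v vV.
have k0 : 1 <= (2 ^+ k : R) by rewrite exprn_ege1// ler1n.
have kp : 0 < (2 ^+ k : R) by apply: lt_le_trans k0.
have -> : derive1n i (rk k) v =
    (2 ^+ k) ^- d * ((2 ^+ k) ^+ i * derive1n i r (2 ^+ k * v)).
  rewrite /rk derive1nZ; last first.
    by under eq_fun do rewrite -[_ * _]addr0; exact: smooth1_affine.
  have := @derive1n_affine R i (2 ^+ k) 0 r smooth1_r.
  under eq_fun do rewrite addr0.
  by move=> ->; rewrite addr0.
have [v0|v0] := ltP v 0.
  rewrite (@derive1n_open R i r (fun=> 0) [set y | y < 0]) ?derive1n_0//.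
  - by rewrite !mulr0 normr0 addr_ge0.
  - by move=> y /= y0; rewrite r_le0// ltW.
  - by rewrite /= pmulr_rlt0.
have [k2|k2] := leP (2 ^+ k * v) 2.
  rewrite mulrA normrM; apply: (@le_trans _ _ (1 * C)); last by rewrite mul1r lerDl.
  apply: ler_pM => //; last by apply: HC => //; rewrite k2 mulr_ge0// ltW.
  rewrite ger0_norm; last by rewrite mulr_ge0 ?invr_ge0// exprn_ge0// ltW.
  by rewrite mulrC ler_pdivrMr ?exprn_gt0// mul1r ler_weXn2l.
rewrite (@derive1n_open R i r (fun s => (d`!%:R^-1 *: 'X^d).[s]) [set y | 1 < y])//.
- rewrite (@le_trans _ _ D) ?lerDr//.
  have := HD i id v; rewrite v0 le_max vV => /(_ isT).
  congr (`|_| <= _); rewrite derive1n_horner !hornerE derivnZ !hornerE.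
  rewrite derivnXn hornerMn hornerXn hornerMn hornerXn exprMn.
  have -> : (2 ^+ k) ^+ d = (2 ^+ k) ^+ i * (2 ^+ k) ^+ (d - i) :> R.
    by rewrite -exprD subnKC.
  rewrite /=.
  have ki : (2 ^+ k) ^+ i != 0 :> R by rewrite expf_neq0// gt_eqF.
  have kd : (2 ^+ k) ^+ (d - i) != 0 :> R by rewrite expf_neq0// gt_eqF.
  have fd : d`!%:R != 0 :> R by rewrite pnatr_eq0 -lt0n fact_gt0.
  rewrite !mulrnAr; congr (_ *+ _).
  move: ki kd fd; move: ((2 ^+ k) ^+ i) ((2 ^+ k) ^+ (d - i)) (v ^+ (d - i)) d`!%:R.
  by move=> I E X a I0 E0 a0; field; rewrite I0 E0 a0.
- by move=> y /= y1; rewrite r_ge1// ltW.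
- by rewrite /= (lt_trans _ k2)// ltr1n.
Qed.

(** For the truncated power itself this is the cardinal B-spline of degree [d], supported in
    [[0, d + 1]]; smoothing enlarges the support to at most [[0, d + 2]]. *)
Definition spline k : R -> R := iter d.+1 (bdiff 1) (rk k).

Lemma smooth1_spline k : smooth1 (spline k).
Proof. exact: smooth1_iter_bdiff. Qed.

Lemma spline_supp k v : ~~ (0 <= v <= d.+2%:R) -> spline k v = 0.
Proof.
rewrite negb_and -!ltNge => /orP[v0|vd].
  have H n w : w <= 0 -> iter n (bdiff 1) (rk k) w = 0.
    elim: n w => [|n IH] w w0 /=; first exact: rk_le0.
    rewrite /bdiff !IH ?subrr//; lra.
  by rewrite /spline H// ltW.
rewrite /spline (@iter_bdiff_horner _ _ _ _ 1 (@rk_ge1 k)).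
  rewrite iter_pdiff_eq0 ?horner0//.
  by rewrite (leq_trans (size_scale_leq _ _))// size_polyXn.
by rewrite addrC natr1 ltW.
Qed.

(** A spline is the first difference of the [d]-th difference of [rk k], so the sum of translates
    telescopes. The upper end is the [d]-th difference of [v ^+ d / d!], that is 1, and the lower
    end is taken left of 0. *)
Lemma spline_sum k (M : nat) v : d.+2%:R <= v <= M%:R ->
  \sum_(m < M) spline k (v - m%:R) = 1.
Proof.
move=> /andP[vd vM].
have -> : \sum_(m < M) spline k (v - m%:R) =
    iter d (bdiff 1) (rk k) v - iter d (bdiff 1) (rk k) (v - M%:R).
  elim: M {vM} => [|M IH]; first by rewrite big_ord0 subr0 subrr.
  rewrite big_ord_recr /= IH.
  have -> : spline k (v - M%:R) = iter d (bdiff 1) (rk k) (v - M%:R) -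
      iter d (bdiff 1) (rk k) (v - M.+1%:R).
    by have -> : v - M.+1%:R = v - M%:R - 1 by rewrite -natr1; ring.
  ring.
rewrite (@iter_bdiff_horner _ _ _ _ 1 (@rk_ge1 k)); last first.
  by rewrite (le_trans _ vd)// addrC natr1 ler_nat.
rewrite iter_pdiffZ iter_pdiffXn hornerZ hornerC mulVf ?pnatr_eq0 -?lt0n ?fact_gt0//.
have -> : iter d (bdiff 1) (rk k) (v - M%:R) = 0.
  have : v - M%:R <= 0 by lra.
  move: (v - M%:R); elim: d => [|n IH] w w0 /=; first exact: rk_le0.
  rewrite /bdiff !IH ?subrr//; lra.
by rewrite subr0.
Qed.

(** The homogeneity of [rk] turns unit differences of [rk k.+1] at [v] into differences of step 2 of
    [rk k] at [2 * v], which [iter_bdiff_refine] expands. *)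
Lemma spline_refine k v :
  spline k.+1 v = \sum_(j < d.+2) 2 ^- d * 'C(d.+1, j)%:R * spline k (2 * v - j%:R).
Proof.
transitivity (2 ^- d * iter d.+1 (bdiff 2) (rk k) (2 * v)).
  rewrite -{2}[2]mulr1 -iter_bdiff_scale /spline.
  congr (iter _ _ _ _); apply/funext => w.
  by rewrite /rk !mulrA -exprSr -invfM -exprMn -exprS.
rewrite iter_bdiff_refine mulr_sumr; apply: eq_bigr => j _.
by rewrite mulrA.
Qed.

(** The powers [v ^+ a] are included because a moment of a localized piece is a test of [f] against
    a spline times a power. The bound is uniform in [k]. *)
Lemma spline_bound (N : nat) : exists2 A : R, 0 <= A &
  forall k a i v, (a <= N)%N -> (i <= d)%N ->
    `|derive1n i (fun v => spline k v * v ^+ a) v| <= A.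
Proof.
have [C C0 HC] := rk_bound d.+2%:R.
have [D D0 HD] : exists2 D : R, 0 <= D & forall a i v, (a <= N)%N -> (i <= d)%N ->
    0 <= v <= d.+2%:R -> `|derive1n i (fun v : R => v ^+ a) v| <= D.
  elim: N => [|N [D D0 HD]].
    have [D [D0 HD]] := @smooth1_bounded R _ d 0 d.+2%:R (smooth1_horner 'X^0).
    exists D => // a i v; rewrite leqn0 => /eqP -> id vd.
    have := HD i id v vd; by under eq_fun do rewrite hornerXn.
  have [D' [D'0 HD']] := @smooth1_bounded R _ d 0 d.+2%:R (smooth1_horner 'X^(N.+1)).
  exists (D + D'); first exact: addr_ge0.
  move=> a i v; rewrite leq_eqVlt => /orP[/eqP ->|aN] id vd.
    rewrite (@le_trans _ _ D') ?lerDr//.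
    by have := HD' i id v vd; under eq_fun do rewrite hornerXn.
  by rewrite (@le_trans _ _ D) ?lerDl// HD.
have sX a : smooth1 (fun v : R => v ^+ a).
  by have := @smooth1_horner R 'X^a; under eq_fun do rewrite hornerXn.
have P0 : 0 <= 2 ^+ d * (2 ^+ d.+1 * C * D).
  by rewrite !mulr_ge0// exprn_ge0.
exists (2 ^+ d * (2 ^+ d.+1 * C * D)) => // k a i v aN id.
have [vd|vd] := boolP (0 <= v <= d.+2%:R); last first.
  rewrite (@derive1n_vanish R i _ 0 d.+2%:R) ?normr0//.
  - by apply: smooth1M => //; exact: smooth1_spline.
  - by move=> x xd; rewrite spline_supp// mul0r.
apply: (@le_trans _ _ (2 ^+ i * (2 ^+ d.+1 * C * D))); last first.
  apply: ler_wpM2r; first by rewrite !mulr_ge0// exprn_ge0.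
  by rewrite ler_weXn2l// ler1n.
apply: derive1nM_bound => //.
- exact: smooth1_spline.
- by rewrite mulr_ge0// exprn_ge0.
- move=> j ji; rewrite /spline derive1n_iter_bdiff//.
  apply: (@iter_bdiff_bound _ _ _ _ d.+2%:R) => //; last by case/andP: vd.
  by apply: HC; exact: leq_trans id.
- by move=> j ji; apply: HD => //; exact: leq_trans id.
Qed.

End spline.

(** * Integration of bounded functions with bounded support *)

Section bounded_support.
Context d (T : measurableType d) {R : realType}.
Variable mu : {measure set T -> \bar R}.

Lemma integrable_bounded_support (g : T -> R) (D : set T) (B : R) :
  measurable D -> (mu D < +oo)%E -> measurable_fun [set: T] g ->
  (forall x, `|g x| <= B) -> (forall x, g x != 0 -> D x) ->
  mu.-integrable [set: T] (EFin \o g).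
Proof.
move=> mD muD mg gB gD.
apply: (@le_integrable _ _ _ _ _ _ _ (fun x => B%:E * (\1_D x)%:E)%E) => //.
- exact/measurable_EFinP.
- move=> x _; rewrite -EFinM /= lee_fin indicE.
  have [->|g0] := eqVneq (g x) 0; first by rewrite normr0.
  by rewrite mem_set ?mulr1; [exact: le_trans (ler_norm _)|exact: gD].
- apply: integrableZl => //; apply/integrableP; split; first exact/measurable_EFinP.
  rewrite (eq_integral (fun x => (\1_D x)%:E)); last first.
    by move=> t _; rewrite gee0_abs// lee_fin.
  by rewrite integral_indic// setIT.
Qed.

End bounded_support.

Section bdds1.
Context {R : realType}.
Local Notation lam := (@lebesgue_measure R).

Definition bdds1 (u : R -> R) := measurable_fun [set: measurableTypeR R] u /\
  exists A B : R, forall x, `|u x| <= B /\ (u x != 0 -> `|x| <= A).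

Lemma bdds1_integrable u : bdds1 u -> lam.-integrable [set: _] (EFin \o u).
Proof.
move=> [mu [A [B uAB]]].
apply: (@integrable_bounded_support _ (measurableTypeR R) R lam u `[- A, A]%classic B) => //.
- rewrite [X in (X < _)%E]lebesgue_measure_itv /=; case: ifP => // _.
  by rewrite -EFinD ltry.
- by move=> x; case: (uAB x).
- by move=> x; case: (uAB x) => _ h /h; rewrite ler_norml /= in_itv.
Qed.

End bdds1.

Section bddsn.
Context {R : realType} (n : nat).
Local Notation Rn := 'rV[R]_n.
Local Notation mu := (lebesgue_rV R n).
Implicit Types g h : Rn -> R.

(** The working class for integrals: stable under the algebraic operations and contained in the
    integrable functions. Size is measured coordinate by coordinate to suit tensor products. *)
Definition bdds g := measurable_fun [set: Rn] g /\
  exists A B : R, forall x, `|g x| <= B /\ (g x != 0 -> forall i, `|x ord0 i| <= A).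

Definition box (a b : R) : set Rn := [set x | forall i, x ord0 i \in `[a, b]%R].

Lemma measurable_box a b : measurable (box a b).
Proof.
rewrite [X in measurable X](_ : _ = \bigcap_(i in [set: 'I_n])
      ((fun x : 'rV[R]_n => x ord0 i) @^-1` `[a, b])).
  apply: fin_bigcap_measurable => // i _.
  by rewrite -[X in measurable X]setTI; exact: measurable_coord.
by apply/seteqP; split => x /= H i; [move=> _; exact: H | exact: H].
Qed.

Lemma mu_box a b : a <= b -> mu (box a b) = ((b - a) ^+ n)%:E.
Proof.
move=> ab.
have -> : box a b = [set x : Rn | forall i,
    x ord0 i \in `[(const_mx a : Rn) ord0 i, (const_mx b : Rn) ord0 i]%R].
  by apply/seteqP; split=> x h i; have := h i; rewrite !mxE.
rewrite lebesgue_rV_box => [|i]; last by rewrite !mxE.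
by congr EFin; under eq_bigr do rewrite !mxE; rewrite prodr_const card_ord.
Qed.

Lemma bdds_box g : bdds g -> exists A B : R, [/\ 0 <= A, 0 <= B,
  forall x, `|g x| <= B & forall x, g x != 0 -> box (- A) A x].
Proof.
move=> [_ [A [B gAB]]]; exists `|A|, B; split => //.
- by apply: le_trans (proj1 (gAB 0)).
- by move=> x; case: (gAB x).
- move=> x /(proj2 (gAB x)) h i; rewrite in_itv /= -ler_norml.
  by rewrite (le_trans (h i))// ler_norm.
Qed.

Lemma bdds_integrable g : bdds g -> mu.-integrable [set: Rn] (EFin \o g).
Proof.
move=> gb; have [A [B [A0 B0 gB gA]]] := bdds_box gb; have [mg _] := gb.
apply: (@integrable_bounded_support _ _ _ mu g (box (- A) A) B) => //.
- exact: measurable_box.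
- by rewrite [X in (X < _)%E]mu_box ?ltry//; lra.
Qed.

Lemma bdds0 : bdds (fun=> 0).
Proof.
split; first exact: measurable_cst.
by exists 0, 0 => x; rewrite normr0 eqxx.
Qed.

Lemma bddsM g h : bdds g -> measurable_fun [set: Rn] h ->
  (forall A : R, exists B : R, forall x : Rn, (forall i : 'I_n, `|x ord0 i| <= A) -> `|h x| <= B) ->
  bdds (fun x => g x * h x).
Proof.
move=> [mg [A [B gAB]]] mh hb; split; first exact: measurable_funM.
have [C hC] := hb A; exists A, (`|B| * `|C|) => x; have [gB gA] := gAB x.
have [g0|g0] := eqVneq (g x) 0.
  by rewrite g0 mul0r normr0 eqxx; split=> //; exact: mulr_ge0.
split; last by move=> _; exact: gA.
rewrite normrM ler_pM//; first by rewrite (le_trans gB)// ler_norm.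
by rewrite (le_trans (hC _ (gA g0)))// ler_norm.
Qed.

Lemma bddsZ c g : bdds g -> bdds (fun x => c * g x).
Proof.
move=> gb; under eq_fun do rewrite mulrC.
apply: bddsM => //.
by move=> A; exists `|c|.
Qed.

Lemma bddsD g h : bdds g -> bdds h -> bdds (fun x => g x + h x).
Proof.
move=> gb hb; split; first exact: measurable_funD (proj1 gb) (proj1 hb).
have [A [B [A0 B0 gB gA]]] := bdds_box gb.
have [C [D [C0 D0 hD hC]]] := bdds_box hb.
exists (A + C), (B + D) => x; split.
  by rewrite (le_trans (ler_normD _ _))// lerD.
move=> gh i; have [g0|/gA/(_ i)] := eqVneq (g x) 0; last first.
  by rewrite in_itv /= -ler_norml => /le_trans; apply; rewrite lerDl.
have /hC/(_ i) : h x != 0 by move: gh; rewrite g0 add0r.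
by rewrite in_itv /= -ler_norml => /le_trans; apply; rewrite lerDr.
Qed.

Lemma bdds_sum (I : Type) (s : seq I) (P : pred I) (G : I -> Rn -> R) :
  (forall i, P i -> bdds (G i)) -> bdds (fun x => \sum_(i <- s | P i) G i x).
Proof.
move=> Gb; elim: s => [|i s IH].
  by under eq_fun do rewrite big_nil; exact: bdds0.
have [Pi|Pi] := boolP (P i).
  by under eq_fun do rewrite big_cons Pi; apply: bddsD => //; exact: Gb.
by under eq_fun do rewrite big_cons (negbTE Pi).
Qed.

Lemma bddsB g h : bdds g -> bdds h -> bdds (fun x => g x - h x).
Proof.
move=> gb /(bddsZ (-1)) hb; have := bddsD gb hb.
by under eq_fun do rewrite mulN1r.
Qed.

Definition rint g : R := \int[mu]_x g x.

Lemma rintD g h : bdds g -> bdds h -> rint (fun x => g x + h x) = rint g + rint h.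
Proof.
by move=> gb hb; apply: RintegralD => //; exact: bdds_integrable.
Qed.

Lemma rintZ c g : bdds g -> rint (fun x => c * g x) = c * rint g.
Proof. by move=> gb; apply: RintegralZl => //; exact: bdds_integrable. Qed.

Lemma rintB g h : bdds g -> bdds h -> rint (fun x => g x - h x) = rint g - rint h.
Proof.
by move=> gb hb; apply: RintegralB => //; exact: bdds_integrable.
Qed.

Lemma rint0 : rint (fun=> 0) = 0.
Proof. by rewrite /rint /Rintegral integral0. Qed.

Lemma rint_sum (I : Type) (s : seq I) (P : pred I) (G : I -> Rn -> R) :
  (forall i, P i -> bdds (G i)) ->
  rint (fun x => \sum_(i <- s | P i) G i x) = \sum_(i <- s | P i) rint (G i).
Proof.
move=> Gb; elim: s => [|i s IH].
  by under eq_fun do rewrite big_nil; rewrite big_nil rint0.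
rewrite big_cons; have [Pi|Pi] := boolP (P i).
  under eq_fun do rewrite big_cons Pi.
  by rewrite rintD ?IH//; [exact: Gb|exact: bdds_sum].
by under eq_fun do rewrite big_cons (negbTE Pi).
Qed.

Lemma le_rint g h : bdds g -> bdds h -> (forall x, g x <= h x) -> rint g <= rint h.
Proof.
by move=> gb hb gh; apply: le_Rintegral => //; exact: bdds_integrable.
Qed.

Lemma ler_norm_rint g h : bdds g -> bdds h -> (forall x, `|g x| <= h x) ->
  `|rint g| <= rint h.
Proof.
move=> gb hb gh; rewrite ler_norml; apply/andP; split.
  rewrite lerNl -[leLHS]mulN1r -rintZ//; apply: le_rint => //.
    exact: bddsZ.
  by move=> x; rewrite mulN1r (le_trans _ (gh x))// -normrN ler_norm.
by apply: le_rint => // x; rewrite (le_trans _ (gh x))// ler_norm.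
Qed.

End bddsn.

Section tensor.
Context {R : realType}.

Definition tensor n (u : 'I_n -> R -> R) (x : 'rV[R]_n) : R :=
  \prod_i u i (x ord0 i).

Lemma measurable_tensor n (u : 'I_n -> R -> R) :
  (forall i, measurable_fun [set: measurableTypeR R] (u i)) ->
  measurable_fun [set: 'rV[R]_n] (tensor u).
Proof.
move=> mu; apply: measurable_prod => i _.
apply: (measurableT_comp (mu i)); exact: measurable_coord.
Qed.

Lemma bdds_tensor n (u : 'I_n -> R -> R) :
  (forall i, bdds1 (u i)) -> bdds (tensor u).
Proof.
move=> ub; split; first by apply: measurable_tensor => i; case: (ub i).
have /choice[A /choice[B AB]] : forall i, exists A, exists B : R,
    forall x, `|u i x| <= B /\ (u i x != 0 -> `|x| <= A) by move=> i; case: (ub i).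
exists (\sum_i `|A i|), (\prod_i B i) => x; split.
  by rewrite normr_prod; apply: ler_prod => i _; case: (AB i (x ord0 i)) => -> _; rewrite normr_ge0.
move=> u0 i; have /(proj2 (AB i _)) h : u i (x ord0 i) != 0.
  by apply: contra u0 => /eqP ui0; rewrite /tensor (bigD1 i)//= ui0 mul0r.
rewrite (le_trans h)// (bigD1 i)//= (le_trans (ler_norm _))// lerDl.
exact: sumr_ge0.
Qed.

(** Lebesgue measure in dimension [n + 1] is the image of a product measure under [rV_cons], so each
    induction step is one use of Fubini splitting off coordinate 0. *)
Lemma rint_tensor n (u : 'I_n -> R -> R) : (forall i, bdds1 (u i)) ->
  rint (tensor u) = \prod_i \int[@lebesgue_measure R]_s u i s.
Proof.
elim: n u => [|n IH] u ub.
  rewrite big_ord0 /rint /Rintegral /= integral_dirac//.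
    by rewrite diracT mul1e /tensor big_ord0.
  by apply/measurable_EFinP; apply: measurable_tensor => i; case: (ub i).
pose v (i : 'I_n) := u (lift ord0 i).
have vb i : bdds1 (v i) by exact: ub.
have E (p : measurableTypeR R * 'rV[R]_n) :
    tensor u (rV_cons p) = u ord0 p.1 * tensor v p.2.
  rewrite /tensor big_ord_recl rV_cons0; congr (_ * _).
  by apply: eq_bigr => i _; rewrite rV_consS.
have mE : measurable_fun [set: measurableTypeR R * 'rV[R]_n]
    (fun p => u ord0 p.1 * tensor v p.2).
  apply: measurable_funM.
    by apply: measurableT_comp; [case: (ub ord0)|exact: measurable_fst].
  by apply: (measurableT_comp (proj1 (bdds_tensor vb))); exact: measurable_snd.
have iE : (@lebesgue_measure R \x lebesgue_rV R n)%E.-integrable setT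
    (EFin \o (fun p => u ord0 p.1 * tensor v p.2)).
  have [_ [A [B AB]]] := ub ord0.
  have [C [D [C0 D0 tD tC]]] := bdds_box (bdds_tensor vb).
  apply: (@integrable_bounded_support _ (measurableTypeR R * 'rV[R]_n)%type R
    (@lebesgue_measure R \x lebesgue_rV R n)%E _
    (`[- A, A]%classic `*` box (- C) C) (`|B| * D)) => //.
  - by apply: measurableX; [exact: measurable_itv|exact: measurable_box].
  - rewrite [X in (X < _)%E]product_measure1E//; last exact: measurable_box.
    have l1 : (@lebesgue_measure R `[(- A)%R, A]%classic < +oo)%E.
      by rewrite [X in (X < _)%E]lebesgue_measure_itv /=; case: ifP => // _; rewrite -EFinD ltry.
    have l2 : (lebesgue_rV R n (box (- C)%R C) < +oo)%E.
      by rewrite [X in (X < _)%E]mu_box ?ltry//; lra.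
    by rewrite lte_mul_pinfty// ge0_fin_numE.
  - move=> [a y] /=; rewrite normrM ler_pM// (le_trans (proj1 (AB a)))//.
    exact: ler_norm.
  - move=> [a y] /=; rewrite mulf_eq0 negb_or => /andP[ua ty]; split => /=.
      by have := proj2 (AB a) ua; rewrite in_itv /= ler_norml.
    exact: tC.
rewrite /rint /Rintegral /=.
transitivity (fine (\int[@lebesgue_measure R \x lebesgue_rV R n]_p
   (u ord0 p.1 * tensor v p.2)%:E)%E).
  congr fine; rewrite integral_pushforward//=.
  - by rewrite preimage_setT; apply: eq_integral => p _; rewrite /= E.
  - exact: measurable_rV_cons.
  - by apply/measurable_EFinP; case: (bdds_tensor ub).
  - rewrite preimage_setT.
    by apply: eq_integrable iE => // p _ /=; rewrite E.
rewrite -(integral12_prod_meas1 iE) /fubini_F /=.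
under eq_integral.
  move=> a _.
  under eq_integral do rewrite EFinM.
  rewrite integralZl//; last exact: bdds_integrable (bdds_tensor vb).
  over.
rewrite big_ord_recl -IH// -RintegralZr//; last exact: bdds1_integrable.
congr fine; apply: eq_integral => a _; rewrite EFinM; congr (_ * _)%E.
rewrite /rint /Rintegral fineK//; apply: integrable_fin_num => //.
exact: bdds_integrable (bdds_tensor vb).
Qed.

End tensor.

Section continuous_measurable.
Context {R : realType} (n : nat).
Local Notation Rn := 'rV[R]_n.

(** The sigma-algebra is generated by the coordinates, so an open set has to be written as a
    countable union of boxes; those with rational corners are enumerated by [pickle]. *)
Lemma open_measurable_rV (U : set Rn) : open U -> measurable U.
Proof.
move=> oU.
pose I := ({ffun 'I_n -> rat} * {ffun 'I_n -> rat})%type.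
pose F (pq : I) : set Rn :=
  [set x | forall i, ratr (pq.1 i) < x ord0 i < ratr (pq.2 i)].
have mF pq : measurable (F pq).
  rewrite [X in measurable X](_ : _ = \bigcap_(i in [set: 'I_n])
      ((fun x : Rn => x ord0 i) @^-1` `]ratr (pq.1 i), ratr (pq.2 i)[)).
    apply: fin_bigcap_measurable => // i _.
    by rewrite -[X in measurable X]setTI; exact: measurable_coord.
  apply/seteqP; split => x /= H i => [_|].
    by rewrite /= in_itv /=; exact: H.
  by have := H i Logic.I; rewrite /= in_itv.
rewrite (_ : U = \bigcup_(k in [set: nat])
    if unpickle k is Some pq then
      if `[< F pq `<=` U >] then F pq else set0 else set0).
  apply: bigcup_measurable => k _; case: unpickle => [pq|]; last exact: measurable0.
  by case: ifP => _; [exact: mF|exact: measurable0].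
apply/seteqP; split => [x Ux|x [k _]]; last first.
  by case: unpickle => // pq; case: asboolP => // FU; exact: FU.
have /nbhs_ballP[e /= e0 eU] : nbhs x U by exact: open_nbhs_nbhs.
have /choice[p Hp] : forall i : 'I_n, exists q : rat,
    ratr q \in `]x ord0 i - e, x ord0 i[.
  by move=> i; apply: rat_in_itvoo; rewrite gtrBl.
have /choice[q Hq] : forall i : 'I_n, exists q : rat,
    ratr q \in `]x ord0 i, x ord0 i + e[.
  by move=> i; apply: rat_in_itvoo; rewrite ltrDl.
pose pq : I := ([ffun i => p i], [ffun i => q i]).
exists (pickle pq) => //; rewrite pickleK; case: asboolP => [_|].
  move=> i; rewrite !ffunE; have := Hp i; have := Hq i; rewrite !in_itv /=.
  by move=> /andP[-> _] /andP[_ ->].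
case=> y Fy; apply: eU; split=> // i j; rewrite (ord1 i).
have := Fy j; rewrite !ffunE; have := Hp j; have := Hq j; rewrite !in_itv /=.
move=> /andP[_ qx] /andP[px _] /andP[py yq].
rewrite /ball /= ltr_norml; apply/andP; split; lra.
Qed.

Lemma continuous_measurable_rV (f : Rn -> R) : continuous f ->
  measurable_fun [set: Rn] f.
Proof.
move=> cf; apply: (measurability _ (RGenOpens.measurableE R)) => _ [_ [a [b ->] <-]].
rewrite setTI; apply: open_measurable_rV; apply: open_comp => // x _; exact: cf.
Qed.

End continuous_measurable.

(** * Step functions dual to the monomials, and moment matching *)

Section dual_steps.
Context {R : realType}.
Local Notation lam := (@lebesgue_measure R).

Lemma integral_power (c l t : R) (b : nat) : 0 < l -> 0 < t ->
  \int[lam]_(s in `[c, c + l * t]) ((l^-1 * (s - c)) ^+ b) =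
  l * (t ^+ b.+1 / b.+1%:R).
Proof.
move=> l0 t0; rewrite /Rintegral.
pose q : {poly R} := l^-1 *: ('X - c%:P).
pose F := (l / b.+1%:R) *: q ^+ b.+1.
have E s : (l^-1 * (s - c)) ^+ b = (q ^+ b).[s] by rewrite horner_exp !hornerE.
under eq_integral do rewrite E.
have dF : F^`() = q ^+ b.
  have q' : q^`() = (l^-1)%:P.
    by rewrite derivZ derivB derivX derivC subr0 -mul_polyC mulr1.
  rewrite derivZ deriv_exp q' /= mul_polyC -[X in _ *: X = _]scaler_nat !scalerA.
  rewrite (_ : _ * _ = 1) ?scale1r//.
  by rewrite mulrA divfK ?pnatr_eq0// divff ?gt_eqF.
have ab : c < c + l * t by rewrite ltrDl mulr_gt0.
rewrite (@continuous_FTC2 _ _ (horner F)) //.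
- rewrite -EFinB /= /F /q !(hornerZ, horner_exp, hornerD, hornerN, hornerX, hornerC).
  rewrite subrr mulr0 expr0n /= mulr0 subr0 (addrC c) addrK mulKf ?gt_eqF//.
  by rewrite mulrAC mulrA.
- by apply: continuous_subspaceT => x; exact: continuous_horner.
- split.
  + by move=> x _; exact: derivable_horner.
  + by apply: cvg_at_right_filter; exact: continuous_horner.
  + by apply: cvg_at_left_filter; exact: continuous_horner.
- by move=> x _; rewrite -derivE dF.
Qed.

End dual_steps.

Section dual_functions.
Context {R : realType} (N : nat).
Local Notation lam := (@lebesgue_measure R).

Let node (i : 'I_N.+1) : R := i.+1%:R / N.+1%:R.

Let node_gt0 i : 0 < node i. Proof. by rewrite divr_gt0 ?ltr0n. Qed.

Let node_le1 i : node i <= 1.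
Proof. by rewrite ler_pdivrMr ?ltr0n// mul1r ler_nat. Qed.

(* [V i b] is the integral of [v ^+ b] over [[0, node i]]. *)
Let V : 'M[R]_N.+1 := \matrix_(i, b) (node i ^+ b.+1 / b.+1%:R).

(** Up to scaling of rows by [node i] and of columns by [1/(b + 1)], this is a Vandermonde matrix
    with distinct nodes. *)
Let V_unit : V \in unitmx.
Proof.
have -> : V = diag_mx (\row_i node i) *m (Vandermonde N.+1 (\row_i node i))^T
    *m diag_mx (\row_b (b.+1%:R)^-1).
  apply/matrixP => i b; rewrite mul_mx_diag mul_diag_mx !mxE exprS.
  by [].
rewrite !unitmx_mul unitmx_tr !unitmxE !det_diag det_Vandermonde !unitfE.
apply/andP; split; first (apply/andP; split).
- by apply/prodf_neq0 => i _; rewrite mxE gt_eqF.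
- apply/prodf_neq0 => i _; apply/prodf_neq0 => j ij; rewrite !mxE subr_eq0.
  rewrite (inj_eq (mulIf _)) ?invr_eq0 ?pnatr_eq0// eqr_nat eqSS.
  by rewrite neq_ltn ij orbT.
- by apply/prodf_neq0 => i _; rewrite mxE invr_eq0 pnatr_eq0.
Qed.

(** The family biorthogonal to [1, v, ..., v ^+ N] on [[0, 1]]. Step functions suffice, an atom
    having only to be bounded, and their integrals against powers are explicit. *)
Definition dual_fun (a : 'I_N.+1) (v : R) : R :=
  \sum_i invmx V a i * \1_(`[0, node i]%classic) v.

Lemma dual_fun_supp a v : dual_fun a v != 0 -> 0 <= v <= 1.
Proof.
apply: contraNT => v01; rewrite /dual_fun big1// => i _.
rewrite indicE memNset ?mulr0//= in_itv /= => /andP[v0 vi].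
by move: v01; rewrite v0 (le_trans vi).
Qed.

Lemma dual_fun_bound : exists2 B : R, 0 <= B & forall a v, `|dual_fun a v| <= B.
Proof.
exists (\sum_a \sum_i `|invmx V a i|).
  by apply: sumr_ge0 => a _; exact: sumr_ge0.
move=> a v; rewrite (bigD1 a)//= -[leLHS]addr0.
apply: lerD; last by apply: sumr_ge0 => b _; exact: sumr_ge0.
rewrite (le_trans (ler_norm_sum _ _ _))//; apply: ler_sum => i _.
rewrite normrM -[leRHS]mulr1; apply: ler_wpM2l => //.
by rewrite indicE; case: (_ \in _); rewrite ?normr1 ?normr0.
Qed.

Let scaled (c l : R) s := l^-1 * (s - c).

Let measurable_scaled c l : measurable_fun [set: measurableTypeR R] (scaled c l).
Proof.
apply: continuous_measurable_fun => x.
have -> : scaled c l = horner (l^-1 *: ('X - c%:P)).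
  by apply/funext => y; rewrite /scaled hornerZ !hornerE.
exact: continuous_horner.
Qed.

Lemma bdds1_dual (c l : R) a b : 0 < l ->
  bdds1 (fun s => dual_fun a (l^-1 * (s - c)) * (l^-1 * (s - c)) ^+ b).
Proof.
move=> l0; split.
  apply: measurable_funM.
    apply: measurable_sum => i; apply: measurable_funM => //.
    by apply: (measurableT_comp (measurable_indic _)) => //; exact: measurable_scaled.
  by apply: measurable_funX; exact: measurable_scaled.
have [B B0 HB] := dual_fun_bound.
exists (`|c| + l), B => s; split.
  rewrite normrM; have [->|] := eqVneq (dual_fun a (l^-1 * (s - c))) 0.
    by rewrite normr0 mul0r.
  move=> /dual_fun_supp /andP[s0 s1]; rewrite -[leRHS]mulr1 ler_pM//.
  by rewrite ger0_norm ?exprn_ge0// exprn_ile1.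
rewrite mulf_eq0 negb_or => /andP[/dual_fun_supp + _].
rewrite mulrC => /andP[]; rewrite pmulr_lge0 ?invr_gt0// ler_pdivrMr// mul1r => s0 s1.
by rewrite -[s](subrK c) addrC (le_trans (ler_normD _ _))// lerD2l ger0_norm.
Qed.

(** By [integral_power] each indicator contributes [l * V i b], so the sum is [l] times an entry of
    [invmx V *m V]. *)
Lemma integral_dual (c l : R) (a b : 'I_N.+1) : 0 < l ->
  \int[lam]_s (dual_fun a (l^-1 * (s - c)) * (l^-1 * (s - c)) ^+ b) = l *+ (a == b).
Proof.
move=> l0.
pose q i s := \1_(`[c, c + l * node i]%classic) s * (l^-1 * (s - c)) ^+ b.
have qE i s : \1_(`[0, node i]%classic) (l^-1 * (s - c)) * (l^-1 * (s - c)) ^+ b = q i s.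
  rewrite /q; congr (_ * _); rewrite !indicE; congr (nat_of_bool _)%:R.
  apply/idP/idP; rewrite !inE /= !in_itv /= [l^-1 * _]mulrC.
    rewrite pmulr_lge0 ?invr_gt0// ler_pdivrMr// [node i * l]mulrC; lra.
  rewrite pmulr_lge0 ?invr_gt0// ler_pdivrMr// [node i * l]mulrC; lra.
have qI i : lam.-integrable [set: _] (EFin \o q i).
  apply: bdds1_integrable; split.
    apply: measurable_funM; first exact: measurable_indic.
    by apply: measurable_funX; exact: measurable_scaled.
  exists (`|c| + l), 1 => s; rewrite /q indicE.
  have [|_] := boolP (s \in _); last by rewrite mul0r normr0 eqxx.
  rewrite mul1r inE /= in_itv /= => /andP[cs sc].
  have sl : s - c <= l.
    rewrite lerBlDl (le_trans sc)// lerD2l -[leRHS]mulr1.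
    by apply: ler_wpM2l; [exact: ltW|exact: node_le1].
  split.
    have s0 : 0 <= l^-1 * (s - c) by rewrite mulr_ge0 ?invr_ge0 ?subr_ge0// ltW.
    rewrite normrX exprn_ile1// ger0_norm//.
    by rewrite mulrC ler_pdivrMr// mul1r.
  move=> _; rewrite -[s](subrK c) addrC (le_trans (ler_normD _ _))// lerD2l.
  by rewrite ger0_norm// subr_ge0.
transitivity (\sum_i invmx V a i * \int[lam]_s q i s).
  rewrite /dual_fun.
  transitivity (\int[lam]_s (\sum_i invmx V a i * q i s)).
    apply: eq_Rintegral => s _; rewrite mulr_suml; apply: eq_bigr => i _.
    by rewrite -mulrA qE.
  rewrite /Rintegral; under eq_integral do rewrite -sumEFin.
  rewrite integral_sum//; last first.
    by move=> i; under eq_fun do rewrite EFinM; apply: integrableZl => //; exact: qI.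
  rewrite -sum_fine; last first.
    move=> i _; under eq_integral do rewrite EFinM.
    by apply: integrable_fin_num => //; apply: integrableZl => //; exact: qI.
  by apply: eq_bigr => i _; apply: RintegralZl => //; exact: qI.
transitivity (\sum_i invmx V a i * (l * V i b)).
  apply: eq_bigr => i _; congr (_ * _); rewrite mxE -(integral_power c)//.
  rewrite [RHS]Rintegral_mkcond; apply: eq_Rintegral => s _.
  by rewrite /q patchE indicE; case: ifP; rewrite ?mul1r ?mul0r.
under eq_bigr do rewrite mulrCA.
rewrite -mulr_sumr; have := mulVmx V_unit => /matrixP /(_ a b).
by rewrite !mxE => ->; rewrite mulr_natr.
Qed.

End dual_functions.

Section moment_match.
Context {R : realType} (n N : nat).
Local Notation Rn := 'rV[R]_n.

Definition cent (c : 'I_n -> R) (l : R) (z : Rn) (i : 'I_n) := l^-1 * (z ord0 i - c i).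

Definition centmon (c : 'I_n -> R) (l : R) (a : {ffun 'I_n -> 'I_N.+1}) (z : Rn) :=
  \prod_i cent c l z i ^+ a i.

(** Expansion in the dual functions of the cube of corner [c] and side [l], the coefficients being
    the normalized moments of [phi]. Exponents are bounded coordinatewise, not in total degree, so
    that integrals factor over the coordinates. *)
Definition match_mom (c : 'I_n -> R) (l : R) (phi : Rn -> R) (x : Rn) : R :=
  \sum_(a : {ffun 'I_n -> 'I_N.+1})
    (l ^- n * rint (fun z => phi z * centmon c l a z)) *
    \prod_i dual_fun (a i) (cent c l x i).

Lemma measurable_centmon c l a : measurable_fun [set: Rn] (centmon c l a).
Proof.
apply: measurable_prod => i _; apply: measurable_funX.
apply: measurable_funM => //; apply: measurable_funB => //.
exact: measurable_coord.
Qed.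

Lemma measurable_monomial b : measurable_fun [set: Rn] (@monomial R n b).
Proof.
by apply: measurable_prod => i _; apply: measurable_funX; exact: measurable_coord.
Qed.

Lemma centmon_bounded c l a (A : R) : exists B : R, forall x : Rn,
  (forall i : 'I_n, `|x ord0 i| <= A) -> `|centmon c l a x| <= B.
Proof.
exists (\prod_i (`|l^-1| * (A + `|c i|)) ^+ a i) => x xA.
rewrite normr_prod; apply: ler_prod => i _; rewrite normr_ge0 normrX /=.
apply: lerXn2r; rewrite ?nnegrE//.
  by rewrite mulr_ge0// addr_ge0// (le_trans _ (xA i)).
rewrite normrM; apply: ler_wpM2l => //.
by rewrite (le_trans (ler_normB _ _))// lerD2r.
Qed.

Lemma monomial_bounded b (A : R) : exists B : R, forall x : Rn,
  (forall i : 'I_n, `|x ord0 i| <= A) -> `|monomial b x| <= B.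
Proof.
exists (\prod_i A ^+ b i) => x xA.
rewrite normr_prod; apply: ler_prod => i _; rewrite normr_ge0 normrX /=.
by apply: lerXn2r; rewrite ?nnegrE// (le_trans _ (xA i)).
Qed.

Lemma bdds_centmon c l a g : bdds g -> bdds (fun x => g x * centmon c l a x).
Proof.
move=> gb; apply: bddsM => //; first exact: measurable_centmon.
exact: centmon_bounded.
Qed.

Lemma bdds_monomial b g : bdds g -> bdds (fun x : Rn => g x * monomial b x).
Proof.
move=> gb; apply: bddsM => //; first exact: measurable_monomial.
exact: monomial_bounded.
Qed.

(** Binomial expansion of each [x_i = c_i + l t_i], with [t_i] the centred coordinate, followed by
    distribution of the product over the sums. *)
Lemma monomial_centmon c (l : R) (b : 'I_n -> nat) : l != 0 -> (forall i, (b i <= N)%N) ->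
  exists e : {ffun 'I_n -> 'I_N.+1} -> R,
  forall x : Rn, monomial b x = \sum_a e a * centmon c l a x.
Proof.
move=> l0 bN.
exists (fun a : {ffun 'I_n -> 'I_N.+1} => \prod_i (c i ^+ (b i - a i) * l ^+ a i *+ 'C(b i, a i))) => x.
rewrite /monomial.
transitivity (\prod_i \sum_(j < N.+1)
    (c i ^+ (b i - j) * l ^+ j *+ 'C(b i, j)) * cent c l x i ^+ j).
  apply: eq_bigr => i _.
  rewrite [in LHS](_ : x ord0 i = c i + l * cent c l x i); last first.
    by rewrite /cent mulrA divff// mul1r addrC subrK.
  rewrite exprDn (big_ord_widen N.+1 (fun j =>
    c i ^+ (b i - j) * (l * cent c l x i) ^+ j *+ 'C(b i, j))) ?ltnS//.
  rewrite big_mkcond; apply: eq_bigr => j _; case: ifPn => [_|].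
    by rewrite exprMn mulrA mulrnAl.
  by rewrite -leqNgt => bj; rewrite bin_small// mulr0n mul0r.
rewrite bigA_distr_bigA; apply: eq_bigr => a _.
by rewrite big_split.
Qed.

Lemma bdds_match c l phi : 0 < l -> bdds (match_mom c l phi).
Proof.
move=> l0; apply: bdds_sum => a _; apply: bddsZ.
have := @bdds_tensor R n (fun i s => dual_fun (a i) (l^-1 * (s - c i)) *
  (l^-1 * (s - c i)) ^+ 0) (fun i => bdds1_dual (c i) (a i) 0 l0).
rewrite /tensor; under eq_fun do under eq_bigr do rewrite expr0 mulr1.
exact.
Qed.

Lemma match_supp c l phi x : match_mom c l phi x != 0 ->
  forall i, 0 <= cent c l x i <= 1.
Proof.
move=> m0 i; apply: contraNT m0 => ci; rewrite /match_mom big1// => a _.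
rewrite (bigD1 i)//= (_ : dual_fun _ _ = 0) ?mul0r ?mulr0//.
by apply/eqP; apply: contraNT ci => /dual_fun_supp.
Qed.

(** By linearity it is enough to test centred monomials. Biorthogonality then leaves a single term,
    whose factor [l ^+ n] cancels the normalization. *)
Lemma match_moment c l phi (b : 'I_n -> nat) : 0 < l -> bdds phi ->
  (forall i, (b i <= N)%N) ->
  rint (fun x => match_mom c l phi x * monomial b x) =
  rint (fun x => phi x * monomial b x).
Proof.
move=> l0 phib bN.
have [e eE] := @monomial_centmon c l b (lt0r_neq0 l0) bN.
suff H a : rint (fun x => match_mom c l phi x * centmon c l a x) =
    rint (fun x => phi x * centmon c l a x).
  transitivity (\sum_a e a * rint (fun x => match_mom c l phi x * centmon c l a x)).
    rewrite -[RHS](eq_bigr _ (fun a _ => rintZ (e a) (bdds_centmon c l a (bdds_match c phi l0)))).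
    rewrite -rint_sum => [|a _]; last by apply: bddsZ; exact/bdds_centmon/bdds_match.
    congr rint; apply/funext => x; rewrite eE mulr_sumr; apply: eq_bigr => a _.
    by rewrite mulrCA.
  under eq_bigr do rewrite H.
  rewrite -[LHS](eq_bigr _ (fun a _ => rintZ (e a) (bdds_centmon c l a phib))).
  rewrite -rint_sum => [|a _]; last by apply: bddsZ; exact/bdds_centmon.
  congr rint; apply/funext => x; rewrite eE mulr_sumr; apply: eq_bigr => a' _.
  by rewrite mulrCA.
pose T (g : {ffun 'I_n -> 'I_N.+1}) := tensor (fun i s =>
  dual_fun (g i) (l^-1 * (s - c i)) * (l^-1 * (s - c i)) ^+ a i).
have Tb g : bdds (T g) by apply: bdds_tensor => i; exact: bdds1_dual.
transitivity (\sum_g (l ^- n * rint (fun z => phi z * centmon c l g z)) * rint (T g)).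
  rewrite -[RHS](eq_bigr _ (fun g _ => rintZ _ (Tb g))).
  rewrite -rint_sum => [|g _]; last exact: bddsZ.
  congr rint; apply/funext => x; rewrite /match_mom mulr_suml.
  by apply: eq_bigr => g _; rewrite /T /tensor big_split -[LHS]mulrA.
have TE g : rint (T g) = l ^+ n *+ (g == a).
  rewrite /T rint_tensor => [|i]; last exact: bdds1_dual.
  under eq_bigr do rewrite integral_dual//.
  have [->|ga] := eqVneq g a.
    by under eq_bigr do rewrite eqxx mulr1n; rewrite prodr_const card_ord mulr1n.
  have /existsP[i gai] : [exists i, g i != a i].
    rewrite -negb_forall; apply: contra ga => /forallP h.
    by apply/eqP/ffunP => i; exact/eqP.
  by rewrite (bigD1 i)//= (negbTE gai) mulr0n mul0r.
rewrite (bigD1 a)//= big1 => [|g ga]; last by rewrite TE (negbTE ga) mulr0.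
rewrite addr0 TE eqxx mulr1n mulrAC mulVf ?mul1r// expf_neq0//.
exact: lt0r_neq0.
Qed.

End moment_match.

Section integral_any.
Context d (T : measurableType d) {R : realType}.
Variable mu : {measure set T -> \bar R}.
Local Open Scope ereal_scope.

(** The grand maximal function is not known to be measurable; monotonicity is therefore read off
    from the integral as a supremum over the simple functions below. *)
Lemma le_integral_any (f g : T -> \bar R) :
  (forall x, 0 <= f x) -> (forall x, f x <= g x) ->
  \int[mu]_x f x <= \int[mu]_x g x.
Proof.
move=> f0 fg; rewrite !ge0_integralTE//; last by move=> x; exact: le_trans (fg x).
apply: ge_ereal_sup => _ [h/= hf] <-.
by apply: ereal_sup_ubound; exists h => //= x; exact: le_trans (fg x).
Qed.

End integral_any.

(** * Tensor products as test functions *)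

Section tensor_smooth.
Context {R : realType} (n : nat).
Local Notation Rn := 'rV[R]_n.
Implicit Types (u : 'I_n -> R -> R) (x : Rn).

Definition updf u (i : 'I_n) (v : R -> R) : 'I_n -> R -> R :=
  fun j => if j == i then v else u j.

(** Along a coordinate direction only one factor moves. Equating the difference quotients as
    functions of [h] transfers derivability and the value of the derivative at once. *)
Lemma tensor_diff_quot (k : R) u (i : 'I_n) x :
  let w s := k * \prod_(j | j != i) u j (x ord0 j) * u i s in
  (fun h : R => h^-1 *: (((fun y => k * tensor u y) \o shift x) (h *: delta_mx ord0 i)
    - k * tensor u x)) =
  (fun h : R => h^-1 *: ((w \o shift (x ord0 i)) (h *: 1) - w (x ord0 i))).
Proof.
move=> w; apply/funext => h; congr (_ *: (_ - _)).
  have E j : (h *: delta_mx ord0 i + x) ord0 j = h * (j == i)%:R + x ord0 j.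
    by rewrite !mxE eqxx.
  rewrite /w /= /tensor (bigD1 i)//= E eqxx -mulrA; congr (_ * _).
  rewrite mulrC; congr (_ * _).
  by apply: eq_bigr => j ji; rewrite E (negbTE ji) mulr0 add0r.
by rewrite /w /tensor (bigD1 i)//= -mulrA; congr (_ * _); rewrite mulrC.
Qed.

Lemma derivable_tensor k u i x : smooth1 (u i) ->
  derivable (fun y => k * tensor u y) x (delta_mx ord0 i).
Proof.
move=> su; rewrite /derivable tensor_diff_quot.
exact: (smooth1_derivable (smooth1Z _ su)).
Qed.

Lemma partial_tensor k u i : smooth1 (u i) ->
  partial i (fun y => k * tensor u y) =
  (fun y => k * tensor (updf u i (derive1 (u i))) y).
Proof.
move=> su; apply/funext => x; rewrite /partial /derive tensor_diff_quot.
rewrite -[LHS]derive1E derive1_scale//.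
rewrite /tensor [in RHS](bigD1 i)//= /updf eqxx -mulrA; congr (_ * _).
rewrite mulrC; congr (_ * _).
by apply: eq_bigr => j /negbTE ->.
Qed.

Lemma smooth1_updf u i v : (forall j, smooth1 (u j)) -> smooth1 v ->
  forall j, smooth1 (updf u i v j).
Proof. by move=> su sv j; rewrite /updf; case: eqP. Qed.

Lemma continuous_tensor k u : (forall i, smooth1 (u i)) ->
  continuous (fun y : Rn => k * tensor u y).
Proof.
move=> su.
have H s : continuous (fun y : Rn => \prod_(i <- s) u i (y ord0 i)).
  elim: s => [|i s IH].
    rewrite [X in continuous X](_ : _ = cst 1); first exact: cst_continuous.
    by apply/funext => y; rewrite big_nil.
  rewrite [X in continuous X](_ : _ =
    (fun y : Rn => u i (y ord0 i) * \prod_(j <- s) u j (y ord0 j))); last first.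
    by apply/funext => y; rewrite big_cons.
  move=> x; apply: continuousM; last exact: IH.
  apply: continuous_comp; first exact: coord_continuous.
  exact: smooth1_continuous.
by move=> x; apply: continuousM; [exact: cst_continuous|exact: H].
Qed.

Lemma class_C_tensor m k u : (forall i, smooth1 (u i)) ->
  class_C m (fun y => k * tensor u y).
Proof.
elim: m u => [|m IH] u su; split => //; try exact: continuous_tensor.
move=> i; split; first by move=> x; exact: derivable_tensor.
rewrite partial_tensor//; apply: IH; apply: smooth1_updf => //.
exact: smooth1_derive1.
Qed.

Lemma iter_partial_tensor m k u i : (forall i, smooth1 (u i)) ->
  iter m (partial i) (fun y => k * tensor u y) =
  (fun y => k * tensor (updf u i (derive1n m (u i))) y).
Proof.
move=> su; elim: m => [|m IH].
  apply/funext => y; congr (_ * tensor _ _); apply/funext => j.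
  by rewrite /updf; case: eqP => // ->.
rewrite iterS IH partial_tensor; last first.
  by apply: smooth1_updf => //; exact: smooth1_derive1n.
apply/funext => y; congr (_ * tensor _ _); apply/funext => j.
by rewrite /updf eqxx; case: eqP.
Qed.

Lemma Dmulti_tensor (a : multiindex n) k u : (forall i, smooth1 (u i)) ->
  Dmulti a (fun y => k * tensor u y) =
  (fun y => k * tensor (fun i => derive1n (a i) (u i)) y).
Proof.
move=> su; rewrite /Dmulti.
suff H s : uniq s -> foldr (fun i g => iter (a i) (partial i) g) (fun y => k * tensor u y) s =
    (fun y => k * tensor (fun i => if i \in s then derive1n (a i) (u i) else u i) y).
  rewrite H ?enum_uniq//; apply/funext => y; congr (_ * tensor _ _).
  by apply/funext => i; rewrite mem_enum.
elim: s => [//|i s IH] /= /andP[si us].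
rewrite IH// iter_partial_tensor; last first.
  by move=> j; case: ifP => // _; exact: smooth1_derive1n.
apply/funext => y; congr (_ * tensor _ _); apply/funext => j.
by rewrite /updf (negbTE si) in_cons; case: eqP => [->|].
Qed.

Definition ctensor (k : R) u : Rn -> R[i] := fun x => (k * tensor u x)%:C.

Lemma modulus_real (r : R) : modulus (r%:C) = `|r|.
Proof. by rewrite /modulus /= expr0n /= addr0 sqrtr_sqr. Qed.

Lemma DmultiC_ctensor a k u x : (forall i, smooth1 (u i)) ->
  DmultiC a (ctensor k u) x = (k * tensor (fun i => derive1n (a i) (u i)) x)%:C.
Proof.
move=> su; rewrite /DmultiC /ctensor /= Dmulti_tensor//; congr (_ +i* _).
rewrite (_ : (fun _ => _) = (fun y => 0 * tensor u y)).
  by rewrite Dmulti_tensor// mul0r.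
by apply/funext => y; rewrite mul0r.
Qed.

Lemma schwartz_ctensor k u (A : R) : (forall i, smooth1 (u i)) ->
  (forall i v, A < `|v| -> u i v = 0) -> schwartz (ctensor k u).
Proof.
move=> su u0; split.
  move=> m; split; first exact: class_C_tensor.
  rewrite (_ : (fun _ => _) = (fun y => 0 * tensor u y)); first exact: class_C_tensor.
  by apply/funext => y; rewrite mul0r.
move=> b a.
have /choice[M HM] (i : 'I_n) : exists M : R,
    forall v, `|v ^+ a i * derive1n (b i) (u i) v| <= M.
  have sv : smooth1 (fun v : R => v ^+ a i * derive1n (b i) (u i) v).
    apply: smooth1M; last exact: smooth1_derive1n.
    by have := @smooth1_horner R 'X^(a i); under eq_fun do rewrite hornerXn.
  have [C [C0 HC]] := @continuous_bounded R _ (- A) A (smooth1_continuous sv).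
  exists C => v; have [vA|vA] := boolP (- A <= v <= A); first exact: HC.
  rewrite (@derive1n_vanish R (b i) (u i) (- A) A)// ?mulr0 ?normr0//.
  by move=> w wA; rewrite u0// ltNge ler_norml.
exists (`|k| * \prod_i M i) => x; rewrite DmultiC_ctensor// modulus_real.
rewrite normrM mulrCA; apply: ler_wpM2l => //.
rewrite -normrM /monomial /tensor -big_split normr_prod /=.
by apply: ler_prod => i _; rewrite normr_ge0 HM.
Qed.

Lemma euclidean_norm_le x (A : R) : (forall i, `|x ord0 i| <= A) ->
  euclidean_norm x <= Num.sqrt (\sum_(i < n) A ^+ 2).
Proof.
move=> xA; apply: ler_wsqrtr; apply: ler_sum => i _.
rewrite -real_normK ?num_real//.
by apply: lerXn2r; rewrite ?nnegrE// (le_trans _ (xA i)).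
Qed.

(** On the box of half-side [A] the weight is at most [E] and the squared derivatives sum to at most
    [k ^+ 2 * S]; off the box they vanish. So the integral is at most [k ^+ 2 * K], and
    [k = 1/(1 + K)] makes it at most 1, uniformly in [u]. *)
Lemma test_class_ctensor (N0 : nat) (A B : R) : 0 <= A -> 0 <= B ->
  exists2 k : R, 0 < k & forall u, (forall i, smooth1 (u i)) ->
    (forall i v, A < `|v| -> u i v = 0) ->
    (forall i a v, (a <= N0)%N -> `|derive1n a (u i) v| <= B) ->
    test_class N0 (ctensor k u).
Proof.
move=> A0 B0.
pose S := \sum_(a : {ffun 'I_n -> 'I_N0.+1} | (mdegree (fun i => a i) <= N0)%N)
  (B ^+ n) ^+ 2.
pose E := (1 + Num.sqrt (\sum_(i < n) A ^+ 2)) ^+ N0.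
pose K := E * S * (A - - A) ^+ n.
have S0 : 0 <= S by apply: sumr_ge0 => a _; rewrite sqr_ge0.
have E0 : 0 <= E by rewrite exprn_ge0// addr_ge0// sqrtr_ge0.
have K0 : 0 <= K by rewrite !mulr_ge0// exprn_ge0//; lra.
exists (1 + K)^-1; first by rewrite invr_gt0; lra.
set k := (1 + K)^-1 => u su u0 uB; split; first exact: schwartz_ctensor u0.
have k0 : 0 <= k by rewrite invr_ge0; lra.
have kK : k ^+ 2 * K <= 1.
  rewrite /k exprVn mulrC ler_pdivrMr ?mul1r; last by rewrite exprn_gt0//; lra.
  nra.
apply: (@le_trans _ _ (\int[lebesgue_rV R n]_x
   ((k ^+ 2 * (E * S))%:E * (\1_(box (- A) A) x)%:E))%E).
  apply: le_integral_any => x.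
    rewrite lee_fin mulr_ge0 ?exprn_ge0 ?addr_ge0 ?sqrtr_ge0//.
    by apply: sumr_ge0 => a _; rewrite sqr_ge0.
  rewrite -EFinM lee_fin indicE.
  under eq_bigr do rewrite DmultiC_ctensor// modulus_real.
  have [xA|] := boolP (x \in _); last first.
    rewrite mulr0 => /negP xA; rewrite big1 ?mulr0// => a _.
    have [i xi] : exists i, A < `|x ord0 i|.
      apply: contrapT => /forallNP h; apply: xA; rewrite inE => i.
      by rewrite in_itv /= -ler_norml leNgt; apply/negP; exact: h.
    rewrite /tensor (bigD1 i)//= (@derive1n_vanish R (a i) (u i) (- A) A)//.
    - by rewrite mul0r mulr0 normr0 expr0n.
    - by move=> w wA; rewrite u0// ltNge ler_norml.
    - by rewrite -ler_norml -ltNge.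
  move: xA; rewrite inE /= => xA; rewrite mulr1 mulrCA; apply: ler_pM.
  - by rewrite exprn_ge0// addr_ge0// sqrtr_ge0.
  - by apply: sumr_ge0 => a _; rewrite sqr_ge0.
  - apply: lerXn2r; rewrite ?nnegrE ?addr_ge0 ?sqrtr_ge0// lerD2l.
    by apply: euclidean_norm_le => i; have := xA i; rewrite in_itv /= ler_norml.
  - rewrite mulr_sumr; apply: ler_sum => a _.
    rewrite normrM exprMn (ger0_norm k0); apply: ler_wpM2l; first exact: sqr_ge0.
    apply: lerXn2r; rewrite ?nnegrE ?exprn_ge0// /tensor normr_prod.
    rewrite -[X in B ^+ X]card_ord -prodr_const; apply: ler_prod => i _.
    by rewrite normr_ge0 uB// -ltnS.
rewrite ge0_integralZl//; last 2 first.
- by apply/measurable_EFinP; apply: measurable_indic; exact: measurable_box.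
- by rewrite lee_fin !mulr_ge0// sqr_ge0.
rewrite integral_indic//; last exact: measurable_box.
rewrite setIT [X in (_ * X <= _)%E]mu_box; last by lra.
by rewrite -EFinM lee_fin -mulrA.
Qed.

End tensor_smooth.

(** * Bump functions tested against the grand maximal function *)

Section maximal_bound.
Context {R : realType} (n : nat).
Local Notation Rn := 'rV[R]_n.
Implicit Types (f : Rn -> R[i]) (x y z : Rn).

Lemma Re_le_modulus (w : R[i]) : `|complex.Re w| <= modulus w.
Proof.
case: w => a b; rewrite /modulus /= -sqrtr_sqr; apply: ler_wsqrtr.
by rewrite lerDl sqr_ge0.
Qed.

Lemma Im_le_modulus (w : R[i]) : `|complex.Im w| <= modulus w.
Proof.
case: w => a b; rewrite /modulus /= -sqrtr_sqr; apply: ler_wsqrtr.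
by rewrite lerDr sqr_ge0.
Qed.

(** The supremum is over a nonempty set, as the zero tensor belongs to the test class. *)
Lemma grand_maximal_ge0 N0 f y : (0 <= grand_maximal N0 (distribution_of f) y)%E.
Proof.
have [k k0 Hk] := @test_class_ctensor R n N0 0 0 (lexx 0) (lexx 0).
have tc : test_class N0 (ctensor k (fun (_ : 'I_n) (_ : R) => 0)).
  apply: Hk => // [i|i a v _]; first exact: smooth1_cst.
  by rewrite derive1n_0 normr0.
apply: (@le_trans _ _ (modulus (convolve (dilate 1 (ctensor k (fun (_ : 'I_n) (_ : R) => 0)))
    (distribution_of f) y))%:E); first by rewrite lee_fin sqrtr_ge0.
by apply: ereal_sup_ubound; exists (ctensor k (fun (_ : 'I_n) (_ : R) => 0)), 1.
Qed.

(** After multiplication by the normalizing [k], the tensor is a test function, and its dilate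
    paired with [f] is [h ^- n * k] times the pairing with [phi]. As [phi] is real, the two
    integrals are the real and imaginary parts of one convolution. *)
Lemma maximal_tensor (N0 : nat) (A B : R) : 0 <= A -> 0 <= B ->
  exists2 C : R, 0 < C & forall f,
    bdds (fun x => complex.Re (f x)) -> bdds (fun x => complex.Im (f x)) ->
    forall (u : 'I_n -> R -> R), (forall i, smooth1 (u i)) ->
    (forall i v, A < `|v| -> u i v = 0) ->
    (forall i a v, (a <= N0)%N -> `|derive1n a (u i) v| <= B) ->
    forall (h : R) y, 0 < h ->
    let phi z := tensor u (h^-1 *: (y - z)) in
    (`|rint (fun z => complex.Re (f z) * phi z)|%:E <=
      (C * h ^+ n)%:E * grand_maximal N0 (distribution_of f) y)%E /\
    (`|rint (fun z => complex.Im (f z) * phi z)|%:E <=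
      (C * h ^+ n)%:E * grand_maximal N0 (distribution_of f) y)%E.
Proof.
move=> A0 B0; have [k k0 Hk] := @test_class_ctensor R n N0 A B A0 B0.
exists k^-1; first by rewrite invr_gt0.
move=> f Rf If u su u0 uB h y h0 phi.
have tc := Hk u su u0 uB.
have mphi : measurable_fun [set: Rn] phi.
  rewrite (_ : phi = tensor (fun i v => u i (- h^-1 * v + h^-1 * y ord0 i))).
    apply: measurable_tensor => i; apply: continuous_measurable_fun.
    by apply: smooth1_continuous; exact: smooth1_affine.
  apply/funext => z; apply: eq_bigr => i _; rewrite !mxE; congr (u _ _); ring.
have phib g : bdds g -> bdds (fun z => g z * phi z).
  move=> gb; apply: bddsM => // C; exists (\prod_(i < n) B) => z _.
  rewrite /phi /tensor normr_prod; apply: ler_prod => i _.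
  by rewrite normr_ge0 (uB i 0%N).
pose s := h ^- n * k.
have s0 : 0 < s by rewrite mulr_gt0// invr_gt0 exprn_gt0.
have E g : bdds g -> rint (fun z => g z * (s * phi z)) = s * rint (fun z => g z * phi z).
  by move=> gb; rewrite -rintZ; [congr rint; apply/funext => z; rewrite mulrCA|exact: phib].
pose W := convolve (dilate h (ctensor k u)) (distribution_of f) y.
have WE z : f z * dilate h (ctensor k u) (y - z) =
    (complex.Re (f z) * (s * phi z)) +i* (complex.Im (f z) * (s * phi z)).
  have -> : dilate h (ctensor k u) (y - z) = (s * phi z)%:C.
    by rewrite /dilate /ctensor -rmorphM /= /s mulrA.
  move: (s * phi z) => t; case: (f z) => a b.
  by rewrite /GRing.mul /= !mulr0 subr0 add0r.
have WM : ((modulus W)%:E <= grand_maximal N0 (distribution_of f) y)%E.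
  by apply: ereal_sup_ubound; exists (ctensor k u), h.
have WR : complex.Re W = s * rint (fun z => complex.Re (f z) * phi z).
  rewrite -E//; congr rint; apply/funext => z.
  by rewrite WE.
have WI : complex.Im W = s * rint (fun z => complex.Im (f z) * phi z).
  rewrite -E//; congr rint; apply/funext => z.
  by rewrite WE.
have fin t : `|s * t| <= modulus W ->
    (`|t|%:E <= (k^-1 * h ^+ n)%:E * grand_maximal N0 (distribution_of f) y)%E.
  move=> tW; apply: (@le_trans _ _ ((k^-1 * h ^+ n)%:E * (modulus W)%:E)%E).
    rewrite -EFinM lee_fin (_ : k^-1 * h ^+ n = s^-1); last first.
      by rewrite /s invfM invrK mulrC.
    by rewrite mulrC ler_pdivlMr// mulrC -[X in X * _](gtr0_norm s0) -normrM.
  apply: lee_wpmul2l => //.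
  by rewrite lee_fin mulr_ge0 ?invr_ge0 ?exprn_ge0// ltW.
split; apply: fin; first by rewrite -WR Re_le_modulus.
by rewrite -WI Im_le_modulus.
Qed.

End maximal_bound.

(** * Stopping times on a tree of refinements *)

Section overlap.
Context {R : realType} {T : finType} (Cf : T -> T -> R).
Context (Cf_ge0 : forall m m', 0 <= Cf m m').
Context (Cf_sum : forall m', \sum_m Cf m m' <= 1).
Context (tch st : nat -> T -> bool) (nu : R).
Context (count_tch : forall k, \sum_(m | tch k m) (1 : R) <= nu).
Context (whitney : forall k m m',
  tch k.+1 m -> st k.+1 m -> tch k m' -> st k m').
Context (X : nat -> T -> R) (A : R) (A_ge0 : 0 <= A).
Context (X_ge0 : forall k m, 0 <= X k m).
Context (X_tch : forall k m, ~~ tch k m -> X k m = 0).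

Let leaf k m := (k == 0)%N || st k m.

Context (X_leaf : forall k p m, ~~ st k.+1 p -> Cf p m != 0 -> leaf k m -> X k m <= A).
Context (X_node : forall k m, ~~ st k.+1 m -> X k.+1 m <= \sum_m' Cf m m' * X k m').

Let U k := \sum_(m | ~~ leaf k m) X k m.

(** Exchange the sums: each value of level [k] is handed on with total weight at most 1. Values at
    non-leaves add up to at most [U k]; a leaf counts only if it touches the point, and then at most
    [A]. *)
Let U_step k : U k.+1 <= A * \sum_(m | leaf k m && tch k m) 1 + U k.
Proof.
apply: (@le_trans _ _ (\sum_(m | ~~ leaf k.+1 m) \sum_m' Cf m m' * X k m')).
  by apply: ler_sum => m; rewrite /leaf /= => /X_node.
rewrite exchange_big /= (bigID (leaf k)) /=; apply: lerD; last first.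
  apply: ler_sum => m' _; rewrite -mulr_suml ler_piMl//.
  rewrite (le_trans _ (Cf_sum m'))// [leRHS](bigID (fun m => ~~ leaf k.+1 m))/=.
  by rewrite lerDl sumr_ge0.
rewrite (bigID (tch k)) /= [X in _ + X]big1 ?addr0; last first.
  by move=> m' /andP[_ tm']; apply: big1 => m _; rewrite X_tch ?mulr0.
rewrite mulr_sumr; apply: ler_sum => m' /andP[lm' tm']; rewrite mulr1.
apply: (@le_trans _ _ (\sum_(m | ~~ leaf k.+1 m) Cf m m' * A)).
  apply: ler_sum => m; rewrite {1}/leaf /= => sm.
  have [->|c0] := eqVneq (Cf m m') 0; first by rewrite !mul0r.
  by apply: ler_wpM2l => //; exact: X_leaf c0 _.
rewrite -mulr_suml ler_piMl//.
rewrite (le_trans _ (Cf_sum m'))// [leRHS](bigID (fun m => ~~ leaf k.+1 m))/=.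
by rewrite lerDl sumr_ge0.
Qed.

Let nu_ge0 : 0 <= nu.
Proof. by apply: le_trans (count_tch 0); exact: sumr_ge0. Qed.

Let U_step_nu k : U k.+1 <= nu * A + U k.
Proof.
apply: (le_trans (U_step k)); rewrite lerD2r mulrC; apply: ler_wpM2r => //.
apply: le_trans (count_tch k); rewrite [leRHS](bigID (leaf k))/=.
under [X in _ <= X + _]eq_bigl do rewrite andbC.
by rewrite lerDl sumr_ge0.
Qed.

Let U_eq0 k : (forall m, tch k m -> leaf k m) -> U k = 0.
Proof.
move=> tl; apply: big1 => m lm; apply: X_tch; exact: contra (tl m) lm.
Qed.

(* If a leaf of level [k] touches the given point, then by [whitney] all the nodes
   of level [k - 1] touching it are leaves, so that at most two levels contribute. *)
Lemma overlap_sum k : \sum_(m | ~~ leaf k m) X k m <= 2 * (nu * A).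
Proof.
rewrite -/(U k); have nA : 0 <= nu * A by exact: mulr_ge0.
elim: k => [|k IH]; first by rewrite U_eq0// mulr_ge0.
have [/existsP[m /andP[lm tm]]|/existsPn h] := boolP [exists m, leaf k m && tch k m].
  apply: (le_trans (U_step_nu k)).
  case: k lm tm {IH} => [|k] lm tm; first by rewrite U_eq0//; lra.
  have := U_step_nu k; rewrite (@U_eq0 k) ?addr0; last first.
    by move=> m' tm'; apply/orP; right; exact: (whitney tm).
  lra.
apply: (le_trans (U_step k)); rewrite big_pred0 ?mulr0 ?add0r//.
by move=> m; apply/negbTE; exact: h.
Qed.

Lemma overlap_node k m : ~~ st k.+1 m -> X k.+1 m <= 2 * (nu * A).
Proof.
move=> sm; apply: le_trans (overlap_sum k.+1).
by rewrite (bigD1 m)//= lerDl sumr_ge0.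
Qed.

End overlap.

(** The terms below [M] form a geometric series dominated by the last one. The auxiliary bound
    [2 ^+ J * t] serves the induction step in which the new term is present. *)
Lemma dyadic_sum {R : realType} (J : nat) (t M : R) : 0 < t -> 0 <= M ->
  \sum_(j < J) (if 2 ^+ j * t < M then 2 ^+ j * t else 0) <= 2 * M.
Proof.
move=> t0 M0.
suff [] : \sum_(j < J) (if 2 ^+ j * t < M then 2 ^+ j * t else 0) <= 2 * M /\
  \sum_(j < J) (if 2 ^+ j * t < M then 2 ^+ j * t else 0) <= 2 ^+ J * t by [].
elim: J => [|J [IH1 IH2]].
  by rewrite big_ord0 mul1r (ltW t0) mulr_ge0.
have p0 : 0 < 2 ^+ J * t by rewrite mulr_gt0// exprn_gt0.
rewrite big_ord_recr /= exprS; case: ifPn => h; last first.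
  by rewrite addr0; split=> //; rewrite (le_trans IH2)//; lra.
by split; lra.
Qed.

(** * Stopped sums and their decomposition on an abstract tree *)

Section tree.
Context {R : realType} {T : finType} {P : Type} (Cf : T -> T -> R).
Context (Cf_ge0 : forall m m', 0 <= Cf m m').
Context (Cf_sum : forall m', \sum_m Cf m m' <= 1).
Context (touch : nat -> T -> P -> bool) (near_node : nat -> T -> P -> Prop).
Context (nu : R) (nu_ge0 : 0 <= nu).
Context (count_touch : forall k x, \sum_(m | touch k m x) (1 : R) <= nu).
Context (touch_near : forall k m x, touch k m x -> near_node k m x).
Context (near_touch : forall k m m' x y, touch k.+1 m x -> touch k m' x ->
  near_node k m' y -> near_node k.+1 m y).
Context (touch_parent : forall k m m' x, Cf m m' != 0 -> touch k m' x -> touch k.+1 m x).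
Context (Mt : P -> R) (Mt_ge0 : forall x, 0 <= Mt x).
Context (F G : nat -> T -> P -> R) (C0 : R) (C0_ge0 : 0 <= C0).
Context (F_node : forall k m x, F k.+1 m x = \sum_m' Cf m m' * F k m' x).
Context (G0 : forall m, G 0 m = F 0 m).
Context (G_touch : forall k m x, G k m x != 0 -> touch k m x).
Context (G_parent : forall k p m x y, Cf p m != 0 -> near_node k.+1 p y ->
  `|G k m x| <= C0 * Mt y).
Context (G_near : forall k m x y, near_node k m y -> `|G k m x| <= C0 * Mt y).

Definition stopped (t : R) k m := `[< forall y, near_node k m y -> t < Mt y >].

Fixpoint stop_fun (t : R) k m : P -> R :=
  if k is k'.+1 then
    if stopped t k m then G k m else fun x => \sum_m' Cf m m' * stop_fun t k' m' x
  else G 0 m.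

Lemma stop_fun_touch t k m x : stop_fun t k m x != 0 -> touch k m x.
Proof.
elim: k m => [|k IH] m /=; first exact: G_touch.
case: ifP => _; first exact: G_touch.
move=> s0; have /existsP[m' ] : [exists m', Cf m m' * stop_fun t k m' x != 0].
  rewrite -negb_forall; apply: contra s0 => /forallP s0.
  by rewrite big1// => m' _; exact/eqP.
by rewrite mulf_eq0 negb_or => /andP[/touch_parent h /IH /h].
Qed.

(** An invariance principle: whatever relation holds between [G] and [F] and passes through the node
    identity holds for stopped sums. It is applied to equality of moments. *)
Lemma stop_fun_eq (E : (P -> R) -> (P -> R) -> Prop) t :
  (forall k m, E (G k m) (F k m)) ->
  (forall k m (g : T -> P -> R), (forall m', E (g m') (F k m')) ->
     E (fun x => \sum_m' Cf m m' * g m' x) (F k.+1 m)) ->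
  forall k m, E (stop_fun t k m) (F k m).
Proof.
move=> EG EF; elim=> [|k IH] m /=; first by have := EG 0%N m.
by case: ifP => _; [exact: EG|apply: EF => m'; exact: IH].
Qed.

(** Neighbourhoods are nonempty, so above the supremum of [Mt] no node is stopped and the recursion
    reaches level 0, where [G0] makes it exact. *)
Lemma stop_fun_top t k m : (forall y, Mt y <= t) ->
  (forall k m, exists y, near_node k m y) -> stop_fun t k m = F k m.
Proof.
move=> Mtt ex; elim: k m => [|k IH] m /=; first exact: G0.
rewrite ifF; last first.
  apply/asboolPn => h; have [y ny] := ex k.+1 m.
  by have := h y ny; rewrite ltNge Mtt.
by apply/funext => x; rewrite F_node; apply: eq_bigr => m' _; rewrite IH.
Qed.

Lemma not_stopped t k m : ~~ stopped t k m -> exists2 y, near_node k m y & Mt y <= t.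
Proof.
move=> /asboolPn/existsNP[y /not_implyP[ny /negP]]; rewrite -leNgt => My.
by exists y.
Qed.

(** The neighbourhood of a node lies in that of every node one level coarser touching the same
    point, so being stopped is inherited downwards. *)
Let whitney t x k m m' :
  touch k.+1 m x -> stopped t k.+1 m -> touch k m' x -> stopped t k m'.
Proof.
move=> tm /asboolP sm tm'; apply/asboolP => y ny; apply: sm.
exact: near_touch tm tm' ny.
Qed.

(** At a leaf the stopped sum is [G], and an unstopped parent has a nearby [y] with [Mt y <= t];
    hence [G_parent] gives the value [C0 * t] for the constant [A] of [overlap_node]. *)
Lemma stop_fun_bound t k m x : 0 <= t -> ~~ stopped t k.+1 m ->
  `|stop_fun t k.+1 m x| <= 2 * (nu * (C0 * t)).
Proof.
move=> t0 sm.
apply: (@overlap_node R T Cf Cf_ge0 Cf_sum (fun k m => touch k m x) (stopped t) nu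
  (fun k => count_touch k x) (@whitney t x)
  (fun k m => `|stop_fun t k m x|) (C0 * t)) => //.
- exact: mulr_ge0.
- move=> {sm m}k m; apply: contraNeq; rewrite normr_eq0; exact: stop_fun_touch.
- move=> {sm m}k p m /not_stopped[y ny My] c0 lf.
  rewrite (_ : stop_fun t k m = G k m); last first.
    by case: k lf {ny} => //= k ->.
  apply: (le_trans (G_parent x c0 ny)); exact: ler_wpM2l.
- move=> {sm m}k m sm /=; rewrite (negbTE sm).
  apply: (le_trans (ler_norm_sum _ _ _)); apply: ler_sum => m' _.
  by rewrite normrM ger0_norm.
Qed.

(* The sum of the coefficients, over the atoms containing [x], of the decomposition
   of [stop_fun t' k m - stop_fun t k m], when every coefficient is [b]. *)
Fixpoint level_cost (b t : R) k m (x : P) : R :=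
  if k is k'.+1 then
    if stopped t k m then b * (touch k m x)%:R
    else \sum_m' Cf m m' * level_cost b t k' m' x
  else 0.

Lemma level_cost_ge0 b t k m x : 0 <= b -> 0 <= level_cost b t k m x.
Proof.
move=> b0; elim: k m => [//|k IH] m /=; case: ifP => _; first exact: mulr_ge0.
by apply: sumr_ge0 => m' _; exact: mulr_ge0.
Qed.

Lemma level_cost_touch b t k m x : level_cost b t k m x != 0 -> touch k m x.
Proof.
elim: k m => [|k IH] m /=; first by rewrite eqxx.
case: ifP => _; first by case: touch => //; rewrite mulr0 eqxx.
move=> s0; have /existsP[m' ] : [exists m', Cf m m' * level_cost b t k m' x != 0].
  rewrite -negb_forall; apply: contra s0 => /forallP s0.
  by rewrite big1// => m' _; exact/eqP.
by rewrite mulf_eq0 negb_or => /andP[/touch_parent h /IH /h].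
Qed.

(** Touched points are near points, so every atom created at threshold [t] lives where [Mt] exceeds
    [t]. This later cuts the sum over thresholds at [Mt x]. *)
Lemma level_cost_eq0 b t k m x : Mt x <= t -> level_cost b t k m x = 0.
Proof.
move=> Mx; elim: k m => [//|k IH] m /=; case: ifPn => [/asboolP sm|_].
  have [tm|] := boolP (touch k.+1 m x); last by rewrite mulr0.
  by have := sm x (touch_near tm); rewrite ltNge Mx.
by apply: big1 => m' _; rewrite IH mulr0.
Qed.

(** The stopped nodes of level [k + 1] itself cost [nu * b]; the unstopped ones cost twice that by
    [overlap_sum]. *)
Lemma level_cost_sum (T0 : pred T) b t k x : 0 <= b ->
  \sum_(m | T0 m) level_cost b t k.+1 m x <= 3 * (nu * b).
Proof.
move=> b0.
apply: (@le_trans _ _ (\sum_m level_cost b t k.+1 m x)).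
  rewrite [leRHS](bigID T0)/= lerDl; apply: sumr_ge0 => m _.
  exact: (@level_cost_ge0 b t k.+1 m x b0).
rewrite (bigID (stopped t k.+1))/=.
have -> : 3 * (nu * b) = nu * b + 2 * (nu * b) by ring.
apply: lerD.
  rewrite (bigID (fun m => touch k.+1 m x))/= [X in _ + X]big1 ?addr0; last first.
    move=> m /andP[_ tm]; apply/eqP; apply: contraNT tm => h.
    exact: (@level_cost_touch b t k.+1 m x h).
  apply: (@le_trans _ _ (\sum_(m | touch k.+1 m x) b)).
    rewrite [leRHS](bigID (stopped t k.+1))/=.
    under [X in _ <= X + _]eq_bigl do rewrite andbC.
    rewrite -[leLHS]addr0; apply: lerD; last by exact: sumr_ge0.
    by apply: ler_sum => m /andP[-> ->]; rewrite mulr1.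
  have := ler_wpM2r b0 (count_touch k.+1 x).
  by rewrite mulr_suml; under eq_bigr do rewrite mul1r.
apply: (@overlap_sum R T Cf Cf_ge0 Cf_sum (fun k m => touch k m x) (stopped t) nu
  (fun k => count_touch k x) (@whitney t x)
  (fun k m => level_cost b t k m x) b b0 _ _ _ _ k.+1) => //.
- by move=> k' m; exact: (@level_cost_ge0 b t k' m x b0).
- move=> k' m; apply: contraNeq => h; exact: (@level_cost_touch b t k' m x h).
- move=> [//|{}k] p m _ _ /= sm; rewrite sm.
  by case: touch; rewrite ?mulr1 ?mulr0.
- by move=> {}k m sm /=; rewrite (negbTE sm).
Qed.

(** [Dec F1 S1] stands for an atomic decomposition of [F1] whose coefficients, weighted by the
    indicators of their cubes, sum to at most [S1]. *)
Context (Dec : (P -> R) -> (P -> R) -> Prop).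
Context (Dec0 : Dec (fun=> 0) (fun=> 0)).
Context (DecD : forall F1 S1 F2 S2, Dec F1 S1 -> Dec F2 S2 ->
  Dec (fun x => F1 x + F2 x) (fun x => S1 x + S2 x)).
Context (DecZ : forall c F1 S1, 0 <= c -> Dec F1 S1 ->
  Dec (fun x => c * F1 x) (fun x => c * S1 x)).
Context (Dec_atom : forall t b k m, 0 < b ->
  (forall x, `|stop_fun t k m x - G k m x| <= b) ->
  Dec (fun x => stop_fun t k m x - G k m x) (fun x => b * (touch k m x)%:R)).

Lemma Dec_sum (I : Type) (s : seq I) (p : pred I) (F1 S1 : I -> P -> R) :
  (forall i, p i -> Dec (F1 i) (S1 i)) ->
  Dec (fun x => \sum_(i <- s | p i) F1 i x) (fun x => \sum_(i <- s | p i) S1 i x).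
Proof.
move=> D; elim: s => [|i s IH].
  under eq_fun do rewrite big_nil.
  by under [X in Dec _ X]eq_fun do rewrite big_nil.
have [pi|pi] := boolP (p i).
  under eq_fun do rewrite big_cons pi.
  under [X in Dec _ X]eq_fun do rewrite big_cons pi.
  by apply: DecD => //; exact: D.
under eq_fun do rewrite big_cons (negbTE pi).
by under [X in Dec _ X]eq_fun do rewrite big_cons (negbTE pi).
Qed.

(** [2 * nu * C0] comes from the stopped sum, [C0] from [G], and the last 1 keeps atom coefficients
    positive. *)
Let C2 := (2 * nu + 1) * C0 + 1.

(** A node stopped at [t'] is stopped at [t], so both recursions run in parallel until the lower
    threshold stops. There the difference is [stop_fun t'] minus [G], a single atom. *)
Lemma Dec_level t t' k m : t <= t' -> 0 < t' ->
  Dec (fun x => stop_fun t' k m x - stop_fun t k m x) (level_cost (C2 * t') t k m).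
Proof.
move=> tt' t'0; elim: k m => [|k IH] m.
  by rewrite (_ : (fun _ => _) = fun=> 0)//; apply/funext => x /=; rewrite subrr.
have C2t : 0 < C2 * t'.
  by rewrite mulr_gt0// ltr_wpDl// mulr_ge0// addr_ge0// mulr_ge0.
have [st|st] := boolP (stopped t k.+1 m).
  rewrite (_ : (fun _ => _) = fun x => stop_fun t' k.+1 m x - G k.+1 m x); last first.
    by apply/funext => x; rewrite [stop_fun t _ _]/= st.
  rewrite (_ : level_cost _ _ _ _ = fun x => C2 * t' * (touch k.+1 m x)%:R); last first.
    by apply/funext => x; rewrite /= st.
  apply: Dec_atom => // x.
  (* If [t'] stops here too, the difference is 0; otherwise both terms are of size [t'], by
     [stop_fun_bound] and by a near point where [Mt] is at most [t']. *)
  have [st'|st'] := boolP (stopped t' k.+1 m).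
    by rewrite /= st' subrr normr0 ltW.
  have [y ny My] := not_stopped st'.
  apply: (le_trans (ler_normB _ _)).
  have h1 := stop_fun_bound x (ltW t'0) st'.
  have h2 : `|G k.+1 m x| <= C0 * t'.
    by apply: (le_trans (G_near _ ny)); exact: ler_wpM2l.
  apply: (le_trans (lerD h1 h2)).
  by rewrite /C2 !mulrDl; have := ltW t'0; lra.
have st' : ~~ stopped t' k.+1 m.
  apply: contra st => /asboolP st'; apply/asboolP => y ny.
  exact: le_lt_trans tt' (st' y ny).
rewrite (_ : (fun _ => _) = fun x =>
    \sum_m' Cf m m' * (stop_fun t' k m' x - stop_fun t k m' x)); last first.
  apply/funext => x; rewrite /= (negbTE st) (negbTE st') -sumrB.
  by apply: eq_bigr => m' _; rewrite mulrBr.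
rewrite (_ : level_cost _ _ _ _ = fun x =>
    \sum_m' Cf m m' * level_cost (C2 * t') t k m' x); last first.
  by apply/funext => x; rewrite /= (negbTE st).
by apply: Dec_sum => m' _; apply: DecZ.
Qed.

Lemma Dec_tree (T0 : pred T) (t0 H : R) k : 0 < t0 ->
  (forall y, Mt y <= H) -> (forall k m, exists y, near_node k m y) ->
  (forall m, T0 m -> stopped t0 k.+1 m) ->
  exists2 S : P -> R, Dec (fun x => \sum_(m | T0 m) (F k.+1 m x - G k.+1 m x)) S &
    forall x, S x <= 12 * (nu * C2) * Mt x.
Proof.
move=> t00 MH ex T0s.
have [J HJ] : exists J : nat, H <= 2 ^+ J * t0.
  have [J HJ] : exists J : nat, H / t0 <= J%:R.
    by exists (Num.bound `|H / t0|); rewrite (le_trans (ler_norm _))// ltW// archi_boundP.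
  exists J; rewrite -ler_pdivrMr//; apply: (le_trans HJ).
  by rewrite -natrX ler_nat ltnW// ltn_expl.
pose tau j := 2 ^+ j * t0.
have tau_gt0 j : 0 < tau j by rewrite mulr_gt0// exprn_gt0.
have tauS j : tau j.+1 = 2 * tau j by rewrite /tau exprS mulrA.
exists (fun x => \sum_(j < J) \sum_(m | T0 m)
  level_cost (C2 * tau j.+1) (tau j) k.+1 m x).
  rewrite (_ : (fun _ => _) = fun x => \sum_(j < J) \sum_(m | T0 m)
      (stop_fun (tau j.+1) k.+1 m x - stop_fun (tau j) k.+1 m x)).
    apply: Dec_sum => j _; apply: Dec_sum => m _; apply: Dec_level => //.
    by rewrite tauS; have := ltW (tau_gt0 j); lra.
  apply/funext => x; rewrite exchange_big /=; apply: eq_bigr => m Tm.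
  (* The telescoping ends are [tau J], above [H], where the stopped sum is [F], and [tau 0 = t0],
     where every root of [T0] is stopped and gives [G]. *)
  rewrite -(big_mkord xpredT (fun j => stop_fun (tau j.+1) k.+1 m x - stop_fun (tau j) k.+1 m x)).
  rewrite telescope_sumr// stop_fun_top//; last by move=> y; exact: le_trans HJ.
  by rewrite /tau expr0 mul1r /= T0s.
move=> x.
have C20 : 0 <= C2 by rewrite addr_ge0// mulr_ge0// addr_ge0// mulr_ge0.
(* The factor 6 is 3 from [level_cost_sum] times 2 from [tau j.+1 = 2 * tau j]; [dyadic_sum] doubles
   it to 12. *)
apply: (@le_trans _ _ (\sum_(j < J) 6 * (nu * C2) * (if tau j < Mt x then tau j else 0))).
  apply: ler_sum => j _; case: ifPn => h.
    apply: (le_trans (level_cost_sum _ _ _ _ _)).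
      by rewrite mulr_ge0// ltW.
    by rewrite tauS; lra.
  rewrite mulr0 big1// => m _; apply: level_cost_eq0.
  by rewrite leNgt.
rewrite -mulr_sumr.
have -> : 12 * (nu * C2) * Mt x = 6 * (nu * C2) * (2 * Mt x) by ring.
apply: ler_wpM2l; first by rewrite !mulr_ge0.
exact: dyadic_sum.
Qed.

End tree.

(** * Functions dominated by a grand maximal function *)

Section uniform_continuity.
Context {R : realType} (n : nat).
Local Notation Rn := 'rV[R]_n.

(** Compactness makes the radius uniform for [x] in [K]. If only [z] is in [K] the roles are
    exchanged, and if neither is, both values vanish. *)
Lemma compact_support_uniform (f : Rn -> R) (K : set Rn) (e : R) :
  continuous f -> compact K -> (forall x, f x != 0 -> K x) -> 0 < e ->
  exists2 r : R, 0 < r & forall x z : Rn,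
    (forall i, `|z ord0 i - x ord0 i| < r) -> `|f z - f x| <= e.
Proof.
move=> cf cK fK e0.
have : \forall r \near (0 : R)^'+, K `<=` [set x : Rn | forall z : Rn,
    (forall i, `|z ord0 i - x ord0 i| < r) -> `|f z - f x| <= e].
  move: cK => /compact_near_coveringP cK.
  apply: (cK R (at_right (0 : R)) (fun r (x : Rn) => forall z : Rn,
    (forall i, `|z ord0 i - x ord0 i| < r) -> `|f z - f x| <= e)).
  move=> x Kx; have e20 : 0 < e / 2 by rewrite divr_gt0.
  have /cvgrPdist_lt/(_ _ e20)/nbhs_ballP[/= d d0 Hd] := cf x.
  have d20 : 0 < d / 2 by rewrite divr_gt0.
  exists (ball x (d / 2), [set r | r < d / 2]) => /=.
    split; first exact: nbhsx_ballx.
    exact: nbhs_right_lt.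
  move=> [y r] /= [[_ xy] rd] z zy.
  have fy : `|f x - f y| < e / 2.
    apply: Hd; split=> // i j; apply: lt_trans (xy i j) _; lra.
  have fz : `|f x - f z| < e / 2.
    apply: Hd; split=> // i j; have := xy i j; have := zy j; rewrite /ball /= (ord1 i).
    move=> h1 h2.
    rewrite (_ : x ord0 j - z ord0 j = (x ord0 j - y ord0 j) - (z ord0 j - y ord0 j)); last by ring.
    apply: (le_lt_trans (ler_normB _ _)); lra.
  rewrite (_ : f z - f y = (f x - f y) - (f x - f z)); last by ring.
  apply: (le_trans (ler_normB _ _)); lra.
move=> /nbhs_ballP[/= d d0 Hd].
have d20 : 0 < d / 2 by rewrite divr_gt0.
have HK : K `<=` [set x : Rn | forall z : Rn,
    (forall i, `|z ord0 i - x ord0 i| < d / 2) -> `|f z - f x| <= e].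
  apply: Hd => //; rewrite /ball /= sub0r normrN gtr0_norm//; lra.
exists (d / 2) => // x z xz.
have [Kx|nKx] := pselect (K x); first exact: HK.
have [Kz|nKz] := pselect (K z).
  by rewrite distrC; apply: HK => // i; rewrite distrC.
have -> : f x = 0 by apply/eqP; apply: contra_notT nKx => /fK.
have -> : f z = 0 by apply/eqP; apply: contra_notT nKz => /fK.
by rewrite subrr normr0 ltW.
Qed.

Lemma bdds_compact_support (f : Rn -> R) (K : set Rn) :
  continuous f -> compact K -> (forall x, f x != 0 -> K x) -> bdds f.
Proof.
move=> cf cK fK; split; first exact: continuous_measurable_rV.
have [A [_ HA]] := compact_bounded cK.
have [B [_ HB]] := compact_bounded (continuous_compact (continuous_subspaceT cf) cK).
exists (A + 1), (`|B| + 1) => x; split.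
  have [->|/fK Kx] := eqVneq (f x) 0; first by rewrite normr0 addr_ge0.
  by apply: HB; [rewrite ltr_pwDr// ler_norm|exists x].
move=> /fK Kx i; have : `|x| <= A + 1 by apply: HA => //; rewrite ltrDl.
apply: le_trans; rewrite [leRHS]mx_normE.
exact: (le_bigmax _ (fun ij : 'I_1 * 'I_n => `|x ij.1 ij.2|%:nng) (ord0, i)).
Qed.

End uniform_continuity.

Section dominated.
Context {R : realType} (n : nat) (N0 : nat).
Local Notation Rn := 'rV[R]_n.

(* The function [M] need not be finite or measurable, hence the bound [mu] on its
   value at [y]. *)
Definition dominated (C : R -> R -> R) (f : Rn -> R) (M : Rn -> \bar R) :=
  forall A B, 0 <= A -> 0 <= B -> forall b : 'I_n -> R -> R,
    (forall i, smooth1 (b i)) -> (forall i v, A < `|v| -> b i v = 0) ->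
    (forall i a v, (a <= N0)%N -> `|derive1n a (b i) v| <= B) ->
  forall (h : R) (c : 'I_n -> R) (y : Rn) (mu : R), 0 < h ->
    (forall i, `|y ord0 i - c i| <= A * h) -> (M y <= mu%:E)%E ->
  `|rint (fun z => f z * \prod_i b i (cent c h z i))| <= C A B * h ^+ n * mu.

(** A bump centred at [c] becomes, after reflection and translation, a tensor centred at [y]. As [y]
    is within [A * h] of [c], the support radius grows from [A] to [2 * A], while the bounds on
    derivatives are unchanged. *)
Lemma grand_maximal_dominated : exists2 C : R -> R -> R, (forall A B, 0 < C A B) &
  forall f : Rn -> R[i],
    bdds (fun x => complex.Re (f x)) -> bdds (fun x => complex.Im (f x)) ->
    dominated C (fun x => complex.Re (f x)) (grand_maximal N0 (distribution_of f)) /\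
    dominated C (fun x => complex.Im (f x)) (grand_maximal N0 (distribution_of f)).
Proof.
have /choice[C HC] (AB : R * R) : exists C : R, 0 < C /\ (0 <= AB.1 -> 0 <= AB.2 ->
    forall f, bdds (fun x => complex.Re (f x)) -> bdds (fun x => complex.Im (f x)) ->
    forall (u : 'I_n -> R -> R), (forall i, smooth1 (u i)) ->
    (forall i v, 2 * AB.1 < `|v| -> u i v = 0) ->
    (forall i a v, (a <= N0)%N -> `|derive1n a (u i) v| <= AB.2) ->
    forall (h : R) (y : Rn), 0 < h ->
    let phi z := tensor u (h^-1 *: (y - z)) in
    (`|rint (fun z => complex.Re (f z) * phi z)|%:E <=
      (C * h ^+ n)%:E * grand_maximal N0 (distribution_of f) y)%E /\
    (`|rint (fun z => complex.Im (f z) * phi z)|%:E <=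
      (C * h ^+ n)%:E * grand_maximal N0 (distribution_of f) y)%E).
  case: (boolP ((0 <= AB.1) && (0 <= AB.2))) => [/andP[A0 B0]|nAB].
    have A20 : 0 <= 2 * AB.1 by rewrite mulr_ge0.
    by have [C C0 HC] := @maximal_tensor R n N0 _ _ A20 B0; exists C.
  (* Nothing is claimed for negative parameters; the value 1 keeps the constant positive. *)
  by exists 1; split=> // A0 B0; move: nAB; rewrite A0 B0.
exists (fun A B => C (A, B)) => [A B|f Rf If]; first by case: (HC (A, B)).
have key (A B : R) : 0 <= A -> 0 <= B -> forall b : 'I_n -> R -> R,
    (forall i, smooth1 (b i)) -> (forall i v, A < `|v| -> b i v = 0) ->
    (forall i a v, (a <= N0)%N -> `|derive1n a (b i) v| <= B) ->
    forall (h : R) (c : 'I_n -> R) (y : Rn), 0 < h ->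
    (forall i, `|y ord0 i - c i| <= A * h) -> exists u : 'I_n -> R -> R,
    [/\ forall i, smooth1 (u i), forall i v, 2 * A < `|v| -> u i v = 0,
       forall i a v, (a <= N0)%N -> `|derive1n a (u i) v| <= B &
       forall z, tensor u (h^-1 *: (y - z)) = \prod_i b i (cent c h z i)].
  move=> A0 B0 b sb b0 bB h c y h0 yc.
  exists (fun i v => b i (-1 * v + h^-1 * (y ord0 i - c i))); split.
  - by move=> i; exact: smooth1_affine.
  - move=> i v vA; rewrite b0// mulN1r addrC -normrN opprB.
    have := yc i; rewrite -ler_pdivrMr// => yci.
    have h1 : `|h^-1 * (y ord0 i - c i)| <= A.
      by rewrite normrM (gtr0_norm (x := h^-1)) ?invr_gt0// mulrC.
    have := lerB_dist v (h^-1 * (y ord0 i - c i)); lra.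
  - move=> i a v aN; rewrite derive1n_affine// normrM normrX normrN1 expr1n mul1r.
    exact: bB.
  - move=> z; apply: eq_bigr => i _; rewrite !mxE /cent; congr (b _ _); ring.
split=> A B A0 B0 b sb b0 bB h c y mu h0 yc My.
  have [u [su u0 uB uE]] := key A B A0 B0 b sb b0 bB h c y h0 yc.
  have [_ /(_ A0 B0 f Rf If u su u0 uB h y h0) [HR _]] := HC (A, B).
  rewrite -lee_fin (_ : rint _ = rint (fun z => complex.Re (f z) * tensor u (h^-1 *: (y - z)))).
    apply: (le_trans HR); rewrite [leRHS]EFinM; apply: lee_wpmul2l => //.
    by rewrite lee_fin mulr_ge0 ?exprn_ge0// ltW//; case: (HC (A, B)).
  by congr rint; apply/funext => z; rewrite uE.
have [u [su u0 uB uE]] := key A B A0 B0 b sb b0 bB h c y h0 yc.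
have [_ /(_ A0 B0 f Rf If u su u0 uB h y h0) [_ HI]] := HC (A, B).
rewrite -lee_fin (_ : rint _ = rint (fun z => complex.Im (f z) * tensor u (h^-1 *: (y - z)))).
  apply: (le_trans HI); rewrite [leRHS]EFinM; apply: lee_wpmul2l => //.
  by rewrite lee_fin mulr_ge0 ?exprn_ge0// ltW//; case: (HC (A, B)).
by congr rint; apply/funext => z; rewrite uE.
Qed.

Definition bump (v : R) : R := smooth_step (v + 2) * smooth_step (2 - v).

Lemma smooth1_bump : smooth1 bump.
Proof.
apply: smooth1M.
  have := @smooth1_affine R 1 2 _ smooth1_step.
  by under eq_fun do rewrite mul1r.
have := @smooth1_affine R (-1) 2 _ smooth1_step.
by under eq_fun do rewrite mulN1r addrC.
Qed.

Lemma bump_ge0 v : 0 <= bump v.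
Proof. by rewrite mulr_ge0 ?smooth_step_ge0. Qed.

Lemma bump_le1 v : bump v <= 1.
Proof. by rewrite -[leRHS]mulr1 ler_pM ?smooth_step_ge0 ?smooth_step_le1. Qed.

Lemma bump_eq1 v : `|v| <= 1 -> bump v = 1.
Proof.
rewrite ler_norml => /andP[v1 v2].
by rewrite /bump !smooth_step_ge1 ?mulr1//; lra.
Qed.

Lemma bump_supp v : 2 < `|v| -> bump v = 0.
Proof.
rewrite ltNge ler_norml negb_and -!ltNge => /orP[v2|v2].
  by rewrite /bump smooth_step_le0 ?mul0r//; lra.
by rewrite /bump [smooth_step (2 - v)]smooth_step_le0 ?mulr0//; lra.
Qed.

Lemma bump_bound : exists2 B : R, 0 <= B &
  forall a v, (a <= N0)%N -> `|derive1n a bump v| <= B.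
Proof.
have [B [B0 HB]] := @smooth1_bounded R bump N0 (-2) 2 smooth1_bump.
exists B => // a v aN; have [v2|v2] := boolP (-2 <= v <= 2); first exact: HB.
rewrite (@derive1n_vanish R a bump (-2) 2) ?normr0//; first exact: smooth1_bump.
by move=> x x2; rewrite bump_supp// ltNge ler_norml.
Qed.

(** The bump is 1 on a cube of side [2 * h]. The cruder bound [h ^+ n] is the factor that occurs in
    [dominated]. *)
Lemma rint_bump_ge (x : Rn) (h : R) : 0 < h ->
  bdds (fun z => \prod_i bump (cent (fun i => x ord0 i) h z i)) /\
  h ^+ n <= rint (fun z => \prod_i bump (cent (fun i => x ord0 i) h z i)).
Proof.
move=> h0.
have b1 : bdds (fun z => \prod_i bump (cent (fun i => x ord0 i) h z i)).
  apply: (@bdds_tensor R n (fun i s => bump (h^-1 * (s - x ord0 i)))) => i; split.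
    apply: continuous_measurable_fun; apply: smooth1_continuous.
    rewrite (_ : (fun _ => _) = fun s => bump (h^-1 * s + (- (h^-1 * x ord0 i)))).
      by apply: smooth1_affine; exact: smooth1_bump.
    by apply/funext => s; congr bump; ring.
  exists (`|x ord0 i| + 2 * h), 1 => s; split.
    by rewrite ger0_norm ?bump_ge0// bump_le1.
  apply: contraNT; rewrite -ltNge => hs; rewrite bump_supp//.
  rewrite normrM (gtr0_norm (x := h^-1)) ?invr_gt0// mulrC ltr_pdivlMr//.
  have := lerB_dist s (x ord0 i); lra.
split=> //.
pose D : set Rn := [set z | forall i, z ord0 i \in
  `[(x - const_mx h) ord0 i, (x + const_mx h) ord0 i]%R].
have mD : measurable D.
  rewrite [X in measurable X](_ : _ = \bigcap_(i in [set: 'I_n])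
      ((fun x : 'rV[R]_n => x ord0 i) @^-1`
        `[(x - const_mx h) ord0 i, (x + const_mx h) ord0 i])).
    apply: fin_bigcap_measurable => // i _.
    by rewrite -[X in measurable X]setTI; exact: measurable_coord.
  by apply/seteqP; split => z /= H i; [move=> _; exact: H | exact: H].
have muD : lebesgue_rV R n D = ((2 * h) ^+ n)%:E.
  rewrite lebesgue_rV_box => [|i]; last by rewrite !mxE; lra.
  congr EFin; rewrite -[X in _ ^+ X]card_ord -prodr_const.
  by apply: eq_bigr => i _; rewrite !mxE; ring.
have Db : bdds (\1_D : Rn -> R).
  split; first exact: measurable_indic.
  exists (\sum_i `|x ord0 i| + h), 1 => z; rewrite indicE.
  have [zD|_] := boolP (z \in D); last by rewrite normr0 eqxx.
  split; first by rewrite normr1.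
  move=> _ i; move: zD; rewrite inE => /(_ i); rewrite in_itv /= !mxE => zi.
  have h1 : `|z ord0 i| <= `|x ord0 i| + h.
    have : `|z ord0 i - x ord0 i| <= h by rewrite ler_norml; lra.
    have := lerB_dist (z ord0 i) (x ord0 i); lra.
  by rewrite (le_trans h1)// lerD2r (bigD1 i)//= lerDl sumr_ge0.
apply: (@le_trans _ _ (rint (\1_D : Rn -> R))).
  rewrite /rint /Rintegral integral_indic// setIT [X in fine X]muD /=.
  by apply: lerXn2r; rewrite ?nnegrE ?mulr_ge0// ?ltW//; lra.
apply: le_rint => // z; rewrite indicE.
have [zD|_] := boolP (z \in D); last by apply: prodr_ge0 => i _; exact: bump_ge0.
rewrite big1// => i _; apply: bump_eq1.
move: zD; rewrite inE => /(_ i); rewrite in_itv /= !mxE => zi.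
rewrite /cent normrM (gtr0_norm (x := h^-1)) ?invr_gt0// mulrC ler_pdivrMr// mul1r.
by rewrite ler_norml; lra.
Qed.

(** The average of [f] against a bump at [x] differs from [f x] by at most the oscillation [w], and
    [dominated] bounds it by [C A B0 * mu], since the bump has integral at least [h ^+ n]. *)
Lemma pointwise_dominated : exists2 B0 : R, 0 <= B0 &
  forall C f M, (forall A B, 0 < C A B) -> bdds f -> dominated C f M ->
  (forall y, 0 <= M y)%E ->
  forall (A h mu w : R) (x y : Rn), 2 <= A -> 0 < h ->
    (forall i, `|y ord0 i - x ord0 i| <= A * h) -> (M y <= mu%:E)%E ->
    (forall z : Rn, (forall i, `|z ord0 i - x ord0 i| <= 2 * h) -> `|f z - f x| <= w) ->
  `|f x| <= w + C A B0 * mu.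
Proof.
have [B0 B00 HB0] := bump_bound; exists B0 => // C f M C0 fb dom M0 A h mu w x y A2 h0 xy My fw.
have mu0 : 0 <= mu by rewrite -lee_fin (le_trans (M0 y)).
have A0 : 0 <= A by lra.
have [Eb] := @rint_bump_ge x h h0.
set E := (fun z => \prod_i _) in Eb *; set I := rint E => hI.
have := dom A B0 A0 B00 (fun=> bump) (fun=> smooth1_bump).
move=> /(_ (fun i v vA => bump_supp (le_lt_trans A2 vA))).
move=> /(_ (fun i => HB0) h (fun i => x ord0 i) y mu h0 xy My) domE.
have E0 z : 0 <= E z by apply: prodr_ge0 => i _; exact: bump_ge0.
have fEb : bdds (fun z => f z * E z).
  apply: bddsM => //; first by case: Eb.
  by have [_ [? [B HB]]] := Eb; move=> ?; exists B => z _; case: (HB z).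
have w0 : 0 <= w by have := fw x; rewrite subrr normr0; apply => i; rewrite subrr normr0 mulr_ge0// ltW.
have osc : `|rint (fun z => f z * E z) - f x * I| <= w * I.
  rewrite /I -rintZ// -rintB//; last exact: bddsZ.
  rewrite -rintZ//; apply: ler_norm_rint; [by apply: bddsB => //; exact: bddsZ|exact: bddsZ|].
  move=> z; rewrite -mulrBl normrM (ger0_norm (E0 z)).
  have [/forallP zx|/forallPn[i zi]] := boolP [forall i, `|z ord0 i - x ord0 i| <= 2 * h].
    by apply: ler_wpM2r => //; exact: fw.
  have -> : E z = 0; last by rewrite !mulr0.
  rewrite /E (bigD1 i)//= bump_supp ?mul0r//.
  rewrite /cent normrM (gtr0_norm (x := h^-1)) ?invr_gt0// mulrC ltr_pdivlMr//.
  by rewrite ltNge.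
have hn0 : 0 < h ^+ n by rewrite exprn_gt0.
have I0 : 0 < I by exact: lt_le_trans hI.
rewrite -(ler_pM2r I0) -[X in _ * X](gtr0_norm I0) -normrM.
have := lerB_dist (f x * I) (rint (fun z => f z * E z)).
rewrite distrC => h1.
have h2 : C A B0 * h ^+ n * mu <= C A B0 * mu * I.
  rewrite mulrAC; apply: ler_wpM2l => //.
  by rewrite mulr_ge0// ltW.
rewrite mulrDl.
have domE' : `|rint (fun z => f z * E z)| <= C A B0 * h ^+ n * mu by exact: domE.
lra.
Qed.

(** At a scale where [f] oscillates by at most [|f x| / 2], a value of [M] below the chosen constant
    would give [|f x| <= 3/4 |f x|]. A large [rho] is absorbed into the parameter [A], on which the
    constant may depend. *)
Lemma dominated_gt0 C (f : Rn -> R) M (K : set Rn) (rho : R) (x : Rn) :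
  (forall A B, 0 < C A B) ->
  continuous f -> compact K -> (forall x, f x != 0 -> K x) ->
  dominated C f M -> (forall y, 0 <= M y)%E -> f x != 0 ->
  exists2 c : R, 0 < c & forall y : Rn,
    (forall i, `|y ord0 i - x ord0 i| <= rho) -> (c%:E <= M y)%E.
Proof.
move=> C0 cf cK fK dom M0 fx; have [B0 B00 HB] := pointwise_dominated.
have fx0 : 0 < `|f x| by rewrite normr_gt0.
have w0 : 0 < `|f x| / 2 by rewrite divr_gt0.
have [r r0 Hr] := compact_support_uniform cf cK fK w0.
have r40 : 0 < r / 4 by rewrite divr_gt0.
pose A := Num.max 2 (rho / (r / 4)).
exists (`|f x| / 4 / C A B0); first by rewrite !divr_gt0.
move=> y xy; rewrite leNgt; apply/negP => /ltW My.
have fb := bdds_compact_support cf cK fK.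
have := HB C f M C0 fb dom M0 A (r / 4) _ (`|f x| / 2) x y _ r40 _ My _.
have -> : C A B0 * (`|f x| / 4 / C A B0) = `|f x| / 4.
  by rewrite mulrC divfK// gt_eqF.
have -> : (`|f x| <= `|f x| / 2 + `|f x| / 4) = false.
  by apply/negbTE; rewrite -ltNge; lra.
move=> H; suff : false by []; apply: H.
- by rewrite le_max lexx.
- move=> i; apply: (le_trans (xy i)); rewrite -ler_pdivrMr//.
  by rewrite /A le_max lexx orbT.
- move=> z zx; apply: Hr => i; apply: (le_lt_trans (zx i)); lra.
Qed.

End dominated.

(** * Atomic decomposition of a dominated function *)

Section decomposition.
Context {R : realType} (n N : nat).
Local Notation Rn := 'rV[R]_n.

Definition real_atom (Q : set Rn) (a : Rn -> R) : Prop :=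
  [/\ measurable_fun [set: Rn] a, forall x, a x != 0 -> Q x,
      forall x, `|a x| <= 1 &
      forall b : multiindex n, (mdegree b <= N)%N ->
        rint (fun x => a x * monomial b x) = 0].

(** [S] is only a majorant of the weighted sum of indicators, so decompositions can be added and
    scaled together with their majorants. *)
Definition decomposes (F S : Rn -> R) : Prop :=
  exists (m : nat) (lambda : 'I_m -> R) (a : 'I_m -> Rn -> R) (Q : 'I_m -> set Rn),
  [/\ forall k, 0 <= lambda k,
      forall k, is_cube (Q k) /\ real_atom (Q k) (a k),
      forall x, F x = \sum_(k < m) lambda k * a k x &
      forall x, \sum_(k < m) lambda k * \1_(Q k) x <= S x].

Lemma decomposes0 : decomposes (fun=> 0) (fun=> 0).
Proof.
exists 0%N, (fun=> 0), (fun _ _ => 0), (fun=> set0).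
by split => [[]|[]|x|x] //; rewrite big_ord0.
Qed.

Definition osplit {m1 m2} {X : Type} (u : 'I_m1 -> X) (v : 'I_m2 -> X)
    (k : 'I_(m1 + m2)) : X :=
  match fintype.split k with inl i => u i | inr j => v j end.

Lemma osplit_lshift {m1 m2} {X : Type} (u : 'I_m1 -> X) (v : 'I_m2 -> X) i :
  osplit u v (lshift m2 i) = u i.
Proof. by rewrite /osplit -[lshift _ _]/(unsplit (inl i)) unsplitK. Qed.

Lemma osplit_rshift {m1 m2} {X : Type} (u : 'I_m1 -> X) (v : 'I_m2 -> X) i :
  osplit u v (rshift m1 i) = v i.
Proof. by rewrite /osplit -[rshift _ _]/(unsplit (inr i)) unsplitK. Qed.

Lemma decomposesD F1 S1 F2 S2 : decomposes F1 S1 -> decomposes F2 S2 ->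
  decomposes (fun x => F1 x + F2 x) (fun x => S1 x + S2 x).
Proof.
move=> [m1 [l1 [a1 [Q1 [l10 aQ1 F1E S1E]]]]] [m2 [l2 [a2 [Q2 [l20 aQ2 F2E S2E]]]]].
exists (m1 + m2)%N, (osplit l1 l2), (osplit a1 a2), (osplit Q1 Q2); split.
- by move=> k; rewrite /osplit; case: fintype.split.
- by move=> k; rewrite /osplit; case: fintype.split.
- move=> x; rewrite big_split_ord /= F1E F2E; congr (_ + _); apply: eq_bigr => i _.
    by rewrite !osplit_lshift.
  by rewrite !osplit_rshift.
- move=> x; rewrite big_split_ord /=.
  under eq_bigr do rewrite !osplit_lshift.
  under [X in _ + X <= _]eq_bigr do rewrite !osplit_rshift.
  exact: lerD.
Qed.

Lemma decomposesZ c F S : 0 <= c -> decomposes F S ->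
  decomposes (fun x => c * F x) (fun x => c * S x).
Proof.
move=> c0 [m [l [a [Q [l0 aQ FE SE]]]]].
exists m, (fun k => c * l k), a, Q; split => //.
- by move=> k; exact: mulr_ge0.
- by move=> x; rewrite FE mulr_sumr; apply: eq_bigr => i _; rewrite mulrA.
- move=> x; under eq_bigr do rewrite -mulrA.
  by rewrite -mulr_sumr; exact: ler_wpM2l.
Qed.

Lemma decomposes_atom (g : Rn -> R) (Q : set Rn) (b : R) : 0 < b -> bdds g ->
  is_cube Q -> (forall x, g x != 0 -> Q x) -> (forall x, `|g x| <= b) ->
  (forall e : multiindex n, (mdegree e <= N)%N ->
    rint (fun x => g x * monomial e x) = 0) ->
  decomposes g (fun x => b * \1_Q x).
Proof.
move=> b0 gb cQ gQ gle gmom.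
exists 1%N, (fun=> b), (fun _ x => b^-1 * g x), (fun=> Q); split.
- by move=> _; exact: ltW.
- move=> _; split => //; split.
  + by apply: measurable_funM => //; case: gb.
  + move=> x; rewrite mulf_eq0 negb_or => /andP[_]; exact: gQ.
  + by move=> x; rewrite normrM gtr0_norm ?invr_gt0// mulrC ler_pdivrMr// mul1r.
  + move=> e eN; under eq_fun do rewrite -mulrA.
    by rewrite rintZ ?gmom ?mulr0//; exact: bdds_monomial.
- by move=> x; rewrite big_ord1 mulVKf// gt_eqF.
- by move=> x; rewrite big_ord1.
Qed.

End decomposition.

(** * The dyadic grid of splines *)

Section geometry.
Context {R : realType} (n N0 : nat).
Local Notation Rn := 'rV[R]_n.
Context (o h : R) (h_gt0 : 0 < h) (M : nat).
Local Notation T := {ffun 'I_n -> 'I_M}.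
Local Notation kap := (N0.+2%:R : R).

(** One index set of [M] nodes per axis, with common origin [o], serves every level; only the mesh
    doubles, so coarse grids reach far beyond the support of [f]. *)
Definition ell (k : nat) : R := h * 2 ^+ k.
Definition cen (k : nat) (m : T) (i : 'I_n) : R := o + ell k * (m i)%:R.
Definition psi (k : nat) (m : T) (x : Rn) : R :=
  \prod_i spline N0 k (cent (cen k m) (ell k) x i).
Definition tch (k : nat) (m : T) (x : Rn) : bool :=
  [forall i, 0 <= cent (cen k m) (ell k) x i <= kap].
Definition close (A : R) (k : nat) (m : T) (y : Rn) : Prop :=
  forall i, `|y ord0 i - cen k m i| <= A * ell k.
(** The coefficient of shift [j = b - 2 a] in [spline_refine]. The guard is needed since subtraction
    on [nat] truncates; beyond [2 a + N0 + 1] the binomial vanishes by itself. *)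
Definition ref1 (a b : nat) : R :=
  if (2 * a <= b)%N then 2 ^- N0 * 'C(N0.+1, b - 2 * a)%:R else 0.
Definition ref (m m' : T) : R := \prod_i ref1 (m i) (m' i).

Lemma ell_gt0 k : 0 < ell k.
Proof. by rewrite mulr_gt0// exprn_gt0. Qed.

Lemma ellS k : ell k.+1 = 2 * ell k.
Proof. by rewrite /ell exprS mulrCA. Qed.

Lemma ell_ge k : h <= ell k.
Proof. by apply: ler_peMr; [exact: ltW|rewrite exprn_ege1// ler1n]. Qed.

Lemma ref1_ge0 a b : 0 <= ref1 a b.
Proof.
by rewrite /ref1; case: ifP => // _; rewrite mulr_ge0// invr_ge0 exprn_ge0.
Qed.

Lemma ref_ge0 m m' : 0 <= ref m m'.
Proof. by apply: prodr_ge0 => i _; exact: ref1_ge0. Qed.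

(* Pascal's rule splits each 'C(N0 + 1, b - 2a) into two entries of row N0,
   and over all a these entries have pairwise distinct columns. *)
Lemma ref1_sum b (m : nat) : \sum_(a < m) ref1 a b <= 1.
Proof.
suff H : (\sum_(a < m) (if (2 * a <= b)%N then 'C(N0.+1, b - 2 * a) else 0) <= 2 ^ N0)%N.
  rewrite (_ : \sum_(a < m) _ = 2 ^- N0 *
      (\sum_(a < m) (if (2 * a <= b)%N then 'C(N0.+1, b - 2 * a) else 0))%:R).
    rewrite mulrC ler_pdivrMr ?exprn_gt0// mul1r -natrX ler_nat.
    exact: H.
  rewrite natr_sum mulr_sumr; apply: eq_bigr => a _; rewrite /ref1.
  by case: ifP; rewrite ?mulr0.
have P a : ((if 2 * a <= b then 'C(N0.+1, b - 2 * a) else 0) =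
    (if 2 * a <= b then 'C(N0, b - 2 * a) else 0) +
    (if (2 * a).+1 <= b then 'C(N0, b - (2 * a).+1) else 0))%N.
  case: (ltnP (2 * a) b) => ab; first by rewrite (ltnW ab) -(subnSK ab) binS.
  rewrite addn0; case: (leqP (2 * a) b) => // ba.
  have -> : b = (2 * a)%N by apply/eqP; rewrite eqn_leq ab.
  by rewrite subnn !bin0.
under eq_bigr do rewrite P.
have -> : (\sum_(a < m) ((if 2 * a <= b then 'C(N0, b - 2 * a) else 0) +
    (if (2 * a).+1 <= b then 'C(N0, b - (2 * a).+1) else 0)) =
    \sum_(c < 2 * m) (if c <= b then 'C(N0, b - c) else 0))%N.
  elim: m => [|m IH]; first by rewrite muln0 !big_ord0.
  by rewrite big_ord_recr /= IH mulnS add2n 2!big_ord_recr /= addnA.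
have B (j : nat) : (\sum_(c < j.+1) 'C(N0, c) <= 2 ^ N0)%N.
  have -> : (2 ^ N0 = \sum_(c < N0.+1) 'C(N0, c))%N.
    rewrite -[2%N]/(1 + 1)%N expnDn; apply: eq_bigr => i _.
    by rewrite !exp1n !muln1.
  have [jN|Nj] := leqP j N0.
    rewrite (big_ord_widen N0.+1 (fun c => 'C(N0, c)))// [leqRHS](bigID (fun c : 'I_N0.+1 => c < j.+1)%N)/=.
    exact: leq_addr.
  rewrite -!(big_mkord xpredT (fun c => 'C(N0, c))) (@big_cat_nat _ _ _ N0.+1)//=; last exact: ltnW.
  have -> : (\sum_(N0.+1 <= c < j.+1) 'C(N0, c) = 0)%N.
    by rewrite big_nat big1// => c /andP[Nc _]; rewrite bin_small.
  by rewrite addn0.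
apply: leq_trans (B b).
have -> : (\sum_(c < b.+1) 'C(N0, c) = \sum_(c < b.+1) 'C(N0, b - c))%N.
  by rewrite (reindex_inj rev_ord_inj)/=; apply: eq_bigr => i _; rewrite subSS.
rewrite -big_mkcond/=.
rewrite -!(big_mkord xpredT (fun c => 'C(N0, b - c))) -(big_mkord (fun c => c <= b)%N (fun c => 'C(N0, b - c))).
have [mb|bm] := leqP (2 * m) b.+1.
  rewrite [leqRHS](@big_cat_nat _ _ _ (2 * m))//=.
  rewrite big_mkcond/= (@leq_trans (\sum_(0 <= i < 2 * m) 'C(N0, b - i)))//; last exact: leq_addr.
  by apply: leq_sum => i _; case: ifP.
rewrite (@big_cat_nat _ _ _ b.+1)//=; last exact: ltnW.
have -> : (\sum_(b.+1 <= c < 2 * m | (c <= b)%N) 'C(N0, b - c) = 0)%N.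
  rewrite big_nat_cond big_pred0// => i; rewrite ltnNge.
  by case: (i <= b)%N; rewrite ?andbF.
rewrite addn0; by rewrite big_mkcond/=; apply: leq_sum => i _; case: ifP.
Qed.

Lemma ref_sum m' : \sum_m ref m m' <= 1.
Proof.
rewrite /ref -(bigA_distr_bigA (fun i (a : 'I_M) => ref1 a (m' i))).
suff /andP[] : 0 <= \prod_i \sum_(a < M) ref1 a (m' i) <= 1 by [].
elim/big_ind: _ => [|x y /andP[x0 x1] /andP[y0 y1]|i _].
- by rewrite ler01 lexx.
- by rewrite mulr_ge0// -[leRHS]mulr1 ler_pM.
- by rewrite ref1_sum andbT; apply: sumr_ge0 => a _; exact: ref1_ge0.
Qed.

(** All such [a] lie among the [N0 + 3] integers ending at the integer part of [v]. *)
Lemma count_interval (v : R) : \sum_(a < M) (if 0 <= v - a%:R <= kap then 1 else 0 : R)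
  <= N0.+3%:R.
Proof.
rewrite -big_mkcond/= sumr_const ler_nat.
have [v0|v0] := leP 0 v; last first.
  rewrite (@eq_card0 _ _) ?leq0n// => a; rewrite !inE; apply/negbTE.
  rewrite negb_and -!ltNge; apply/orP; left.
  by have := ler0n R a; lra.
pose t := Num.trunc v.
have /andP[tv vt] : t%:R <= v < t.+1%:R by apply: Num.Theory.truncn_itv.
rewrite cardE -(size_map val) -(size_iota (t - N0.+2) N0.+3).
apply: uniq_leq_size; first by rewrite map_inj_uniq ?enum_uniq//; exact: val_inj.
move=> _ /mapP[a aE ->].
have /andP[va0 va1] : 0 <= v - a%:R <= kap by move: aE; rewrite mem_enum.
rewrite mem_iota; apply/andP; split.
  rewrite leq_subLR addnC.
  have : (t%:R : R) <= (a + N0.+2)%:R by rewrite natrD; lra.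
  by rewrite ler_nat.
have at1 : (a < t.+1)%N by rewrite -(ltr_nat R); lra.
by rewrite (leq_trans at1)// addnS ltnS addnC -leq_subLR.
Qed.

End geometry.

Section nodes.
Context {R : realType} (n N0 : nat).
Local Notation Rn := 'rV[R]_n.
Context (o h : R) (h_gt0 : 0 < h) (M : nat).
Local Notation T := {ffun 'I_n -> 'I_M}.
Local Notation kap := (N0.+2%:R : R).
Local Notation ell := (ell h).
Local Notation cen := (cen o h).
Local Notation tch := (tch N0 o h).
Local Notation psi := (psi N0 o h).
Local Notation close := (close o h).
Local Notation ref := (@ref R n N0 M).
Implicit Types (m : T) (x y : Rn).

Let ell0 k : 0 < ell k := ell_gt0 h_gt0 k.

Lemma centE k m x i :
  cent (cen k m) (ell k) x i = (ell k)^-1 * (x ord0 i - o) - (m i)%:R.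
Proof.
rewrite /cent /cen opprD addrA mulrBr mulKf//.
by rewrite gt_eqF.
Qed.

Lemma cent_cen k m x i : x ord0 i - cen k m i = ell k * cent (cen k m) (ell k) x i.
Proof. by rewrite /cent mulrA mulfV ?mul1r// gt_eqF. Qed.

Lemma sum_tch k x : \sum_(m : T | tch k m x) (1 : R) <= N0.+3%:R ^+ n.
Proof.
rewrite big_mkcond /=.
pose v i := (ell k)^-1 * (x ord0 i - o).
have -> : \sum_(m : T) (if tch k m x then 1 else 0 : R) =
    \sum_(m : T) \prod_i (if 0 <= v i - (m i)%:R <= kap then 1 else 0 : R).
  apply: eq_bigr => m _; case: ifPn => [/forallP tm|/forallPn[i ti]].
    by rewrite big1// => i _; have := tm i; rewrite centE => ->.
  by rewrite (bigD1 i)//= -centE (negbTE ti) mul0r.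
rewrite -(bigA_distr_bigA (fun i (a : 'I_M) => if 0 <= v i - a%:R <= kap then 1 else 0 : R)).
rewrite -[X in _ ^+ X]card_ord -prodr_const; apply: ler_prod => i _.
rewrite count_interval andbT; apply: sumr_ge0 => a _.
by case: ifP.
Qed.

Lemma tch_close k m x : tch k m x -> close kap k m x.
Proof.
move=> /forallP tm i; have /andP[t0 t1] := tm i.
have e0 := ltW (ell0 k).
rewrite cent_cen ger0_norm; last exact: mulr_ge0.
by rewrite mulrC; exact: ler_wpM2r.
Qed.

Lemma close_le (A B : R) k m y : A <= B -> close A k m y -> close B k m y.
Proof.
by move=> AB cA i; apply: (le_trans (cA i)); apply: ler_wpM2r => //; exact: ltW.
Qed.

Let kap0 : 0 <= kap. Proof. exact: ler0n. Qed.

(** Passing through [x] costs [3 kap + kap + 2 kap = 6 kap] in units of [ell k], that is [3 kap] in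
    units of [ell k.+1]. The factor 3 is the least one reproducing itself. *)
Lemma close_tch k m m' x y : tch k.+1 m x -> tch k m' x ->
  close (3 * kap) k m' y -> close (3 * kap) k.+1 m y.
Proof.
move=> /tch_close tm /tch_close tm' cy i.
have h1 := tm i; have h2 := tm' i; have h3 := cy i.
rewrite ellS in h1 *.
rewrite (_ : y ord0 i - cen k.+1 m i = (y ord0 i - cen k m' i) -
  (x ord0 i - cen k m' i) + (x ord0 i - cen k.+1 m i)); last by ring.
apply: (le_trans (ler_normD _ _)).
have h4 := ler_normB (y ord0 i - cen k m' i) (x ord0 i - cen k m' i).
lra.
Qed.

Lemma ref_neq0 m m' : ref m m' != 0 ->
  forall i, (2 * m i <= m' i <= 2 * m i + N0.+1)%N.
Proof.
move=> r0 i; apply: contraNT r0 => /negP ri.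
rewrite /ref (bigD1 i)//= /ref1; case: ifPn => [mi|]; last by rewrite mul0r.
rewrite bin_small ?mulr0 ?mul0r// ltn_subRL ltnNge; apply/negP => h1; apply: ri.
by rewrite mi.
Qed.

Lemma cen_ref k m m' i : ref m m' != 0 ->
  exists2 j : R, 0 <= j <= N0.+1%:R & cen k m' i = cen k.+1 m i + ell k * j.
Proof.
move=> /ref_neq0/(_ i)/andP[h1 h2]; exists (m' i - 2 * m i)%:R.
  by rewrite ler0n ler_nat leq_subLR.
by rewrite /cen ellS natrB// natrM; ring.
Qed.

(** The relative coordinates satisfy [2 s = t + j], where [t <= kap] and [j <= N0 + 1], so [s] stays
    below [kap]. *)
Lemma tch_ref k m m' x : ref m m' != 0 -> tch k m' x -> tch k.+1 m x.
Proof.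
move=> r0 /forallP tm; apply/forallP => i.
have [j /andP[j0 j1] E] := cen_ref k i r0.
have := tm i; have := cent_cen k m' x i; have := cent_cen k.+1 m x i.
rewrite ellS E; move: (cent _ _ _ _) (cent _ _ _ _) => t s.
have e0 := ell0 k; move=> E1 E2 /andP[t0 t1].
have Es : ell k * (2 * s) = ell k * (t + j).
  rewrite (_ : ell k * (2 * s) = 2 * ell k * s); last by ring.
  by rewrite -E1 mulrDr -E2; ring.
have {}Es : 2 * s = t + j by apply: mulfI Es; rewrite gt_eqF.
have k1 : N0.+1%:R <= kap by rewrite ler_nat.
by apply/andP; split; lra.
Qed.

(** Origin of the 7: [3 kap] coarse units are [6 kap] fine ones, and the two corners are at most
    [kap] fine units apart. *)
Lemma close_ref k m m' y : ref m m' != 0 -> close (3 * kap) k.+1 m y ->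
  close (7 * kap) k m' y.
Proof.
move=> r0 cy i; have [j /andP[j0 j1] E] := cen_ref k i r0.
have k1 : N0.+1%:R <= kap by rewrite ler_nat.
have := cy i; rewrite ellS E => h1.
rewrite (_ : y ord0 i - _ = (y ord0 i - cen k.+1 m i) - ell k * j); last by ring.
apply: (le_trans (ler_normB _ _)).
have : `|ell k * j| <= kap * ell k.
  rewrite ger0_norm; last by rewrite mulr_ge0// ltW.
  rewrite mulrC.
  by apply: ler_wpM2r; [exact: ltW|exact: le_trans k1].
lra.
Qed.

Lemma psi_tch k m x : psi k m x != 0 -> tch k m x.
Proof.
apply: contraNT => /forallPn[i ti].
by rewrite /psi (bigD1 i)//= spline_supp ?mul0r.
Qed.

(** Shifts [b >= M] fall outside the index set, but their splines vanish at [v < M]. *)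
Lemma spline_ref1 k (a : nat) (v : R) : v < M%:R ->
  spline N0 k.+1 (v / 2 - a%:R) = \sum_(b < M) ref1 N0 a b * spline N0 k (v - b%:R).
Proof.
move=> vM; rewrite spline_refine.
pose t (b : nat) := ref1 N0 a b * spline N0 k (v - b%:R).
(* A common range containing both sums; the added terms are zero. *)
pose B := (N0.+2 + M + 2 * a)%N.
have tM b : (M <= b)%N -> t b = 0.
  move=> Mb; rewrite /t spline_supp ?mulr0//; apply/negP => /andP[+ _].
  rewrite subr_ge0 leNgt; apply/negP; rewrite negbK (lt_le_trans vM)//.
  by rewrite ler_nat.
have -> : \sum_(b < M) ref1 N0 a b * spline N0 k (v - b%:R) = \sum_(0 <= b < B) t b.
  rewrite (@big_cat_nat _ _ _ M)//=; last by rewrite /B; lia.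
  have -> : \sum_(M <= b < B) t b = 0.
    by rewrite big_nat big1// => b /andP[Mb _]; exact: tM.
  by rewrite addr0 big_mkord.
rewrite (@big_cat_nat _ _ _ (2 * a))//=; last by rewrite /B; lia.
have -> : \sum_(0 <= b < 2 * a) t b = 0.
  by rewrite big_nat big1// => b /andP[_ ba]; rewrite /t /ref1 leqNgt ba mul0r.
rewrite add0r.
rewrite -{1}[(2 * a)%N]add0n big_addn /B addnK.
rewrite (@big_cat_nat _ _ _ N0.+2)//=; last by lia.
have -> : \sum_(N0.+2 <= b < N0.+2 + M) t (b + 2 * a)%N = 0.
  rewrite big_nat big1// => b /andP[bN _].
  by rewrite /t /ref1 leq_addl addnK bin_small// mulr0 mul0r.
rewrite addr0 big_mkord; apply: eq_bigr => j _.
rewrite /t /ref1 leq_addl addnK; congr (_ * spline _ _ _).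
by rewrite natrD natrM; field.
Qed.

Lemma psi_node k m x : (forall i, x ord0 i - o < h * M%:R) -> 
  psi k.+1 m x = \sum_m' ref m m' * psi k m' x.
Proof.
move=> xM; rewrite /psi.
pose v i := (ell k)^-1 * (x ord0 i - o).
have vM i : v i < M%:R.
  have [x0|x0] := ltP (x ord0 i - o) 0.
    apply: (@lt_le_trans _ _ 0) => //.
    by rewrite /v pmulr_rlt0// invr_gt0.
  rewrite /v mulrC ltr_pdivrMr//; apply: (lt_le_trans (xM i)).
  by rewrite mulrC ler_wpM2l// ell_ge.
transitivity (\prod_i \sum_(b < M) ref1 N0 (m i) b * spline N0 k (v i - b%:R)).
  apply: eq_bigr => i _; rewrite -spline_ref1// centE; congr (spline _ _ (_ - _)).
  by rewrite /v ellS invfM; ring.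
rewrite bigA_distr_bigA; apply: eq_bigr => m' _.
rewrite /ref -big_split /=; apply: eq_bigr => i _.
by rewrite centE.
Qed.

Lemma psi_sum k x : (forall i, kap * ell k <= x ord0 i - o <= ell k * M%:R) ->
  \sum_(m : T) psi k m x = 1.
Proof.
move=> xM; rewrite /psi.
pose v i := (ell k)^-1 * (x ord0 i - o).
under eq_bigr do under eq_bigr do rewrite centE -/(v _).
rewrite -(bigA_distr_bigA (fun i (a : 'I_M) => spline N0 k (v i - a%:R))).
rewrite big1// => i _; apply: spline_sum.
have /andP[x1 x2] := xM i; rewrite /v mulrC.
by rewrite ler_pdivlMr// ler_pdivrMr// x1 mulrC.
Qed.

Lemma measurable_psi k m : measurable_fun [set: Rn] (psi k m).
Proof.
apply: (@measurable_tensor R n (fun i s => spline N0 k ((ell k)^-1 * (s - cen k m i)))) => i.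
apply: continuous_measurable_fun; apply: smooth1_continuous.
rewrite (_ : (fun _ => _) = fun s => spline N0 k
  ((ell k)^-1 * s + (- ((ell k)^-1 * cen k m i)))).
  by apply: smooth1_affine; exact: smooth1_spline.
by apply/funext => s; congr spline; ring.
Qed.

Lemma psi_bound : exists2 A : R, 0 <= A & forall k m x, `|psi k m x| <= A.
Proof.
have [A A0 HA] := @spline_bound R N0 0; exists (A ^+ n); first exact: exprn_ge0.
move=> k m x; rewrite /psi normr_prod -[X in _ ^+ X]card_ord -prodr_const.
apply: ler_prod => i _; rewrite normr_ge0 /=.
have := HA k 0%N 0%N (cent (cen k m) (ell k) x i) (leqnn _) (leq0n _).
by rewrite /= mulr1.
Qed.

Lemma bdds_psi f k m : bdds f -> bdds (fun x => f x * psi k m x).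
Proof.
move=> fb; apply: bddsM => //; first exact: measurable_psi.
have [A A0 HA] := psi_bound; move=> B; exists A => x _; exact: HA.
Qed.

End nodes.

(** * The tree of localized pieces *)

Section tree_decomposition.
Context {R : realType} (n N N0 : nat).
Local Notation Rn := 'rV[R]_n.
Context (o h : R) (h_gt0 : 0 < h) (M : nat).
Local Notation T := {ffun 'I_n -> 'I_M}.
Local Notation kap := (N0.+2%:R : R).
Local Notation ell := (ell h).
Local Notation cen := (cen o h).
Local Notation tch := (tch N0 o h).
Local Notation psi := (psi N0 o h).
Local Notation close := (close o h).
Local Notation ref := (@ref R n N0 M).
Implicit Types (m : T) (x y : Rn) (f : Rn -> R).

Let ell0 k : 0 < ell k := ell_gt0 h_gt0 k.

Definition local_part f k m x := f x * psi k m x.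

Definition local_approx f k m : Rn -> R :=
  if k is 0 then local_part f 0 m
  else match_mom N (cen k m) (ell k) (local_part f k m).

Definition same_moments (g g' : Rn -> R) :=
  bdds g /\ forall b : 'I_n -> nat, (forall i, (b i <= N)%N) ->
    rint (fun x => g x * monomial b x) = rint (fun x => g' x * monomial b x).

Lemma bdds_local_part f k m : bdds f -> bdds (local_part f k m).
Proof. exact: bdds_psi. Qed.

Lemma same_moments_approx f k m : bdds f ->
  same_moments (local_approx f k m) (local_part f k m).
Proof.
move=> fb; case: k => [|k] /=; first by split=> //; exact: bdds_local_part.
split; first exact: bdds_match.
by move=> b bN; apply: match_moment => //; exact: bdds_local_part.
Qed.

Lemma local_approx_tch f k m x : local_approx f k m x != 0 -> tch k m x.
Proof.
case: k => [|k] /=.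
  by rewrite /local_part mulf_eq0 negb_or => /andP[_ /psi_tch].
move=> /match_supp H; apply/forallP => i; have /andP[-> h1] := H i.
by apply: (le_trans h1); rewrite ler1n.
Qed.

Context (f : Rn -> R) (fb : bdds f).
Context (fM : forall x, f x != 0 -> forall i, x ord0 i - o < h * M%:R).
Context (C0 : R) (C0_gt0 : 0 < C0) (Mt : Rn -> R) (Mt_ge0 : forall x, 0 <= Mt x).
Context (approx_le : forall k m x y, close (7 * kap) k m y ->
  `|local_approx f k m x| <= C0 * Mt y).

Lemma local_part_node k m x :
  local_part f k.+1 m x = \sum_m' ref m m' * local_part f k m' x.
Proof.
rewrite /local_part; have [f0|f0] := eqVneq (f x) 0.
  by rewrite f0 mul0r big1// => m' _; rewrite mul0r mulr0.
rewrite psi_node// ?mulr_sumr; last exact: fM.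
by apply: eq_bigr => m' _; rewrite mulrCA.
Qed.

Let near_node k m y := close (3 * kap) k m y.

Let stopf := stop_fun ref near_node Mt (local_approx f).

Let kap_ge0 : 0 <= kap. Proof. exact: ler0n. Qed.

Let near_close k m y : near_node k m y -> close (7 * kap) k m y.
Proof. by apply: close_le => //; have := kap_ge0; lra. Qed.

Let kap_le3 : kap <= 3 * kap. Proof. by have := kap_ge0; lra. Qed.

Lemma same_moments_stop t k m : same_moments (stopf t k m) (local_part f k m).
Proof.
apply: (@stop_fun_eq R T Rn ref near_node Mt (local_part f) (local_approx f)).
  by move=> k' m'; exact: same_moments_approx.
move=> {}k {}m g Hg; split.
  by apply: bdds_sum => m' _; apply: bddsZ; case: (Hg m').
move=> b bN.
transitivity (\sum_m' ref m m' * rint (fun x => g m' x * monomial b x)).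
  rewrite -[RHS](eq_bigr _ (fun m' _ => rintZ (ref m m') (bdds_monomial b (proj1 (Hg m'))))).
  rewrite -rint_sum => [|m' _]; last by apply: bddsZ; exact: bdds_monomial (proj1 (Hg m')).
  congr rint; apply/funext => x; rewrite mulr_suml.
  by apply: eq_bigr => m' _; rewrite mulrA.
under eq_bigr => m' _ do rewrite (proj2 (Hg m') b bN).
have lb m' : bdds (fun x => local_part f k m' x * monomial b x).
  by apply: bdds_monomial; exact: bdds_local_part.
rewrite -[LHS](eq_bigr _ (fun m' _ => rintZ (ref m m') (lb m'))).
rewrite -rint_sum => [|m' _]; last exact: bddsZ.
congr rint; apply/funext => x; rewrite local_part_node mulr_suml.
by apply: eq_bigr => m' _; rewrite mulrA.
Qed.

Let cube k m : set Rn :=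
  [set x | forall i, cen k m i <= x ord0 i <= cen k m i + kap * ell k].

Let is_cube_cube k m : is_cube (cube k m).
Proof.
exists (\row_i cen k m i), (kap * ell k); split.
  by rewrite mulr_gt0// ltr0n.
by apply/seteqP; split => x /= H i; have := H i; rewrite !mxE.
Qed.

Let tch_cube k m x : (tch k m x)%:R = \1_(cube k m) x :> R.
Proof.
rewrite indicE; congr (nat_of_bool _)%:R; apply/idP/idP.
  move=> /forallP tm; rewrite inE => i; have := cent_cen o h_gt0 k m x i.
  have /andP[t0 t1] := tm i; have e0 := ell0 k; move=> E.
  have h1 : 0 <= ell k * cent (cen k m) (ell k) x i by rewrite mulr_ge0// ltW.
  have h2 : ell k * cent (cen k m) (ell k) x i <= ell k * kap.
    by apply: ler_wpM2l => //; exact: ltW.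
  by apply/andP; split; lra.
rewrite inE => H; apply/forallP => i; have /andP[h1 h2] := H i.
have e0 := ell0 k; rewrite /cent; apply/andP; split.
  by rewrite mulr_ge0 ?subr_ge0// invr_ge0 ltW.
by rewrite mulrC ler_pdivrMr// lerBlDl.
Qed.

(** Both functions share the moments of [local_part f k m], so their difference has none, and both
    live on the cube of which [tch] is the indicator. *)
Let Dec_atom t b k m : 0 < b ->
  (forall x, `|stopf t k m x - local_approx f k m x| <= b) ->
  decomposes N (fun x => stopf t k m x - local_approx f k m x)
    (fun x => b * (tch k m x)%:R).
Proof.
move=> b0 sb; have [s1 s2] := same_moments_stop t k m.
have [a1 a2] := same_moments_approx k m fb.
rewrite (_ : (fun x => b * _) = fun x => b * \1_(cube k m) x); last first.
  by apply/funext => x; rewrite tch_cube.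
apply: decomposes_atom => //; first exact: bddsB.
  move=> x sx; have : tch k m x.
    apply: contraNT sx => ntm.
    have -> : stopf t k m x = 0.
      apply/eqP; apply: contraNT ntm => s0.
      exact: (stop_fun_touch (tch_ref h_gt0 (M := M)) (@local_approx_tch f) s0).
    have -> : local_approx f k m x = 0.
      by apply/eqP; apply: contraNT ntm; exact: local_approx_tch.
    by rewrite subrr.
  move=> tm; have := tch_cube k m x; rewrite tm indicE.
  have [|_] := boolP (x \in cube k m); first by rewrite inE.
  by move=> /eqP; rewrite eqr_nat.
move=> e eN; have eN' i : (e i <= N)%N.
  by apply: leq_trans eN; rewrite /mdegree (bigD1 i)//= leq_addr.
under eq_fun do rewrite mulrBl.
by rewrite rintB ?s2 ?a2 ?subrr//; exact: bdds_monomial.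
Qed.

(** At the root level the support of [f] fits into one cell, and its distance [kap] from the origin
    of the grid lets [psi_sum] apply there. *)
Context (K : nat) (H c : R) (Mt_leH : forall y, Mt y <= H) (c_gt0 : 0 < c).
Context (fK : forall x, f x != 0 ->
  forall i, kap * ell K.+1 <= x ord0 i - o <= (kap + 1) * ell K.+1).
Context (kM : (N0.+3 <= M)%N).
Context (Mt_gec : forall x y, f x != 0 ->
  (forall i, `|y ord0 i - x ord0 i| <= 4 * kap * ell K.+1) -> c <= Mt y).
Context (fmom : forall b : multiindex n, (mdegree b <= N)%N ->
  rint (fun x => f x * monomial b x) = 0).
Context (x0 : Rn) (fx0 : f x0 != 0).

Let root m := `[< exists2 x, f x != 0 & tch K.+1 m x >].
Let nu : R := N0.+3%:R ^+ n.
Let nu_gt0 : 0 < nu. Proof. by rewrite exprn_gt0. Qed.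
Let lK := ell K.+1.
Let lK0 : 0 < lK. Proof. exact: ell0. Qed.
Let kap2 : 2 <= kap. Proof. by rewrite ler_nat. Qed.

(** A near point is within [3 kap] of the corner and the touched point of the support within [kap],
    hence the [4 kap] of [Mt_gec]; [c / 2] turns its bound into a strict one. *)
Let root_stopped m : root m -> stopped near_node Mt (c / 2) K.+1 m.
Proof.
move=> /asboolP[x fx tm]; apply/asboolP => y ny.
have : c <= Mt y; last by have := c_gt0; lra.
apply: (Mt_gec fx) => i; have := ny i; have := tch_close h_gt0 tm i.
rewrite (_ : y ord0 i - x ord0 i = (y ord0 i - cen K.+1 m i) - (x ord0 i - cen K.+1 m i)); last by ring.
move=> h1 h2; apply: (le_trans (ler_normB _ _)); lra.
Qed.

Let top x := \sum_(m | root m) local_approx f K.+1 m x.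

(** A root touching the support has its corner at most [kap + 1] cells from [o], and the
    moment-matching step function occupies one further cell. *)
Let big_cube : set Rn := [set x | forall i, o <= x ord0 i <= o + (kap + 2) * lK].

Let top_eq x : f x = \sum_(m | root m) (local_part f K.+1 m x - local_approx f K.+1 m x)
  + top x.
Proof.
rewrite sumrB subrK.
have -> : \sum_(m | root m) local_part f K.+1 m x = \sum_m local_part f K.+1 m x.
  rewrite [RHS](bigID root)/= [X in _ = _ + X]big1 ?addr0// => m /asboolPn nr.
  apply/eqP; apply: contra_notT nr; rewrite /local_part mulf_eq0 negb_or.
  by move=> /andP[fx /psi_tch tm]; exists x.
rewrite -mulr_sumr; have [->|fx] := eqVneq (f x) 0; first by rewrite mul0r.
rewrite psi_sum ?mulr1// => i; have /andP[-> h1] := fK fx i; apply: (le_trans h1).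
rewrite mulrC; apply: ler_wpM2l; first exact: ltW.
by rewrite natr1 ler_nat.
Qed.

Let top_supp x : top x != 0 -> big_cube x.
Proof.
move=> tx; have [m rm gm] : exists2 m, root m & local_approx f K.+1 m x != 0.
  have /existsP[m /andP[rm gm]] : [exists m, root m && (local_approx f K.+1 m x != 0)].
    apply: contraNT tx => /existsPn nx; rewrite /top big1// => m rm.
    by apply/eqP; have := nx m; rewrite rm negbK.
  by exists m.
move=> i; have /match_supp/(_ i)/andP[g0 g1] := gm.
have E := cent_cen o h_gt0 K.+1 m x i.
have /asboolP[y fy /forallP/(_ i)/andP[t0 _]] := rm.
have Ey := cent_cen o h_gt0 K.+1 m y i.
have /andP[_ y1] := fK fy i.
have p1 : 0 <= lK * cent (cen K.+1 m) (ell K.+1) x i by rewrite mulr_ge0// ltW.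
have p2 : lK * cent (cen K.+1 m) (ell K.+1) x i <= lK * 1 by apply: ler_wpM2l => //; exact: ltW.
have p3 : 0 <= lK * cent (cen K.+1 m) (ell K.+1) y i by rewrite mulr_ge0// ltW.
have p4 : 0 <= lK * (m i)%:R by rewrite mulr_ge0// ltW.
have Ec : cen K.+1 m i = o + lK * (m i)%:R by [].
rewrite /lK in p1 p2 p3 p4 Ec *.
by apply/andP; split; lra.
Qed.

Let top_le x y : big_cube y -> `|top x| <= nu * C0 * Mt y.
Proof.
move=> Qy; apply: (le_trans (ler_norm_sum _ _ _)).
apply: (@le_trans _ _ (\sum_(m | tch K.+1 m x) C0 * Mt y)); last first.
  have := ler_wpM2r (mulr_ge0 (ltW C0_gt0) (Mt_ge0 y)) (sum_tch N0 o h_gt0 M K.+1 x).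
  rewrite mulr_suml (eq_bigr (fun=> C0 * Mt y)) => [|m _]; last by rewrite mul1r.
  by rewrite -/nu mulrA => H1; exact: H1.
rewrite (bigID (fun m => tch K.+1 m x))/= [X in _ + X]big1 ?addr0; last first.
  move=> m /andP[_ nt]; apply/eqP; rewrite normr_eq0; apply: contraNT nt.
  exact: (@local_approx_tch f K.+1 m x).
apply: (@le_trans _ _ (\sum_(m | root m && tch K.+1 m x) C0 * Mt y)); last first.
  rewrite [leRHS](bigID root)/= (eq_bigl (fun m => tch K.+1 m x && root m)).
    by rewrite lerDl sumr_ge0// => m _; rewrite mulr_ge0// ltW.
  by move=> m; rewrite andbC.
apply: ler_sum => m /andP[/asboolP[z fz /forallP tz] _]; apply: (@approx_le K.+1 m x y) => i.
have /andP[t0 _] := tz i; have /andP[_ z1] := fK fz i; have /andP[y0 y1] := Qy i.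
have Ez := cent_cen o h_gt0 K.+1 m z i.
have p3 : 0 <= lK * cent (cen K.+1 m) (ell K.+1) z i by rewrite mulr_ge0// ltW.
have p4 : 0 <= lK * (m i)%:R by rewrite mulr_ge0// ltW.
have Ec : cen K.+1 m i = o + lK * (m i)%:R by [].
have p5 : 2 * lK <= kap * lK by apply: ler_wpM2r => //; exact: ltW.
have l0 := lK0.
rewrite /lK in p3 p4 p5 l0 Ec y1 *.
by rewrite ler_norml; apply/andP; split; lra.
Qed.

Let Mt_big y : big_cube y -> c <= Mt y.
Proof.
move=> Qy; apply: (Mt_gec fx0) => i.
have /andP[x1 x2] := fK fx0 i; have /andP[y1 y2] := Qy i.
have p5 : 2 * lK <= kap * lK by apply: ler_wpM2r => //; exact: ltW.
have l0 := lK0.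
rewrite /lK in p5 l0 y2 *.
by rewrite ler_norml; apply/andP; split; lra.
Qed.

Let near_node_ex k m : exists y, near_node k m y.
Proof.
exists (\row_i cen k m i) => i; rewrite mxE subrr normr0.
by rewrite mulr_ge0 ?(ltW (ell0 k))// mulr_ge0.
Qed.

Lemma decomposes_tree : exists2 S : Rn -> R, decomposes N f S &
  forall x, S x <= (12 * (nu * ((2 * nu + 1) * C0 + 1)) + nu * C0) * Mt x.
Proof.
have c20 : 0 < c / 2 by rewrite divr_gt0.
have [S DS Sle] := Dec_tree (F := local_part f) (G := local_approx f) (@ref_ge0 R n N0 M) (@ref_sum R n N0 M)
  (ltW nu_gt0) (sum_tch N0 o h_gt0 M)
  (fun k m x tm => close_le h_gt0 kap_le3 (tch_close h_gt0 tm))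
  (fun k m m' x y => @close_tch R n N0 o h h_gt0 M k m m' x y)
  (tch_ref h_gt0 (M := M)) Mt_ge0 (ltW C0_gt0)
  local_part_node (fun=> erefl) (@local_approx_tch f)
  (fun k p m x y r0 ny => approx_le x (close_ref h_gt0 r0 ny))
  (fun k m x y ny => approx_le x (near_close ny))
  (decomposes0 n N) (@decomposesD R n N) (@decomposesZ R n N)
  Dec_atom c20 Mt_leH near_node_ex root_stopped.
(* [top] is bounded through every [Mt y] on the cube, and its coefficient must lie below a multiple
   of each [Mt x]; the infimum serves both, and [c] keeps it positive. *)
pose mu := inf (Mt @` big_cube).
have Q0 : big_cube (\row_(i < n) o).
  by move=> i; rewrite mxE lexx lerDl mulr_ge0 ?ltW//; lra.
have has : has_inf (Mt @` big_cube).
  split; first by exists (Mt (\row_(i < n) o)), (\row_(i < n) o).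
  by exists 0 => _ [y _ <-].
have mu_c : c <= mu.
  apply: lb_le_inf; first by case: has.
  by move=> _ [y Qy <-]; exact: Mt_big.
have mu_le y : big_cube y -> mu <= Mt y.
  by move=> Qy; apply: ge_inf; [case: has|exists y].
have nuC : 0 < nu * C0 by rewrite mulr_gt0.
exists (fun x => S x + nu * C0 * mu * \1_big_cube x).
  rewrite (_ : f = fun x =>
      \sum_(m | root m) (local_part f K.+1 m x - local_approx f K.+1 m x) + top x); last first.
    by apply/funext => x; exact: top_eq.
  apply: decomposesD => //; apply: decomposes_atom.
  - by rewrite mulr_gt0// (lt_le_trans c_gt0).
  - by apply: bdds_sum => m _; case: (same_moments_approx K.+1 m fb).
  - exists (\row_(i < n) o), ((kap + 2) * lK); split.
      by rewrite mulr_gt0//; lra.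
    by apply/seteqP; split => x /= Hx i; have := Hx i; rewrite !mxE.
  - exact: top_supp.
  - move=> x; rewrite mulrC -ler_pdivrMr//; apply: lb_le_inf; first by case: has.
    move=> _ [y Qy <-]; rewrite ler_pdivrMr// mulrC; exact: top_le.
  - move=> e eN.
    have eN' i : (e i <= N)%N.
      by apply: leq_trans eN; rewrite /mdegree (bigD1 i)//= leq_addr.
    have ab m : bdds (fun x => local_approx f K.+1 m x * monomial e x).
      by apply: bdds_monomial; case: (same_moments_approx K.+1 m fb).
    have lb m : bdds (fun x => local_part f K.+1 m x * monomial e x).
      by apply: bdds_monomial; exact: bdds_local_part.
    (* The moments of [top] are those of the sum of the root pieces, which is [f]. *)
    rewrite (_ : rint _ = \sum_(m | root m) rint (fun x => local_part f K.+1 m x * monomial e x)).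
      rewrite -rint_sum//; transitivity (rint (fun x => f x * monomial e x)); last exact: fmom.
      congr rint; apply/funext => x; rewrite -mulr_suml; congr (_ * _).
      by rewrite [RHS]top_eq sumrB subrK.
    under [RHS]eq_bigr => m _ do rewrite -(proj2 (same_moments_approx K.+1 m fb) e eN').
    rewrite -rint_sum//; congr rint; apply/funext => x.
    by rewrite /top mulr_suml.
move=> x; rewrite mulrDl; apply: lerD; first exact: Sle.
rewrite -mulrA; apply: ler_wpM2l; first exact: ltW.
rewrite indicE; have [|_] := boolP (x \in big_cube); last by rewrite mulr0.
by rewrite inE mulr1; exact: mu_le.
Qed.

End tree_decomposition.

Section approx_bounds.
Context {R : realType} (n N N0 : nat).
Local Notation Rn := 'rV[R]_n.
Local Notation kap := (N0.+2%:R : R).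
Context (A1 : R) (A1_ge0 : 0 <= A1).
Context (spline_le : forall k a i (v : R), (a <= N)%N -> (i <= N0)%N ->
  `|derive1n i (fun v => spline N0 k v * v ^+ a) v| <= A1).
Context (D : R) (D_ge0 : 0 <= D) (dual_le : forall (a : 'I_N.+1) (v : R), `|dual_fun a v| <= D).
Context (o h : R) (h_gt0 : 0 < h) (M : nat).
Local Notation T := {ffun 'I_n -> 'I_M}.
Local Notation card := (#|{ffun 'I_n -> 'I_N.+1}|%:R : R).
Implicit Types (m : T) (x y : Rn) (f : Rn -> R).

Lemma spline_pow_le k a (v : R) : (a <= N)%N -> `|spline N0 k v * v ^+ a| <= A1.
Proof. by move=> aN; exact: (spline_le k v aN (leq0n _)). Qed.

Lemma psi_le k m x : `|psi N0 o h k m x| <= A1 ^+ n.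
Proof.
rewrite /psi normr_prod -[X in _ ^+ X]card_ord -prodr_const.
apply: ler_prod => i _; rewrite normr_ge0 /=.
by have := spline_pow_le k (cent (cen o h k m) (ell h k) x i) (leq0n _); rewrite expr0 mulr1.
Qed.

Lemma psi_centmonE k m (a : {ffun 'I_n -> 'I_N.+1}) x :
  psi N0 o h k m x * centmon (cen o h k m) (ell h k) a x =
  \prod_i (spline N0 k (cent (cen o h k m) (ell h k) x i) *
           cent (cen o h k m) (ell h k) x i ^+ a i) :> R.
Proof. by rewrite /psi /centmon -big_split. Qed.

Lemma match_mom_le k m x f (B : R) :
  (forall a : {ffun 'I_n -> 'I_N.+1}, (ell h k) ^- n * `|rint (fun z => local_part N0 o h f k m z *
     centmon (N := N) (cen o h k m) (ell h k) a z)| <= B) ->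
  `|match_mom N (cen o h k m) (ell h k) (local_part N0 o h f k m) x| <= card * (B * D ^+ n).
Proof.
move=> HB; apply: (le_trans (ler_norm_sum _ _ _)).
rewrite -sum1_card natr_sum mulr_suml; apply: ler_sum => a _.
rewrite mul1r normrM; apply: ler_pM => //.
  rewrite normrM ger0_norm; first exact: HB.
  by rewrite invr_ge0 exprn_ge0// ltW// ell_gt0.
rewrite normr_prod -[X in _ ^+ X]card_ord -prodr_const.
by apply: ler_prod => i _; rewrite normr_ge0 /=.
Qed.

(** Each coefficient is a test of [f] against splines times powers, so [dominated] applies at scale
    [ell k] with a constant independent of [k]. *)
Lemma match_mom_dominated C f Mf k m x y mu : dominated N0 C f Mf ->
  close o h (7 * kap) k m y -> (Mf y <= mu%:E)%E ->
  `|match_mom N (cen o h k m) (ell h k) (local_part N0 o h f k m) x| <=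
  card * (C (7 * kap) A1 * mu * D ^+ n).
Proof.
move=> dom cy My; apply: match_mom_le => a.
have e0 := ell_gt0 h_gt0 k.
rewrite mulrC ler_pdivrMr ?exprn_gt0//.
rewrite (_ : rint _ = rint (fun z => f z * \prod_i (fun i v => spline N0 k v * v ^+ a i) i
    (cent (cen o h k m) (ell h k) z i))); last first.
  by congr rint; apply/funext => z; rewrite /local_part -mulrA psi_centmonE.
have k0 : 0 <= 7 * kap by rewrite mulr_ge0.
have -> : C (7 * kap) A1 * mu * ell h k ^+ n = C (7 * kap) A1 * ell h k ^+ n * mu by rewrite mulrAC.
apply: (dom _ _ k0 A1_ge0 (fun i v => spline N0 k v * v ^+ a i)) My => //.
- move=> i; apply: smooth1M; first exact: smooth1_spline.
  by have := @smooth1_horner R 'X^(a i); under eq_fun do rewrite hornerXn.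
- move=> i v kv; rewrite spline_supp ?mul0r//; apply/negP => /andP[v0 v1].
  move: kv; rewrite ger0_norm// ltNge => /negP; apply.
  by have := ler0n R N0.+2; lra.
- by move=> i j v jN; apply: spline_le => //; rewrite -ltnS.
Qed.

(** A crude bound, depending on [f] and the mesh, used only to choose the truncation height of the
    maximal function. *)
Lemma match_mom_bounded f k m x : bdds f ->
  `|match_mom N (cen o h k m) (ell h k) (local_part N0 o h f k m) x| <=
  card * (h ^- n * (A1 ^+ n * rint (fun z => `|f z|)) * D ^+ n).
Proof.
move=> fb; apply: match_mom_le => a.
have e0 := ell_gt0 h_gt0 k.
have nfb : bdds (fun z => `|f z|).
  have [mf [A [B AB]]] := fb; split; first exact: measurableT_comp.
  by exists A, B => z; rewrite normr_id normr_eq0; exact: AB.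
apply: ler_pM => //.
- by rewrite invr_ge0 exprn_ge0// ltW.
- rewrite lef_pV2 ?posrE ?exprn_gt0//.
  by apply: lerXn2r; rewrite ?nnegrE; [exact: ltW|exact: ltW|exact: ell_ge].
- rewrite -rintZ//; apply: ler_norm_rint.
  + by apply: bdds_centmon; exact: bdds_local_part.
  + exact: bddsZ.
  + move=> z; rewrite /local_part -mulrA psi_centmonE normrM mulrC.
    apply: ler_wpM2r => //; rewrite normr_prod -[X in _ ^+ X]card_ord -prodr_const.
    apply: ler_prod => i _; rewrite normr_ge0 /=.
    by apply: spline_pow_le; rewrite -ltnS.
Qed.

(** At the bottom level the oscillation is at most [c], itself at most [mu], so
    [pointwise_dominated] bounds [f x]. The distance [8 kap] is [7 kap] from [y] to the corner plus
    [kap] to [x]. *)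
Lemma local_part_dominated (B0 : R) (C : R -> R -> R) f (Mf : Rn -> \bar R) (c : R)
    m x y (mu : R) :
  (forall A B, 0 < C A B) ->
  (forall (A w : R) (x y : Rn), 2 <= A ->
    (forall i, `|y ord0 i - x ord0 i| <= A * h) -> (Mf y <= mu%:E)%E ->
    (forall z : Rn, (forall i, `|z ord0 i - x ord0 i| <= 2 * h) -> `|f z - f x| <= w) ->
    `|f x| <= w + C A B0 * mu) ->
  close o h (7 * kap) 0 m y -> (Mf y <= mu%:E)%E ->
  (f x != 0 -> (forall i, `|y ord0 i - x ord0 i| <= 8 * kap * h) -> c <= mu) ->
  0 <= mu ->
  (forall z : Rn, (forall i, `|z ord0 i - x ord0 i| <= 2 * h) -> `|f z - f x| <= c) ->
  `|local_part N0 o h f 0 m x| <= A1 ^+ n * (1 + C (8 * kap) B0) * mu.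
Proof.
move=> C0 pt cy My cmu mu0 osc; rewrite /local_part.
have CB := C0 (8 * kap) B0.
have [->|p0] := eqVneq (f x * psi N0 o h 0 m x) 0.
  by rewrite normr0 !mulr_ge0 ?exprn_ge0// addr_ge0// ltW.
move: p0; rewrite mulf_eq0 negb_or => /andP[fx /(psi_tch (M := M)) tx].
have kap2 : 2 <= kap by rewrite ler_nat.
have xy i : `|y ord0 i - x ord0 i| <= 8 * kap * h.
  have := cy i; have := tch_close h_gt0 tx i.
  rewrite /ell expr0 mulr1 => h1 h2.
  rewrite (_ : y ord0 i - x ord0 i = (y ord0 i - cen o h 0 m i) - (x ord0 i - cen o h 0 m i)); last by ring.
  by apply: (le_trans (ler_normB _ _)); lra.
rewrite normrM mulrC -mulrA; apply: ler_pM => //; first exact: psi_le.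
rewrite mulrDl mul1r; apply: (@le_trans _ _ (c + C (8 * kap) B0 * mu)).
  by apply: (pt (8 * kap) c x y) => //; lra.
by rewrite lerD2r; exact: cmu.
Qed.

End approx_bounds.

(** * Choice of scales and truncation *)

Section decomposition_dominated.
Context {R : realType} (n N N0 : nat).
Local Notation Rn := 'rV[R]_n.
Local Notation kap := (N0.+2%:R : R).
Context (C : R -> R -> R) (C_gt0 : forall A B, 0 < C A B).

Lemma decomposes_dominated : exists2 Kc : R, 0 <= Kc &
  forall (f : Rn -> R) (Mf : Rn -> \bar R) (Ks : set Rn),
    continuous f -> compact Ks -> (forall x, f x != 0 -> Ks x) ->
    (forall b : multiindex n, (mdegree b <= N)%N ->
      rint (fun x => f x * monomial b x) = 0) ->
    dominated N0 C f Mf -> (forall y, 0 <= Mf y)%E ->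
    exists2 S : Rn -> R, decomposes N f S &
      forall x, ((S x)%:E <= Kc%:E * Mf x)%E.
Proof.
have [A1 A10 HA1] := @spline_bound R N0 N.
have [D D0 HD] := @dual_fun_bound R N.
have [B0 B00 HB0] := @pointwise_dominated R n N0.
have kap2 : 2 <= kap by rewrite ler_nat.
(* [Cg] serves the moment-matched pieces, [Ce] the bottom ones; the 1 in [C0] gives positivity. *)
pose Cg : R := #|{ffun 'I_n -> 'I_N.+1}|%:R * (C (7 * kap) A1 * D ^+ n).
pose Ce : R := A1 ^+ n * (1 + C (8 * kap) B0).
have Cg0 : 0 <= Cg by rewrite !mulr_ge0 ?exprn_ge0// ltW.
have Ce0 : 0 <= Ce by rewrite mulr_ge0 ?exprn_ge0// addr_ge0// ltW.
pose C0 : R := Cg + Ce + 1.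
have C00 : 0 < C0 by rewrite ltr_wpDl// addr_ge0.
pose nu : R := N0.+3%:R ^+ n.
pose Kc : R := 12 * (nu * ((2 * nu + 1) * C0 + 1)) + nu * C0.
have nu0 : 0 <= nu by rewrite exprn_ge0.
have Kc0 : 0 <= Kc.
  have C0' := ltW C00.
  have a1 : 0 <= (2 * nu + 1) * C0 + 1.
    by apply: addr_ge0 => //; apply: mulr_ge0 => //; apply: addr_ge0 => //; exact: mulr_ge0.
  by apply: addr_ge0; apply: mulr_ge0 => //; exact: mulr_ge0.
exists Kc => // f Mf Ks cf cKs fKs fmom dom Mf0.
have [f0|/existsNP[x1 /eqP fx1]] := pselect (forall x, f x = 0).
  exists (fun=> 0); last by move=> x; rewrite mule_ge0 ?lee_fin.
  by rewrite (_ : f = fun=> 0); [exact: decomposes0|exact/funext].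
have fb := bdds_compact_support cf cKs fKs.
have [rho0 [F0 [rho00 F00 fF0 frho]]] := bdds_box fb.
(* The support lies in the cube of half-side [rho], one root cell wide; [o] puts it exactly [kap]
   cells from the origin of the grid. *)
pose rho := rho0 + 1; pose lK := 2 * rho; pose o := - rho - kap * lK.
have rho_gt0 : 0 < rho by rewrite /rho; lra.
have lK0 : 0 < lK by rewrite /lK; lra.
have fbox (x : Rn) : f x != 0 -> forall i, - rho <= x ord0 i <= rho.
  by move=> /frho fx i; have := fx i; rewrite in_itv /= /rho; lra.
(* The radius covers all points within [4 kap] root cells of the support: [2 * rho] is the distance
   from [x1] to any other point of it. *)
have [c c0 Hc] := dominated_gt0 (2 * rho + 4 * kap * lK) C_gt0 cf cKs fKs dom Mf0 fx1.
have [r r0 Hr] := compact_support_uniform cf cKs fKs c0.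
have [K HK] : exists K : nat, lK / r < 2 ^+ K.
  exists (Num.bound (lK / r)).
  have h1 : 0 <= lK / r by rewrite divr_ge0// ltW.
  apply: (lt_le_trans (archi_boundP h1)).
  by rewrite -natrX ler_nat ltnW// ltn_expl.
pose h := lK / 2 ^+ K.+1.
have h0 : 0 < h by rewrite divr_gt0// exprn_gt0.
have hK : ell h K.+1 = lK by rewrite /ell /h divfK// expf_neq0// pnatr_eq0.
have h2r : 2 * h < r.
  rewrite /h exprS invfM mulrCA mulVKf ?pnatr_eq0// ltr_pdivrMr ?exprn_gt0//.
  by rewrite mulrC -ltr_pdivrMr.
(* Even the finest grid has width [kap + 2] root cells, enough to contain the support. *)
pose M := (2 ^ K.+1 * N0.+4)%N.
have hM : h * M%:R = lK * N0.+4%:R.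
  by rewrite /M natrM natrX mulrA divfK// expf_neq0// pnatr_eq0.
have osc (x z : Rn) : (forall i, `|z ord0 i - x ord0 i| <= 2 * h) -> `|f z - f x| <= c.
  by move=> zx; apply: Hr => i; exact: le_lt_trans (zx i) h2r.
have nfb0 : 0 <= rint (fun z => `|f z|) by exact: Rintegral_ge0.
pose H1 : R := #|{ffun 'I_n -> 'I_N.+1}|%:R *
  (h ^- n * (A1 ^+ n * rint (fun z => `|f z|)) * D ^+ n).
pose H2 : R := A1 ^+ n * F0.
have H10 : 0 <= H1.
  by rewrite !mulr_ge0 ?exprn_ge0// invr_ge0 exprn_ge0// ltW.
have H20 : 0 <= H2 by rewrite mulr_ge0 ?exprn_ge0.
pose H : R := (H1 + H2) / C0 + c.
have H0 : 0 <= H by rewrite addr_ge0 ?(ltW c0)// divr_ge0 ?(ltW C00)// addr_ge0.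
(* [H] bounds all the [local_approx] divided by [C0], so truncating [Mf] at [H]
   makes it finite at no cost. *)
pose Mt (y : Rn) : R := if (Mf y <= H%:E)%E then fine (Mf y) else H.
have MtE y : (Mf y <= H%:E)%E -> Mf y = (Mt y)%:E.
  move=> My; rewrite /Mt My fineK// ge0_fin_numE//; exact: le_lt_trans My (ltry _).
have Mt0 y : 0 <= Mt y by rewrite /Mt; case: ifP => _ //; exact: fine_ge0.
have MtH y : Mt y <= H.
  rewrite /Mt; case: ifPn => // My.
  by rewrite -lee_fin fineK// ge0_fin_numE//; exact: le_lt_trans My (ltry _).
have Mt_le y : ((Mt y)%:E <= Mf y)%E.
  rewrite /Mt; case: ifPn => [My|]; last by rewrite -ltNge => /ltW.
  by rewrite fineK// ge0_fin_numE//; exact: le_lt_trans My (ltry _).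
have Mt_ge (t : R) y : (t%:E <= Mf y)%E -> t <= H -> t <= Mt y.
  by move=> tM tH; rewrite /Mt; case: ifPn => // My; rewrite -lee_fin fineK//
    ge0_fin_numE//; exact: le_lt_trans My (ltry _).
have cH : c <= H by rewrite /H lerDr divr_ge0 ?(ltW C00)// addr_ge0.
(* All real majorants [mu] are used because [Mf y] may be infinite. Where [Mt] is truncated,
   [H1 + H2 <= C0 * H] takes over. *)
have bound t y : (forall mu, (Mf y <= mu%:E)%E -> t <= C0 * mu) -> t <= H1 + H2 ->
    t <= C0 * Mt y.
  move=> tmu tH; have [My|My] := boolP (Mf y <= H%:E)%E.
    by apply: tmu; rewrite -MtE.
  rewrite /Mt (negbTE My) (le_trans tH)// mulrC -ler_pdivrMr//.
  by rewrite /H lerDl ltW.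
have near_c (x y : Rn) : f x != 0 ->
    (forall i, `|y ord0 i - x ord0 i| <= 4 * kap * lK) -> (c%:E <= Mf y)%E.
  move=> fx xy; apply: Hc => i; have := xy i; have := fbox _ fx i; have := fbox _ fx1 i.
  rewrite !ler_norml => /andP[? ?] /andP[? ?] /andP[? ?].
  by apply/andP; split; lra.
(* This converts the radius [8 kap * h] of the bottom level into the [4 kap * lK] of [near_c]. *)
have h_lK : 2 * h <= lK.
  rewrite -[leRHS]mul1r -hK /ell mulrC mulrCA; apply: ler_wpM2l; first exact: ltW.
  by rewrite mul1r exprS ler_peMr// exprn_ege1// ler1n.
have approx_le k (m : {ffun 'I_n -> 'I_M}) (x y : Rn) : close o h (7 * kap) k m y ->
    `|local_approx N N0 o h f k m x| <= C0 * Mt y.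
  move=> cy; apply: bound => [mu My|]; last first.
    case: k m cy => [|k] m cy /=; last first.
      apply: (@le_trans _ _ H1); last by rewrite lerDl.
      exact: (match_mom_bounded HA1 HD o h0 k.+1 m x fb).
    apply: (@le_trans _ _ H2); last by rewrite lerDr.
    rewrite /local_part normrM mulrC; apply: ler_pM => //.
    exact: (psi_le HA1 o h 0 m x).
  have mu0 : 0 <= mu by rewrite -lee_fin (le_trans (Mf0 y)).
  case: k m cy => [|k] m cy /=; last first.
    apply: (@le_trans _ _ (Cg * mu)); last first.
      by apply: ler_wpM2r => //; rewrite /C0; lra.
    apply: (le_trans (match_mom_dominated A10 HA1 HD h0 x dom cy My)).
    by rewrite /Cg le_eqVlt; apply/orP; left; apply/eqP; ring.
  apply: (@le_trans _ _ (Ce * mu)); last first.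
    by apply: ler_wpM2r => //; rewrite /C0; lra.
  apply: (local_part_dominated A10 HA1 h0 (B0 := B0) (Mf := Mf) (c := c) C_gt0 _ cy My _ mu0 _).
  - by move=> A w x' y' A2 xy' My' fw; exact: (HB0 C f Mf C_gt0 fb dom Mf0 A h mu w x' y').
  - move=> fx xy; rewrite -lee_fin; apply: le_trans My; apply: (near_c x) => // i.
    apply: (le_trans (xy i)).
    have : kap * (2 * h) <= kap * lK by apply: ler_wpM2l => //; lra.
    lra.
  - exact: osc.
have kap4 : N0.+4%:R = kap + 2 :> R by rewrite -natrD addn2.
have fM (x : Rn) : f x != 0 -> forall i, x ord0 i - o < h * M%:R.
  move=> fx i; have := fbox _ fx i; rewrite hM kap4 mulrDr /o => /andP[_ h1].
  have : lK * 2 = lK + 2 * rho by rewrite /lK; ring.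
  lra.
have fK (x : Rn) : f x != 0 -> forall i,
    kap * ell h K.+1 <= x ord0 i - o <= (kap + 1) * ell h K.+1.
  move=> fx i; have := fbox _ fx i; rewrite hK /o => /andP[h1 h2].
  have h3 : lK = 2 * rho by [].
  clear -h1 h2 h3; by apply/andP; split; lra.
have kM : (N0.+3 <= M)%N.
  rewrite /M; apply: (@leq_trans N0.+4) => //.
  by rewrite leq_pmull// expn_gt0.
have Mt_gec (x y : Rn) : f x != 0 ->
    (forall i, `|y ord0 i - x ord0 i| <= 4 * kap * ell h K.+1) -> c <= Mt y.
  by rewrite hK => fx xy; apply: Mt_ge => //; exact: near_c xy.
have [S DS Sle] := @decomposes_tree R n N N0 o h h0 M f fb fM
  C0 C00 Mt Mt0 approx_le K H c MtH c0 fK kM Mt_gec fmom x1 fx1.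
exists S => // x; apply: (@le_trans _ _ (Kc%:E * (Mt x)%:E)%E).
  by rewrite -EFinM lee_fin; exact: Sle.
by apply: lee_wpmul2l; rewrite ?lee_fin.
Qed.

End decomposition_dominated.

(** * Passage to the weighted quasi-norm *)

Import HBNNSimple.

Section weighted_integral.
Context d (T : measurableType d) {R : realType}.
Variable mu : {measure set T -> \bar R}.
Local Open Scope ereal_scope.

(* The grand maximal function is not known to be measurable, hence this
   one-sided homogeneity instead of [ge0_integralZl]. *)
Lemma ge0_integralZl_le (r : R) (f : T -> \bar R) : (0 < r)%R ->
  (forall x, 0 <= f x) -> \int[mu]_x (r%:E * f x) <= r%:E * \int[mu]_x f x.
Proof.
move=> r0 f0; rewrite ge0_integralTE; last by move=> x; rewrite mule_ge0// lee_fin ltW.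
apply: ge_ereal_sup => _ [h/= hf] <-.
have -> : sintegral mu h = \int[mu]_x (r%:E * (r^-1 * h x)%:E).
  rewrite (eq_integral (fun x => (h x)%:E)); last first.
    by move=> x _; rewrite -EFinM mulVKf// gt_eqF.
  by rewrite integral_nnsfun// patch_setT.
rewrite ge0_integralZl//; last 3 first.
- by apply/measurable_EFinP; apply: measurable_funM.
- by move=> x _; rewrite lee_fin mulr_ge0// invr_ge0 ltW.
- by rewrite lee_fin ltW.
apply: lee_wpmul2l; first by rewrite lee_fin ltW.
apply: le_integral_any => x.
  by rewrite lee_fin mulr_ge0// invr_ge0 ltW.
have := hf x; case: (f x) (f0 x) => [s| |] //= s0; last by rewrite leey.
by rewrite -EFinM !lee_fin ler_pdivrMl.
Qed.

(** Without measurability, [f] is compared with the function equal to [+oo] on a measurable null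
    set, whose integral is 0. *)
Lemma integral_ae0 (f : T -> \bar R) : (forall x, 0 <= f x) ->
  {ae mu, forall x, f x = 0} -> \int[mu]_x f x = 0.
Proof.
move=> f0 [Z [mZ Z0 fZ]]; apply/eqP; rewrite eq_le integral_ge0// andbT.
apply: (@le_trans _ _ (\int[mu]_x (cst +oo \_ Z) x)); last first.
  by rewrite -integral_mkcond integral_cst// Z0 mule0.
apply: le_integral_any => // x; rewrite patchE; case: ifPn => [_|xZ].
  by rewrite leey.
suff -> : f x = 0 by [].
apply: contrapT => fx; move: xZ; rewrite notin_setE; apply; exact: fZ.
Qed.

Lemma ae_integral_pos (f : T -> \bar R) : {ae mu, forall x, 0 <= f x} ->
  \int[mu]_x f x = \int[mu]_x f^\+ x.
Proof.
move=> f0; rewrite integralE [X in _ - X](_ : _ = 0) ?sube0//.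
apply: integral_ae0 => //; apply: filterS f0 => x fx.
by rewrite funenegE max_r// oppe_le0.
Qed.

End weighted_integral.

(** The weight is positive only almost everywhere, so the integrals are first replaced by those of
    positive parts, which compare at every point. *)
Lemma Lp_norm_dominated {R : realType} (n : nat) (w : 'rV[R]_n -> \bar R) (p c : R)
    (g : 'rV[R]_n -> R) (Mf : 'rV[R]_n -> \bar R) :
  is_weight w -> 0 < p -> 0 < c -> (forall x, 0 <= g x) ->
  (forall x, (0 <= Mf x)%E) -> (forall x, ((g x)%:E <= c%:E * Mf x)%E) ->
  (Lp_norm p w (fun x => (g x)%:E) <= c%:E * Lp_norm p w Mf)%E.
Proof.
move=> [_ _ w0] p0 c0 g0 M0 gM; rewrite /Lp_norm.
have w0' (u : 'rV[R]_n -> \bar R) : (forall x, (0 <= u x)%E) ->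
    {ae (lebesgue_rV R n), forall x, (0 <= u x * w x)%E}.
  by move=> u0; apply: filterS w0 => x /andP[wx _]; rewrite mule_ge0// ltW.
set u := (fun x => `|(g x)%:E| `^ p * w x)%E.
set v := (fun x => `|Mf x| `^ p * w x)%E.
have iu : (\int[lebesgue_rV R n]_x u x = \int[lebesgue_rV R n]_x u^\+ x)%E.
  by apply: ae_integral_pos; apply: w0' => x; exact: poweR_ge0.
have iv : (\int[lebesgue_rV R n]_x v x = \int[lebesgue_rV R n]_x v^\+ x)%E.
  by apply: ae_integral_pos; apply: w0' => x; exact: poweR_ge0.
have cp0 : 0 < c `^ p by exact: powR_gt0.
have uv x : (u^\+ x <= (c `^ p)%:E * v^\+ x)%E.
  rewrite !funeposE /u /v.
  have gp : (`|(g x)%:E| `^ p <= (c `^ p)%:E * `|Mf x| `^ p)%E.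
    rewrite gee0_abs ?lee_fin// gee0_abs// -poweR_EFin -poweRM// ?lee_fin ?(ltW c0)//.
    apply: gt0_ler_poweR => //; first exact: ltW.
    - by rewrite in_itv /= lee_fin g0 leey.
    - by rewrite in_itv /= leey andbT mule_ge0// lee_fin ltW.
  have [w1|w1] := leP 0%E (w x).
    rewrite max_l; last by rewrite mule_ge0// poweR_ge0.
    rewrite max_l; last by rewrite mule_ge0// poweR_ge0.
    by rewrite muleA; apply: lee_wpmul2r.
  rewrite max_r; last by rewrite mule_ge0_le0// ?poweR_ge0// ltW.
  rewrite max_r; last by rewrite mule_ge0_le0// ?poweR_ge0// ltW.
  by rewrite mule0.
have u0 : (0 <= \int[lebesgue_rV R n]_x u x)%E by rewrite iu integral_ge0.
have v0 : (0 <= \int[lebesgue_rV R n]_x v x)%E by rewrite iv integral_ge0.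
have uv_int : (\int[lebesgue_rV R n]_x u x <= (c `^ p)%:E * \int[lebesgue_rV R n]_x v x)%E.
  rewrite iu iv; apply: le_trans (ge0_integralZl_le _ cp0 _) => //.
  exact: le_integral_any.
apply: (@le_trans _ _ (((c `^ p)%:E * \int[lebesgue_rV R n]_x v x) `^ p^-1)%E).
  apply: gt0_ler_poweR => //; first by rewrite invr_ge0 ltW.
  - by rewrite in_itv /= u0 leey.
  - by rewrite in_itv /= leey andbT mule_ge0// lee_fin ltW.
rewrite poweRM//; last by rewrite lee_fin ltW.
by rewrite poweR_EFin -powRrM mulfV ?gt_eqF// powRr1// ltW.
Qed.

(** * Complex atoms and the conclusion *)

Section real_to_complex.
Context {R : realType} (n N : nat).
Local Notation Rn := 'rV[R]_n.

Lemma closed_cube (Q : set Rn) : is_cube Q -> closed Q.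
Proof.
move=> [c [l [l0 ->]]].
rewrite [X in closed X](_ : _ = \bigcap_(i in [set: 'I_n])
    ((fun x : Rn => x ord0 i) @^-1` [set y | c ord0 i <= y <= c ord0 i + l])).
  apply: closed_bigI => i _; apply: closed_comp.
    by move=> x _; exact: coord_continuous.
  have := @itv_closed _ R (c ord0 i) (c ord0 i + l).
  by congr closed; apply/seteqP; split => y /=; rewrite in_itv.
by apply/seteqP; split => x /= H i; [move=> _; exact: H|exact: H].
Qed.

Lemma Lnorm_infty_le1 (a : Rn -> R[i]) : (forall x, modulus (a x) <= 1) ->
  (Lnorm (lebesgue_rV R n) +oo (fun x => (modulus (a x))%:E) <= 1)%E.
Proof.
move=> a1; rewrite unlock; case: ifP => _; last by rewrite lee_fin ler01.
apply: ereal_inf_lbound => /=; apply: nearW => x /=.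
rewrite lee_fin ger0_norm//.
by rewrite /modulus; case: (a x) => u v; exact: sqrtr_ge0.
Qed.

Lemma modulusIm (r : R) : modulus (0 +i* r) = `|r|.
Proof. by rewrite /modulus /= expr0n /= add0r sqrtr_sqr. Qed.

Lemma lebesgue_measurable_EFin (g : Rn -> R) : measurable_fun [set: Rn] g ->
  lebesgue_measurable (fun x => (g x)%:E).
Proof.
move=> mg; exists (fun x => (g x)%:E); first exact/measurable_EFinP.
exact: aeW.
Qed.

Lemma atom_on_Re (Q : set Rn) (a : Rn -> R) : is_cube Q -> real_atom N Q a ->
  atom_on N Q (fun x => a x +i* 0).
Proof.
move=> cQ [ma aQ a1 a0]; split.
- by split; apply: lebesgue_measurable_EFin.
- rewrite /supp [X in _ `<=` X](closure_id Q).1; last exact: closed_cube.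
  apply: closure_subset => x /= ax; apply: aQ; apply: contra ax => /eqP ->.
  exact/eqP.
- by apply: Lnorm_infty_le1 => x; rewrite [leLHS]modulus_real.
- move=> b bN; rewrite /integralC /=; congr (_ +i* _).
    rewrite -[RHS](a0 b bN); apply: eq_Rintegral => x _ /=.
    by rewrite mulr0 subr0 mulrC.
  rewrite -[RHS](@rint0 R n); apply: eq_Rintegral => x _ /=.
  by rewrite mulr0 mul0r addr0.
Qed.

Lemma atom_on_Im (Q : set Rn) (a : Rn -> R) : is_cube Q -> real_atom N Q a ->
  atom_on N Q (fun x => 0 +i* a x).
Proof.
move=> cQ [ma aQ a1 a0]; split.
- by split; apply: lebesgue_measurable_EFin.
- rewrite /supp [X in _ `<=` X](closure_id Q).1; last exact: closed_cube.
  apply: closure_subset => x /= ax; apply: aQ; apply: contra ax => /eqP ->.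
  exact/eqP.
- by apply: Lnorm_infty_le1 => x; rewrite modulusIm.
- move=> b bN; rewrite /integralC /=; congr (_ +i* _).
    rewrite -[RHS](@rint0 R n); apply: eq_Rintegral => x _ /=.
    by rewrite mulr0 mul0r subr0.
  rewrite -[RHS](a0 b bN); apply: eq_Rintegral => x _ /=.
  by rewrite mul0r addr0 mulrC.
Qed.

End real_to_complex.

Theorem theorem2p6 (R : realType) (n : nat) (hn : (0 < n)%N)
    (w : 'rV[R]_n -> \bar R) (hw : is_weight w) (hA : muckenhoupt_infty w)
    (p : R) (hp : 0 < p) :
  exists N00 : nat, forall N0 : nat, (N00 <= N0)%N ->
  forall N : nat, s_index w p <= N%:Z ->
  exists C : R, forall f : 'rV[R]_n -> R[i],
    O_moments N f -> hardy N0 p w (distribution_of f) ->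
    exists (m : nat) (lambda : 'I_m -> R) (a : 'I_m -> 'rV[R]_n -> R[i])
           (Q : 'I_m -> set 'rV[R]_n),
      [/\ forall k, 0 <= lambda k,
          forall k, is_cube (Q k) /\ atom_on N (Q k) (a k),
          forall x, f x = \sum_(k < m) (lambda k)%:C * a k x &
          (Lp_norm p w (fun x => (\sum_(k < m) lambda k * \1_(Q k) x)%:E)
            <= C%:E * hardy_norm N0 p w (distribution_of f))%E].
Proof.
(* Any order [N0] is admissible because the degree of the splines is adapted to it. *)
exists 0%N => N0 _ N _.
have [Cd Cd0 HCd] := @grand_maximal_dominated R n N0.
have [Kc Kc0 HKc] := @decomposes_dominated R n N N0 Cd Cd0.
(* One [Kc] for each of the real and imaginary parts; the 1 provides the positivity required by
   [Lp_norm_dominated]. *)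
exists (2 * Kc + 1) => f [sf cf mf] _.
have [cR _] := (sf 0%N).1; have [cI _] := (sf 0%N).2.
have fsupp x : f x != 0 -> supp f x by move=> fx; exact: subset_closure.
have Rsupp x : complex.Re (f x) != 0 -> supp f x.
  by move=> fx; apply: fsupp; apply: contra fx => /eqP ->.
have Isupp x : complex.Im (f x) != 0 -> supp f x.
  by move=> fx; apply: fsupp; apply: contra fx => /eqP ->.
have Rb := bdds_compact_support cR cf Rsupp.
have Ib := bdds_compact_support cI cf Isupp.
have [domR domI] := HCd f Rb Ib.
set Mf := grand_maximal N0 (distribution_of f) in domR domI.
have M0 y : (0 <= Mf y)%E by exact: grand_maximal_ge0.
have Rm (b : multiindex n) : (mdegree b <= N)%N ->
    rint (fun x => complex.Re (f x) * monomial b x) = 0.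
  move=> bN; have /(congr1 (@complex.Re R)) := mf b bN => /= H; rewrite -[RHS]H.
  apply: eq_Rintegral => x _; case: (f x) => u v /=.
  by rewrite mul0r subr0 mulrC.
have Im (b : multiindex n) : (mdegree b <= N)%N ->
    rint (fun x => complex.Im (f x) * monomial b x) = 0.
  move=> bN; have /(congr1 (@complex.Im R)) := mf b bN => /= H; rewrite -[RHS]H.
  apply: eq_Rintegral => x _; case: (f x) => u v /=.
  by rewrite mul0r addr0 mulrC.
have [S1 [m1 [l1 [a1 [Q1 [l10 aQ1 F1E S1E]]]]] S1le] := HKc _ _ _ cR cf Rsupp Rm domR M0.
have [S2 [m2 [l2 [a2 [Q2 [l20 aQ2 F2E S2E]]]]] S2le] := HKc _ _ _ cI cf Isupp Im domI M0.
exists (m1 + m2)%N, (osplit l1 l2),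
  (osplit (fun k x => a1 k x +i* 0) (fun k x => 0 +i* a2 k x)), (osplit Q1 Q2); split.
- by move=> k; rewrite /osplit; case: fintype.split.
- move=> k; rewrite /osplit; case: fintype.split => j.
    by have [cQ aQ] := aQ1 j; split=> //; exact: atom_on_Re.
  by have [cQ aQ] := aQ2 j; split=> //; exact: atom_on_Im.
- move=> x; rewrite big_split_ord /=.
  under eq_bigr do rewrite !osplit_lshift.
  under [X in _ + X]eq_bigr do rewrite !osplit_rshift.
  have -> : \sum_(i < m1) (l1 i)%:C * (a1 i x +i* 0) = complex.Re (f x) +i* 0.
    rewrite F1E; elim/big_ind2: _ => [//|? ? ? ? -> ->|i _].
      by apply/eqP; rewrite eq_complex /= addr0 !eqxx.
    by apply/eqP; rewrite eq_complex /= !mulr0 mul0r subr0 addr0 !eqxx.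
  have -> : \sum_(i < m2) (l2 i)%:C * (0 +i* a2 i x) = 0 +i* complex.Im (f x).
    rewrite F2E; elim/big_ind2: _ => [//|? ? ? ? -> ->|i _].
      by apply/eqP; rewrite eq_complex /= addr0 !eqxx.
    by apply/eqP; rewrite eq_complex /= !mulr0 mul0r subr0 addr0 !eqxx.
  by case: (f x) => u v; apply/eqP; rewrite eq_complex /= addr0 add0r !eqxx.
- have C0 : 0 < 2 * Kc + 1 by lra.
  apply: Lp_norm_dominated => // x.
    apply: sumr_ge0 => k _; apply: mulr_ge0 => //.
    by rewrite /osplit; case: fintype.split.
  rewrite big_split_ord /=.
  under eq_bigr do rewrite !osplit_lshift.
  under [X in (_ + X)%:E]eq_bigr do rewrite !osplit_rshift.
  apply: (@le_trans _ _ (Kc%:E * Mf x + Kc%:E * Mf x)%E).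
    rewrite EFinD; apply: leeD.
      by apply: le_trans (S1le x); rewrite lee_fin.
    by apply: le_trans (S2le x); rewrite lee_fin.
  rewrite -ge0_muleDl ?lee_fin// -EFinD; apply: lee_wpmul2r => //.
  by rewrite lee_fin; lra.
Qed.
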